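(* Let $N$ be an odd positive integer, $m$ a positive integer, and $\mathrm{Re}(y)>0$. Then $$\begin{aligned}&\sum_{n=1}^\infty \sigma_{2Nm-1+N}^{(N)}(n) e^{-ny}+ \frac{B_{2Nm}}{2Nmy} -\frac{(2m)!\,\zeta(2m+1)}{Ny^{2m+1}} \\ & =\frac{2(-1)^m}{\pi}\left(\frac{2\pi}{y}\right)^{2m+1}\sum_{n=1}^{\infty} S_{2Nm-1+N}^{(N)}(n)\Bigg[ \frac{1}{N}\sum_{k=-\frac{N-1}{2}}^{\frac{N-1}{2} }\left( \sinh\operatorname{Shi}-\cosh\operatorname{Chi}\right) \left( \left(\frac{(2\pi)^{N+1}n}{y}\right)^{\frac1N}e^{\frac{\pi i k}{N}}\right)+\sum_{j=1}^{m} (2Nj-1)!\left(\frac{(2\pi)^{N+1}n}{y}\right)^{-2j}\Bigg].\end{aligned}$$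
   Context: For $a\in\mathbb{C}$ and $n\in\mathbb{N}$, $\sigma_a^{(N)}(n)=\sum_{d^N\mid n}d^a$ and $S_a^{(N)}(n)=\sum_{d_1^Nd_2=n}d_2^{\frac{1+a}{N}-1}$ (sums over positive integers). $B_j$ are the Bernoulli numbers and $\zeta$ is the Riemann zeta function. The hyperbolic sine and cosine integrals are $$\mathrm{Shi}(z)=\int_0^z\frac{\sinh t}{t}\,dt,\qquad \mathrm{Chi}(z)=\gamma+\log z+\int_0^z\frac{\cosh t-1}{t}\,dt$$ with $\gamma$ Euler's constant and principal logarithm, and $$(\sinh\operatorname{Shi}-\cosh\operatorname{Chi})(z):=\sinh(z)\operatorname{Shi}(z)-\cosh(z)\operatorname{Chi}(z).$$ Powers take principal values. *)

(* Defs.v *)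
From Stdlib Require Import Reals ZArith Arith List.
From Coquelicot Require Import Coquelicot.
Open Scope R_scope.

(** Elementary functions on [C] *)

Definition Cexp (z : C) : C :=
  (exp (Re z) * cos (Im z), exp (Re z) * sin (Im z)).

Definition Csinh (z : C) : C := ((Cexp z - Cexp (- z)) / 2)%C.
Definition Ccosh (z : C) : C := ((Cexp z + Cexp (- z)) / 2)%C.

(* For z <> 0, the argument in (-PI, PI]: acos takes values in [0, PI]. *)
Definition Carg (z : C) : R :=
  if Rle_dec 0 (Im z) then acos (Re z / Cmod z) else - acos (Re z / Cmod z).

(* Principal logarithm and principal power; meaningful for z <> 0 only. *)
Definition Clog (z : C) : C := (ln (Cmod z), Carg z).
Definition Cpower (z w : C) : C := Cexp (w * Clog z)%C.

(* Integral from [0] to [z] along the straight segment.  The integrands used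
   below extend to entire functions, so the path is immaterial, and so is the
   value at the removable singularity [0], an end point of the segment. *)
Definition CInt0 (f : C -> C) (z : C) : C :=
  (z * RInt (V := C_R_CompleteNormedModule) (fun t : R => f (t * z)%C) 0 1)%C.

(** Special constants and functions *)

Definition euler_gamma : R :=
  real (Lim_seq (fun n => sum_n_m (fun k => / INR k) 1 n - ln (INR n))).

Definition Shi (z : C) : C := CInt0 (fun t => Csinh t / t)%C z.

Definition Chi (z : C) : C :=
  (euler_gamma + Clog z + CInt0 (fun t => (Ccosh t - 1) / t) z)%C.

Definition sinhShi_coshChi (z : C) : C :=
  (Csinh z * Shi z - Ccosh z * Chi z)%C.

(* The Riemann zeta function on the half-line s > 1. *)
Definition zeta (s : R) : R := Series (fun n => / Rpower (INR (S n)) s).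

(* [bernoulli_seq n] is the list of B_0, ..., B_n given by B_0 = 1 and
   sum_(k <= n) binom(n+1, k) B_k = 0 for n >= 1 (hence B_1 = -1/2).
   [Binomial.C] is the binomial coefficient, [C] being the complex numbers. *)
Fixpoint bernoulli_seq (n : nat) : list R :=
  match n with
  | O => 1 :: nil
  | S p =>
      let l := bernoulli_seq p in
      l ++ (- / INR (p + 2) *
              sum_n (fun k => Binomial.C (p + 2) k * nth k l 0) p) :: nil
  end.

Definition bernoulli (n : nat) : R := nth n (bernoulli_seq n) 0.

(** Arithmetic functions.  For n, N >= 1, d^N | n forces d <= n, and
    d1^N d2 = n forces d1, d2 <= n. *)

Definition sigma_pow (N : nat) (a : C) (n : nat) : C :=
  sum_n_m (fun d : nat =>
    if (n mod d ^ N =? 0)%nat then Cpower (INR d) a else RtoC 0) 1 n.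

Definition S_pow (N : nat) (a : C) (n : nat) : C :=
  sum_n_m (fun d1 : nat =>
    sum_n_m (fun d2 : nat =>
      if (d1 ^ N * d2 =? n)%nat
      then Cpower (INR d2) ((1 + a) / INR N - 1)%C else RtoC 0) 1 n) 1 n.

(* Sum of [f k] over the integers a <= k <= b. *)
Definition sum_Z (a b : Z) (f : Z -> C) : C :=
  fold_right (fun (i : nat) (s : C) => (f (a + Z.of_nat i)%Z + s)%C) (RtoC 0)
    (seq 0 (Z.to_nat (b - a + 1))).

(* Main.v *)
(* For a small angle [theta], [sinh Shi - cosh Chi] at [z] is the average over the two rays
   [u] in [(tan theta +- i) R_+] of the integral of [exp (-u) u / (u^2 - z^2)].  When [z] runs
   over the [N] values [X^(1/N) exp (pi i k / N)], partial fractions and the geometric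
   expansion of the resulting kernel (the finite sum over [j] removes its first terms)
   turn the bracket, for [n = d1^N d2] and [c = 2 pi d2 / y], into the integrals over two rays
   [x] in [(1 -+ i tan theta) R_+] of [x^(2Nm+2N-1) exp (-+ 2 pi i d1 x) / (x^(2N) + c^2)].
   The sum over [d2] is the expansion of [1 / (exp w - 1)] in partial fractions at
   [w = y x^N]; expanding this function as a geometric series, rotating each term back to
   the real axis and applying Poisson summation over [d1] produces the Lambert series, together
   with the integral of [x^(2Nm+N-1) exp (- k y x^N)], which yields [zeta (2m+1)].  The polar
   terms [1/w] and [-1/2] of the expansion give integrals of pure powers against
   [exp (-+ 2 pi i d1 x)], of which the first yields [B_(2Nm)] and the second cancels. *)

Require Import Defs.
From Stdlib Require Import Reals ZArith Arith Lra Lia Psatz List.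
From Coquelicot Require Import Coquelicot.
Open Scope R_scope.

(** * Calculus for complex-valued functions of a real variable *)

(** The tilt theta is a compromise. For [u] on the imaginary axis, that is for real [x], exp (-u)
    does not decay and absolute convergence over the divisor pairs is lost; too far from that axis
    the rays meet the poles [z], or [y x^N] leaves the right half plane. With eta = arg y both
    dangers are excluded by the single condition |eta| + N theta < pi/2. The delicate interchange of
    sums is the one between the geometric index [k] and the frequency [d]: for N = m = 1 the
    available bounds are of order k^-1 d^-2 and k^-2 d^-1, neither summable in both indices, while
    their geometric mean is. Oddness of [N] enters three times: the squares of the [N] values [z]
    are all the N-th roots of X^2, (-1)^(N m) equals (-1)^m, and the term -1/2 cancels because 2Nm +
    N is odd. One quantitative form of Poisson summation on [0, 1] also supplies the expansion of
    1/(exp w - 1), from exp (-w t), and the Fourier values of the Bernoulli numbers, from t^n. *)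

Lemma C_ext (z w : C) : Re z = Re w -> Im z = Im w -> z = w.
Proof. destruct z, w; simpl; intros; subst; reflexivity. Qed.

Lemma Cmod_sqr (z : C) : Cmod z * Cmod z = Re z * Re z + Im z * Im z.
Proof. pose proof (Cmod2_alt z); nra. Qed.

Lemma Re_le_Cmod (z : C) : Rabs (Re z) <= Cmod z.
Proof. eapply Rle_trans; [apply Rmax_l|apply Rmax_Cmod]. Qed.

Lemma Im_le_Cmod (z : C) : Rabs (Im z) <= Cmod z.
Proof. eapply Rle_trans; [apply Rmax_r|apply Rmax_Cmod]. Qed.

Lemma Cmod_le_abs (z : C) : Cmod z <= Rabs (Re z) + Rabs (Im z).
Proof.
  apply Rsqr_incr_0_var; [|pose proof (Rabs_pos (Re z)); pose proof (Rabs_pos (Im z)); lra].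
  unfold Rsqr; rewrite Cmod_sqr.
  pose proof (Rabs_pos (Re z)); pose proof (Rabs_pos (Im z)).
  pose proof (Rsqr_abs (Re z)); pose proof (Rsqr_abs (Im z)); unfold Rsqr in *; nra.
Qed.

Lemma Cexp_plus (z w : C) : Cexp (z + w) = (Cexp z * Cexp w)%C.
Proof.
  unfold Cexp, Cmult, Cplus; simpl; rewrite exp_plus, cos_plus, sin_plus.
  unfold Re, Im; apply injective_projections; simpl; ring.
Qed.

Lemma Cexp_0 : Cexp 0 = 1%C.
Proof. unfold Cexp; simpl; rewrite exp_0, cos_0, sin_0; apply C_ext; simpl; ring. Qed.

Lemma Cexp_RtoC (x : R) : Cexp x = RtoC (exp x).
Proof. unfold Cexp; simpl; rewrite cos_0, sin_0; apply C_ext; simpl; ring. Qed.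

Lemma Cexp_opp_l (z : C) : (Cexp (- z) * Cexp z)%C = 1%C.
Proof. rewrite <- Cexp_plus, Cplus_comm, Cplus_opp_r; apply Cexp_0. Qed.

Lemma Cmod_Cexp (z : C) : Cmod (Cexp z) = exp (Re z).
Proof.
  apply Rsqr_inj; [apply Cmod_ge_0|left; apply exp_pos|].
  unfold Rsqr; rewrite Cmod_sqr; unfold Cexp; simpl.
  pose proof (sin2_cos2 (Im z)) as H; unfold Rsqr in H.
  transitivity (exp (Re z) * exp (Re z) * (sin (Im z) * sin (Im z) + cos (Im z) * cos (Im z))); [ring|rewrite H; ring].
Qed.

Lemma Cexp_nz (z : C) : Cexp z <> 0%C.
Proof. apply Cmod_gt_0; rewrite Cmod_Cexp; apply exp_pos. Qed.

Lemma Cexp_opp (z : C) : Cexp (- z) = (/ Cexp z)%C.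
Proof.
  transitivity (Cexp (-z) * Cexp z / Cexp z)%C; [field|rewrite Cexp_opp_l; field]; apply Cexp_nz.
Qed.

Lemma Cexp_pow (z : C) (n : nat) : (Cexp z ^ n)%C = Cexp (INR n * z).
Proof.
  induction n as [|n IH].
  - simpl; rewrite Cmult_0_l, Cexp_0; reflexivity.
  - rewrite Cpow_S, IH, <- Cexp_plus; f_equal; rewrite S_INR, RtoC_plus; ring.
Qed.

(** Everything is componentwise, so that real derivatives and Riemann integrals of the two parts
    carry the calculus. Holomorphy enters only later, as a chain rule along curves ([chol]). *)
Definition cder (f : R -> C) (t : R) (l : C) : Prop :=
  is_derive (fun s => Re (f s)) t (Re l) /\ is_derive (fun s => Im (f s)) t (Im l).

Definition ccont (f : R -> C) (t : R) : Prop :=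
  continuous (fun s => Re (f s)) t /\ continuous (fun s => Im (f s)) t.

Definition cint (f : R -> C) (a b : R) (l : C) : Prop :=
  is_RInt (fun s => Re (f s)) a b (Re l) /\ is_RInt (fun s => Im (f s)) a b (Im l).

Lemma cder_ext (f g : R -> C) t l : (forall s, f s = g s) -> cder f t l -> cder g t l.
Proof.
  intros E [H1 H2]; split; [eapply is_derive_ext; [|apply H1]|eapply is_derive_ext; [|apply H2]];
  intros s; simpl; now rewrite E.
Qed.

Lemma cder_const (c : C) t : cder (fun _ => c) t 0.
Proof. split; apply (is_derive_const (V := R_NormedModule)). Qed.

Lemma cder_RtoC (f : R -> R) t l : is_derive f t l -> cder (fun s => RtoC (f s)) t l.
Proof. intros H; split; simpl; [exact H|apply (is_derive_const (V := R_NormedModule))]. Qed.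

Lemma cder_id t : cder (fun s => RtoC s) t 1.
Proof. apply (cder_RtoC (fun s => s)), (is_derive_id (K := R_AbsRing)). Qed.

Lemma cder_plus f g t a b : cder f t a -> cder g t b -> cder (fun s => f s + g s)%C t (a + b).
Proof. intros [] []; split; now apply (is_derive_plus (V := R_NormedModule)). Qed.

Lemma cder_opp f t a : cder f t a -> cder (fun s => - f s)%C t (- a).
Proof. intros []; split; now apply (is_derive_opp (V := R_NormedModule)). Qed.

Lemma cder_minus f g t a b : cder f t a -> cder g t b -> cder (fun s => f s - g s)%C t (a - b).
Proof. intros; apply cder_plus; [|apply cder_opp]; assumption. Qed.

Lemma cder_mult f g t a b :
  cder f t a -> cder g t b -> cder (fun s => f s * g s)%C t (a * g t + f t * b).
Proof.
  intros [F1 F2] [G1 G2].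
  pose proof (fun u v du dv (Hu : is_derive u t du) (Hv : is_derive v t dv) =>
    is_derive_mult u v t du dv Hu Hv Rmult_comm) as M.
  split.
  - pose proof (is_derive_minus _ _ _ _ _ (M _ _ _ _ F1 G1) (M _ _ _ _ F2 G2)) as H.
    evar_last; [exact H|].
    unfold minus, plus, opp, mult; simpl; unfold mult, Re, Im; simpl; ring.
  - pose proof (is_derive_plus _ _ _ _ _ (M _ _ _ _ F1 G2) (M _ _ _ _ F2 G1)) as H.
    evar_last; [exact H|].
    unfold minus, plus, opp, mult; simpl; unfold mult, Re, Im; simpl; ring.
Qed.

Lemma Csq_pos (z : C) : z <> 0%C -> 0 < Re z * Re z + Im z * Im z.
Proof.
  intros Hz; rewrite <- Cmod_sqr; apply Cmod_gt_0 in Hz; nra.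
Qed.

Lemma cder_Cexp f t a : cder f t a -> cder (fun s => Cexp (f s)) t (a * Cexp (f t)).
Proof.
  intros [F1 F2].
  set (u := fun s => Re (f s)) in *; set (v := fun s => Im (f s)) in *.
  assert (E1 := is_derive_unique _ _ _ F1 : Derive (fun s => u s) t = Re a).
  assert (E2 := is_derive_unique _ _ _ F2 : Derive (fun s => v s) t = Im a).
  assert (X1 : ex_derive u t) by (eexists; exact F1).
  assert (X2 : ex_derive v t) by (eexists; exact F2).
  split.
  - change (is_derive (fun s => exp (u s) * cos (v s)) t (Re (a * Cexp (f t))%C)).
    auto_derive; [now split|]. rewrite E1, E2; unfold Cexp, Cmult, u, v, Re, Im; simpl; ring.
  - change (is_derive (fun s => exp (u s) * sin (v s)) t (Im (a * Cexp (f t))%C)).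
    auto_derive; [now split|]. rewrite E1, E2; unfold Cexp, Cmult, u, v, Re, Im; simpl; ring.
Qed.

Lemma cder_pow f t a n :
  cder f t a -> cder (fun s => f s ^ n)%C t (INR n * a * f t ^ (pred n)).
Proof.
  intros H; induction n as [|n IH].
  - simpl pred. replace (INR 0 * a * f t ^ 0)%C with (RtoC 0) by (simpl; ring).
    apply (cder_ext (fun _ => 1%C)); [intros s; reflexivity|apply cder_const].
  - pose proof (cder_mult _ _ _ _ _ H IH) as M.
    replace (INR (S n) * a * f t ^ pred (S n))%C with (a * f t ^ n + f t * (INR n * a * f t ^ pred n))%C.
    { exact M. }
    rewrite S_INR, RtoC_plus; simpl pred.
    destruct n; [simpl; ring|]. simpl pred; rewrite Cpow_S; ring.
Qed.

Lemma cder_scal f t a (c : C) : cder f t a -> cder (fun s => c * f s)%C t (c * a).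
Proof.
  intros H. replace (c * a)%C with (0 * f t + c * a)%C by ring.
  apply cder_mult; [apply cder_const|assumption].
Qed.

Lemma cder_eq f t a b : cder f t a -> a = b -> cder f t b.
Proof. now intros ? <-. Qed.

Lemma cder_ccont f t a : cder f t a -> ccont f t.
Proof. intros [H1 H2]; split; apply (ex_derive_continuous (V := R_NormedModule)); eexists; eassumption. Qed.

Lemma ccont_ext f g t : (forall s, f s = g s) -> ccont f t -> ccont g t.
Proof. intros E [H1 H2]; split; [apply (continuous_ext (fun s => Re (f s)))|apply (continuous_ext (fun s => Im (f s)))]; auto; intros; now rewrite E. Qed.

Lemma ccont_const (c : C) t : ccont (fun _ => c) t.
Proof. eapply cder_ccont, cder_const. Qed.

Lemma ccont_RtoC f t : continuous f t -> ccont (fun s => RtoC (f s)) t.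
Proof. intros; split; [assumption|apply continuous_const]. Qed.

Lemma ccont_id t : ccont (fun s => RtoC s) t.
Proof. eapply cder_ccont, cder_id. Qed.

Lemma ccont_plus f g t : ccont f t -> ccont g t -> ccont (fun s => f s + g s)%C t.
Proof. intros [] []; split; now apply (continuous_plus (V := R_NormedModule)). Qed.

Lemma ccont_opp f t : ccont f t -> ccont (fun s => - f s)%C t.
Proof. intros []; split; now apply (continuous_opp (V := R_NormedModule)). Qed.

Lemma ccont_minus f g t : ccont f t -> ccont g t -> ccont (fun s => f s - g s)%C t.
Proof. intros; apply ccont_plus; [|apply ccont_opp]; assumption. Qed.

Lemma ccont_mult f g t : ccont f t -> ccont g t -> ccont (fun s => f s * g s)%C t.
Proof.
  intros [] []; split.
  - apply (continuous_minus (V := R_NormedModule)); now apply (continuous_mult (K := R_AbsRing)).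
  - apply (continuous_plus (V := R_NormedModule)); now apply (continuous_mult (K := R_AbsRing)).
Qed.

Lemma ccont_pow f t n : ccont f t -> ccont (fun s => f s ^ n)%C t.
Proof.
  intros H; induction n as [|n IH].
  { apply (ccont_ext (fun _ => 1%C)); [intros s; reflexivity|apply ccont_const]. }
  exact (ccont_mult _ _ _ H IH).
Qed.

Lemma ccont_inv f t : ccont f t -> f t <> 0%C -> ccont (fun s => / f s)%C t.
Proof.
  intros [H1 H2] Hz. pose proof (Csq_pos _ Hz) as Hp.
  assert (Hq : continuous (fun s => / (Re (f s) * Re (f s) + Im (f s) * Im (f s))) t).
  { apply continuous_Rinv_comp; [|lra].
    apply (continuous_plus (V := R_NormedModule)); now apply (continuous_mult (K := R_AbsRing)). }
  split.
  - apply (continuous_ext (fun s => Re (f s) * / (Re (f s) * Re (f s) + Im (f s) * Im (f s)))).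
    { intros s; unfold Cinv; simpl; unfold Re, Im, Rdiv; f_equal; f_equal; ring. }
    now apply (continuous_mult (K := R_AbsRing)).
  - apply (continuous_ext (fun s => - Im (f s) * / (Re (f s) * Re (f s) + Im (f s) * Im (f s)))).
    { intros s; unfold Cinv; simpl; unfold Re, Im, Rdiv; f_equal; f_equal; ring. }
    apply (continuous_mult (K := R_AbsRing)); [now apply (continuous_opp (V := R_NormedModule))|assumption].
Qed.

Lemma ccont_div f g t : ccont f t -> ccont g t -> g t <> 0%C -> ccont (fun s => f s / g s)%C t.
Proof. intros; apply ccont_mult; [|apply ccont_inv]; assumption. Qed.

Lemma ccont_Cexp f t : ccont f t -> ccont (fun s => Cexp (f s)) t.
Proof.
  intros [H1 H2]; split; unfold Cexp; simpl; apply (continuous_mult (K := R_AbsRing)).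
  - now apply continuous_exp_comp.
  - now apply continuous_cos_comp.
  - now apply continuous_exp_comp.
  - now apply continuous_sin_comp.
Qed.

Lemma cint_ext f g a b l :
  (forall x, Rmin a b < x < Rmax a b -> f x = g x) -> cint f a b l -> cint g a b l.
Proof.
  intros E [H1 H2]; split; [eapply is_RInt_ext; [|apply H1]|eapply is_RInt_ext; [|apply H2]];
  intros x Hx; simpl; now rewrite E.
Qed.

Lemma cint_unique f a b l l' : cint f a b l -> cint f a b l' -> l = l'.
Proof.
  intros [H1 H2] [H3 H4]; apply C_ext.
  - now rewrite <- (is_RInt_unique _ _ _ _ H1), <- (is_RInt_unique _ _ _ _ H3).
  - now rewrite <- (is_RInt_unique _ _ _ _ H2), <- (is_RInt_unique _ _ _ _ H4).
Qed.

Lemma cint_plus f g a b l k :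
  cint f a b l -> cint g a b k -> cint (fun x => f x + g x)%C a b (l + k).
Proof. intros [] []; split; now apply (is_RInt_plus (V := R_NormedModule)). Qed.

Lemma cint_scal f a b l (c : C) : cint f a b l -> cint (fun x => c * f x)%C a b (c * l).
Proof.
  intros [H1 H2]; split.
  - apply (is_RInt_minus (V := R_NormedModule)); now apply (is_RInt_scal (V := R_NormedModule)).
  - apply (is_RInt_plus (V := R_NormedModule)); now apply (is_RInt_scal (V := R_NormedModule)).
Qed.

Lemma cint_opp f a b l : cint f a b l -> cint (fun x => - f x)%C a b (- l).
Proof. intros []; split; now apply (is_RInt_opp (V := R_NormedModule)). Qed.

Lemma cint_minus f g a b l k :
  cint f a b l -> cint g a b k -> cint (fun x => f x - g x)%C a b (l - k).
Proof. intros; apply cint_plus; [|apply cint_opp]; assumption. Qed.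

Lemma cint_Chasles f a b c l k : cint f a b l -> cint f b c k -> cint f a c (l + k).
Proof. intros [] []; split; eapply (is_RInt_Chasles (V := R_NormedModule)); eassumption. Qed.

Lemma cint_point f a : cint f a a 0.
Proof. split; apply (is_RInt_point (V := R_NormedModule)). Qed.

Lemma cint_ex f a b :
  (forall x, Rmin a b <= x <= Rmax a b -> ccont f x) -> exists l, cint f a b l.
Proof.
  intros H.
  destruct (ex_RInt_continuous (V := R_CompleteNormedModule) (fun s => Re (f s)) a b) as [l1 H1].
  { intros x Hx; exact (proj1 (H x Hx)). }
  destruct (ex_RInt_continuous (V := R_CompleteNormedModule) (fun s => Im (f s)) a b) as [l2 H2].
  { intros x Hx; exact (proj2 (H x Hx)). }
  exists (l1, l2); split; assumption.
Qed.

Lemma cint_derive f df a b :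
  (forall x, Rmin a b <= x <= Rmax a b -> cder f x (df x)) ->
  (forall x, Rmin a b <= x <= Rmax a b -> ccont df x) ->
  cint df a b (f b - f a).
Proof.
  intros H1 H2; split.
  - apply (is_RInt_derive (V := R_CompleteNormedModule) (fun s => Re (f s)) (fun s => Re (df s)));
    intros x Hx; [exact (proj1 (H1 x Hx))|exact (proj1 (H2 x Hx))].
  - apply (is_RInt_derive (V := R_CompleteNormedModule) (fun s => Im (f s)) (fun s => Im (df s)));
    intros x Hx; [exact (proj2 (H1 x Hx))|exact (proj2 (H2 x Hx))].
Qed.

Lemma cint_is_RInt f a b l :
  cint f a b l <-> is_RInt (V := C_R_CompleteNormedModule) f a b l.
Proof.
  split.
  - intros [H1 H2]. destruct l as [l1 l2].
    exact (is_RInt_fct_extend_pair (U := R_NormedModule) (V := R_NormedModule) f a b l1 l2 H1 H2).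
  - intros H; split; [exact (is_RInt_fct_extend_fst (U := R_NormedModule) (V := R_NormedModule) f a b l H)|exact (is_RInt_fct_extend_snd (U := R_NormedModule) (V := R_NormedModule) f a b l H)].
Qed.

Lemma cint_norm_le f g a b l L :
  a <= b -> (forall x, a < x < b -> Cmod (f x) <= g x) ->
  cint f a b l -> is_RInt g a b L -> Cmod l <= L.
Proof.
  intros Hab Hle Hf Hg.
  (* [norm_RInt_le] wants the bound at the end points too. Resetting both integrands to 0 there
     changes no integral; this matters for quotients that take a default value at 0. *)
  set (inn := fun x => if Rlt_dec a x then if Rlt_dec x b then true else false else false).
  assert (Hinn : forall x, Rmin a b < x < Rmax a b -> inn x = true).
  { intros x; rewrite Rmin_left, Rmax_right by assumption; intros [H1 H2]; unfold inn.
    destruct Rlt_dec; [destruct Rlt_dec|]; lra || reflexivity. }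
  assert (Hf' : cint (fun x => if inn x then f x else 0%C) a b l).
  { eapply cint_ext; [|exact Hf]; intros x Hx; now rewrite Hinn. }
  assert (Hg' : is_RInt (fun x => if inn x then g x else 0) a b L).
  { eapply is_RInt_ext; [|exact Hg]; intros x Hx; now rewrite Hinn. }
  apply cint_is_RInt in Hf'.
  assert (E : forall z : C, norm (V := C_R_NormedModule) z = Cmod z) by (intros; symmetry; apply Cmod_norm).
  rewrite <- E.
  refine (norm_RInt_le (V := C_R_NormedModule) _ _ a b l L Hab _ Hf' Hg').
  intros x Hx; simpl.
  rewrite E. unfold inn.
  destruct Rlt_dec; [destruct Rlt_dec|]; rewrite ?Cmod_0; try lra. apply Hle; lra.
Qed.

Lemma cint_norm_le_const f a b l B :
  a <= b -> (forall x, a < x < b -> Cmod (f x) <= B) -> cint f a b l -> Cmod l <= (b - a) * B.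
Proof.
  intros Hab Hle Hf.
  exact (cint_norm_le f (fun _ => B) a b l _ Hab Hle Hf (is_RInt_const (V := R_NormedModule) a b B)).
Qed.

Lemma cint_norm_le_unit f l B : (forall x, 0 < x < 1 -> Cmod (f x) <= B) -> cint f 0 1 l -> Cmod l <= B.
Proof.
  intros Hle Hf. replace B with ((1 - 0) * B) by ring. exact (cint_norm_le_const f 0 1 l B Rle_0_1 Hle Hf).
Qed.

Lemma cint_comp_lin f u v a b l :
  cint f (u * a + v) (u * b + v) l -> cint (fun x => RtoC u * f (u * x + v)%R)%C a b l.
Proof.
  intros [H1 H2]; split.
  - apply (is_RInt_ext (fun y => scal u (Re (f (u * y + v))))).
    { intros; unfold scal; simpl; unfold mult; simpl; unfold Re, Im; ring. }
    exact (is_RInt_comp_lin (V := R_NormedModule) (fun s => Re (f s)) u v a b _ H1).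
  - apply (is_RInt_ext (fun y => scal u (Im (f (u * y + v))))).
    { intros; unfold scal; simpl; unfold mult; simpl; unfold Re, Im; ring. }
    exact (is_RInt_comp_lin (V := R_NormedModule) (fun s => Im (f s)) u v a b _ H2).
Qed.

(** * Improper integrals and series *)

Definition clim (F : R -> C) (l : C) : Prop :=
  is_lim (fun r => Re (F r)) p_infty (Re l) /\ is_lim (fun r => Im (F r)) p_infty (Im l).

(** The partial integrals are carried as a function [F], so existence of each of them is part of the
    statement and no default value of [RInt] can slip in. *)
Definition IInf (f : R -> C) (l : C) : Prop :=
  exists F : R -> C, (forall r, 0 <= r -> cint f 0 r (F r)) /\ clim F l.

Definition csum (a : nat -> C) (n : nat) : C := sum_n (G := C_AbelianMonoid) a n.

Definition cseries (a : nat -> C) (l : C) : Prop :=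
  is_series (fun n => Re (a n)) (Re l) /\ is_series (fun n => Im (a n)) (Im l).

Lemma clim_ext_loc F G l : (forall r, 0 <= r -> F r = G r) -> clim F l -> clim G l.
Proof.
  intros E [H1 H2]; split; (eapply is_lim_ext_loc; [|eassumption]);
  exists 0; intros r Hr; rewrite E by lra; reflexivity.
Qed.

Lemma clim_unique F l k : clim F l -> clim F k -> l = k.
Proof.
  intros [H1 H2] [H3 H4]; apply C_ext.
  - apply is_lim_unique in H1; apply is_lim_unique in H3; rewrite H1 in H3; now injection H3.
  - apply is_lim_unique in H2; apply is_lim_unique in H4; rewrite H2 in H4; now injection H4.
Qed.

Lemma clim_const (c : C) : clim (fun _ => c) c.
Proof. split; apply is_lim_const. Qed.

Lemma clim_plus F G l k : clim F l -> clim G k -> clim (fun r => F r + G r)%C (l + k).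
Proof.
  intros [] []; split; eapply is_lim_plus; try eassumption; reflexivity.
Qed.

Lemma clim_scal F l (c : C) : clim F l -> clim (fun r => c * F r)%C (c * l).
Proof.
  intros [H1 H2]; split; simpl.
  - apply (is_lim_minus _ _ _ (Re c * Re l) (Im c * Im l)).
    + exact (is_lim_scal_l _ (Re c) p_infty _ H1).
    + exact (is_lim_scal_l _ (Im c) p_infty _ H2).
    + reflexivity.
  - apply (is_lim_plus _ _ _ (Re c * Im l) (Im c * Re l)).
    + exact (is_lim_scal_l _ (Re c) p_infty _ H2).
    + exact (is_lim_scal_l _ (Im c) p_infty _ H1).
    + reflexivity.
Qed.

Lemma clim_opp F l : clim F l -> clim (fun r => - F r)%C (- l).
Proof. intros []; split; now apply (is_lim_opp _ p_infty (Finite _)). Qed.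

Lemma is_lim_abs_le_0 (f g : R -> R) :
  (exists r0, forall r, r0 <= r -> Rabs (f r) <= g r) -> is_lim g p_infty 0 -> is_lim f p_infty 0.
Proof.
  intros [r0 H] Hg.
  apply (is_lim_le_le_loc (fun r => - g r) g); [| |assumption].
  - exists r0; intros r Hr; specialize (H r (Rlt_le _ _ Hr)).
    apply Rabs_le_between in H; lra.
  - replace (Finite 0) with (Rbar_opp 0) by (simpl; f_equal; ring). now apply is_lim_opp.
Qed.

Lemma clim_Cmod_0 F g :
  (exists r0, forall r, r0 <= r -> Cmod (F r) <= g r) -> is_lim g p_infty 0 -> clim F 0.
Proof.
  intros [r0 H] Hg; split; simpl; (eapply is_lim_abs_le_0; [exists r0; intros r Hr|exact Hg]);
  (eapply Rle_trans; [|now apply H]); [apply Re_le_Cmod|apply Im_le_Cmod].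
Qed.

Lemma clim_comp F l (g : R -> R) :
  is_lim g p_infty p_infty -> clim F l -> clim (fun r => F (g r)) l.
Proof.
  intros Hg [H1 H2]; split.
  - apply (is_lim_comp (fun r => Re (F r)) g p_infty (Re l) p_infty H1 Hg). exists 0; discriminate.
  - apply (is_lim_comp (fun r => Im (F r)) g p_infty (Im l) p_infty H2 Hg). exists 0; discriminate.
Qed.

Lemma is_lim_Cmod F l : clim F l -> is_lim (fun r => Cmod (F r)) p_infty (Cmod l).
Proof.
  intros [H1 H2].
  apply (is_lim_ext (fun r => sqrt (Re (F r) * Re (F r) + Im (F r) * Im (F r)))).
  { intros r; rewrite <- Cmod_sqr; apply sqrt_square, Cmod_ge_0. }
  replace (Cmod l) with (sqrt (Re l * Re l + Im l * Im l)) by (rewrite <- Cmod_sqr; apply sqrt_square, Cmod_ge_0).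
  refine (is_lim_comp_continuous (fun r => Re (F r) * Re (F r) + Im (F r) * Im (F r)) sqrt p_infty _ _ (continuous_sqrt _)).
  apply (is_lim_plus _ _ _ (Re l * Re l) (Im l * Im l)); [| |reflexivity];
  apply (is_lim_mult _ _ _ (Finite _) (Finite _)); (assumption || exact I).
Qed.

Lemma clim_Cmod_le F l B : clim F l -> (forall r, 0 <= r -> Cmod (F r) <= B) -> Cmod l <= B.
Proof.
  intros H Hle. apply is_lim_Cmod in H.
  refine (is_lim_le_loc _ (fun _ => B) p_infty (Cmod l) B _ H (is_lim_const _ _)).
  exists 0; intros; apply Hle; lra.
Qed.

Lemma IInf_unique f l k : IInf f l -> IInf f k -> l = k.
Proof.
  intros [F [HF LF]] [G [HG LG]].
  apply (clim_unique F); [assumption|].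
  eapply clim_ext_loc; [|exact LG]. intros r Hr; eapply cint_unique; [now apply HG|now apply HF].
Qed.

Lemma IInf_ext f g l : (forall r, 0 < r -> f r = g r) -> IInf f l -> IInf g l.
Proof.
  intros E [F [HF LF]]; exists F; split; [|assumption].
  intros r Hr; eapply cint_ext; [|now apply HF].
  rewrite Rmin_left by assumption; intros x Hx; apply E; lra.
Qed.

Lemma IInf_plus f g l k : IInf f l -> IInf g k -> IInf (fun r => f r + g r)%C (l + k).
Proof.
  intros [F [HF LF]] [G [HG LG]]; exists (fun r => F r + G r)%C; split.
  - intros; apply cint_plus; auto.
  - now apply clim_plus.
Qed.

Lemma IInf_scal f l (c : C) : IInf f l -> IInf (fun r => c * f r)%C (c * l).
Proof.
  intros [F [HF LF]]; exists (fun r => c * F r)%C; split.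
  - intros; apply cint_scal; auto.
  - now apply clim_scal.
Qed.

Lemma IInf_minus f g l k : IInf f l -> IInf g k -> IInf (fun r => f r - g r)%C (l - k).
Proof.
  intros H1 H2. apply (IInf_ext (fun r => f r + (- (1)) * g r)%C); [intros; ring|].
  replace (l - k)%C with (l + (- (1)) * k)%C by ring. apply IInf_plus, IInf_scal; assumption.
Qed.

Lemma is_lim_scal_p_infty (u : R) : 0 < u -> is_lim (fun r => u * r) p_infty p_infty.
Proof.
  intros Hu; apply is_lim_spec; intros M. exists (M / u); intros r Hr.
  replace M with (u * (M / u)) by (field; lra). now apply Rmult_lt_compat_l.
Qed.

Lemma IInf_scale f l (u : R) : 0 < u -> IInf f l -> IInf (fun r => RtoC u * f (u * r)%R)%C l.
Proof.
  intros Hu [F [HF LF]]; exists (fun r => F (u * r)); split.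
  - intros r Hr. apply (cint_ext (fun x => RtoC u * f (u * x + 0)%R)%C).
    { intros; now rewrite Rplus_0_r. }
    apply cint_comp_lin. rewrite Rmult_0_r, !Rplus_0_r. apply HF; nra.
  - apply clim_comp; [now apply is_lim_scal_p_infty|assumption].
Qed.

Lemma IInf_Cmod_le f g l B :
  (forall r, 0 < r -> Cmod (f r) <= g r) ->
  (forall R, 0 <= R -> exists G, is_RInt g 0 R G /\ G <= B) -> IInf f l -> Cmod l <= B.
Proof.
  intros Hle HG [F [HF LF]]. apply (clim_Cmod_le F); [assumption|].
  intros r Hr. destruct (HG r Hr) as [G [H1 H2]].
  eapply Rle_trans; [|exact H2]. eapply cint_norm_le; [exact Hr| |now apply HF|exact H1].
  intros x Hx; apply Hle; lra.
Qed.

(** The limit exists along the integers, and monotonicity carries it to real arguments. *)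
Lemma is_lim_incr_bounded (F : R -> R) B :
  (forall r s, 0 <= r <= s -> F r <= F s) -> (forall r, 0 <= r -> F r <= B) ->
  exists l, is_lim F p_infty (Finite l).
Proof.
  intros Hinc HB.
  destruct (ex_finite_lim_seq_incr (fun n => F (INR n)) B) as [l Hl].
  { intros n; apply Hinc; rewrite S_INR; pose proof (pos_INR n); lra. }
  { intros n; apply HB, pos_INR. }
  exists l. apply is_lim_spec. intros eps.
  destruct (proj2 (is_lim_seq_spec _ _) Hl eps) as [n0 Hn].
  assert (Hup : forall r, 0 <= r -> F r <= l).
  { intros r Hr.
    assert (HR : Rbar_le (F r) l); [|exact HR].
    refine (is_lim_seq_le_loc (fun _ => F r) (fun n => F (INR n)) (F r) l _ (is_lim_seq_const _) Hl).
    - destruct (nfloor_ex r Hr) as [k Hk]. exists (S k); intros n Hkn. apply Hinc; split; [assumption|].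
      apply le_INR in Hkn; rewrite S_INR in Hkn; lra. }
  exists (INR n0); intros r Hr.
  pose proof (Hn n0 (Nat.le_refl _)) as H0. pose proof (pos_INR n0).
  pose proof (Hup r ltac:(lra)). pose proof (Hinc (INR n0) r ltac:(lra)).
  rewrite Rabs_left1 in H0 |- * by (try apply Rle_minus; try apply Hup; lra). lra.
Qed.

(* A real integrand [h] with [|h| <= g] is [(h + g) - g], a difference of nonnegative ones. *)
Lemma is_lim_RInt_dominated (h g : R -> R) B :
  (forall r, 0 <= r -> continuous h r) ->
  (forall r, 0 <= r -> Rabs (h r) <= g r) ->
  (forall R, 0 <= R -> exists G, is_RInt g 0 R G /\ G <= B) ->
  exists H l, (forall r, 0 <= r -> is_RInt h 0 r (H r)) /\ is_lim H p_infty (Finite l).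
Proof.
  intros Hc Hle HG.
  assert (EH : forall r, 0 <= r -> is_RInt h 0 r (RInt h 0 r)).
  { intros r Hr; apply (RInt_correct (V := R_CompleteNormedModule)), (ex_RInt_continuous (V := R_CompleteNormedModule)).
    rewrite Rmin_left by assumption; intros; apply Hc; lra. }
  assert (EG : forall r, 0 <= r -> is_RInt g 0 r (RInt g 0 r)).
  { intros r Hr; destruct (HG r Hr) as [G [HG1 _]]; apply (RInt_correct (V := R_CompleteNormedModule)); eexists; eassumption. }
  assert (BG : forall r, 0 <= r -> RInt g 0 r <= B).
  { intros r Hr; destruct (HG r Hr) as [G [HG1 HG2]]; now rewrite (is_RInt_unique _ _ _ _ HG1). }
  assert (Inc : forall (k : R -> R), (forall r, 0 <= r -> is_RInt k 0 r (RInt k 0 r)) -> (forall r, 0 <= r -> 0 <= k r) ->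
    forall r s, 0 <= r <= s -> RInt k 0 r <= RInt k 0 s).
  { intros k Hk Hk0 r s Hrs.
    assert (X : ex_RInt k 0 s) by (eexists; apply Hk; lra).
    assert (X1 : ex_RInt k r s).
    { apply (ex_RInt_Chasles_2 (V := R_CompleteNormedModule) k 0 r s Hrs X). }
    assert (X0 : ex_RInt k 0 r) by (eexists; apply Hk; lra).
    rewrite <- (RInt_Chasles (V := R_CompleteNormedModule) k 0 r s X0 X1).
    assert (0 <= RInt k r s).
    { apply RInt_ge_0; [lra|assumption|]. intros; apply Hk0; lra. }
    unfold plus; simpl; lra. }
  assert (EHG : forall r, 0 <= r -> is_RInt (fun x => h x + g x) 0 r (RInt h 0 r + RInt g 0 r)).
  { intros; apply (is_RInt_plus (V := R_NormedModule)); auto. }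
  assert (EHG' : forall r, 0 <= r -> RInt (fun x => h x + g x) 0 r = RInt h 0 r + RInt g 0 r).
  { intros; now apply is_RInt_unique, EHG. }
  destruct (is_lim_incr_bounded (fun r => RInt g 0 r) B) as [lg Hlg].
  { apply Inc; [exact EG|]. intros r Hr; eapply Rle_trans; [apply Rabs_pos|now apply Hle]. }
  { exact BG. }
  destruct (is_lim_incr_bounded (fun r => RInt (fun x => h x + g x) 0 r) (2 * B)) as [l Hl].
  { apply Inc. intros; rewrite EHG' by assumption; now apply EHG.
    intros r Hr; specialize (Hle r Hr); apply Rabs_le_between in Hle; lra. }
  { intros r Hr; rewrite EHG' by assumption.
    assert (RInt h 0 r <= RInt g 0 r).
    { apply RInt_le; [assumption|eexists; now apply EH|eexists; now apply EG|].
      intros x Hx; specialize (Hle x ltac:(lra)); apply Rabs_le_between in Hle; lra. }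
    specialize (BG r Hr); lra. }
  exists (fun r => RInt h 0 r), (l - lg); split; [exact EH|].
  apply (is_lim_ext_loc (fun r => RInt (fun x => h x + g x) 0 r - RInt g 0 r)).
  { exists 0; intros r Hr; rewrite EHG' by lra; ring. }
  apply (is_lim_minus _ _ _ l lg); [assumption|assumption|reflexivity].
Qed.

Lemma IInf_ex f g B :
  (forall r, 0 <= r -> ccont f r) ->
  (forall r, 0 <= r -> Cmod (f r) <= g r) ->
  (forall R, 0 <= R -> exists G, is_RInt g 0 R G /\ G <= B) -> exists l, IInf f l.
Proof.
  intros Hc Hle HG.
  destruct (is_lim_RInt_dominated (fun r => Re (f r)) g B) as [H1 [l1 [A1 L1]]]; try assumption.
  { intros r Hr; exact (proj1 (Hc r Hr)). }
  { intros; eapply Rle_trans; [apply Re_le_Cmod|auto]. }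
  destruct (is_lim_RInt_dominated (fun r => Im (f r)) g B) as [H2 [l2 [A2 L2]]]; try assumption.
  { intros r Hr; exact (proj2 (Hc r Hr)). }
  { intros; eapply Rle_trans; [apply Im_le_Cmod|auto]. }
  exists (l1, l2), (fun r => (H1 r, H2 r)); split; split; simpl; auto.
Qed.

(** The standard dominating function. Its integral over the half-line is p! / k^(p+1), and it is
    this power of [k] that later makes double families summable. *)
Definition edom (p : nat) (k r : R) : R := r ^ p * exp (- k * r).

Lemma edom_ge_0 p k r : 0 <= r -> 0 <= edom p k r.
Proof. intros; apply Rmult_le_pos; [now apply pow_le|left; apply exp_pos]. Qed.

Lemma edom_cont p k r : continuous (edom p k) r.
Proof. apply (ex_derive_continuous (V := R_NormedModule)); unfold edom; auto_derive; exact I. Qed.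

(** Induction on [p] by parts; the boundary term at [R] is nonpositive and is dropped, which gives a
    bound uniform in [R]. *)
Lemma edom_RInt p k K : 0 < k -> 0 <= K ->
  forall R, 0 <= R ->
  exists G, is_RInt (fun r => K * edom p k r) 0 R G /\ G <= K * (INR (fact p) / k ^ S p).
Proof.
  intros Hk HK R HR.
  assert (H : exists G, is_RInt (edom p k) 0 R G /\ G <= INR (fact p) / k ^ S p).
  { induction p as [|p [G [HG1 HG2]]].
    - exists (- exp (- k * R) / k - (- exp (- k * 0) / k)); split.
      + apply (is_RInt_derive (V := R_CompleteNormedModule) (fun r => - exp (- k * r) / k)).
        * intros x _; unfold edom; auto_derive; [exact I|field; lra].
        * intros x _; apply edom_cont.
      + rewrite Rmult_0_r, exp_0; simpl. pose proof (exp_pos (- k * R)).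
        assert (0 < / k) by (apply Rinv_0_lt_compat; lra). unfold Rdiv; rewrite !Rmult_1_r. nra.
    - exists ((- R ^ S p * exp (- k * R) / k - (- 0 ^ S p * exp (- k * 0) / k)) + INR (S p) / k * G); split.
      + apply (is_RInt_ext (fun r => (edom (S p) k r - INR (S p) / k * edom p k r) + scal (INR (S p) / k) (edom p k r))).
        { intros; unfold scal; simpl; unfold mult; simpl; ring. }
        apply (is_RInt_plus (V := R_NormedModule)); [|now apply (is_RInt_scal (V := R_NormedModule))].
        apply (is_RInt_derive (V := R_CompleteNormedModule) (fun r => - r ^ S p * exp (- k * r) / k)).
        * intros x _; unfold edom; auto_derive; [exact I|].
          change (Init.Nat.pred (S p)) with p. rewrite <- tech_pow_Rmult. 
          change (match p with 0%nat => 1 | S _ => INR p + 1 end) with (INR (S p)). field; lra.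
        * intros x _; apply (continuous_minus (V := R_NormedModule)); [apply edom_cont|].
          apply (continuous_scal_r (V := R_NormedModule) (INR (S p) / k) (edom p k)), edom_cont.
      + rewrite pow_i, fact_simpl, mult_INR by lia.
        assert (0 < / k) by (apply Rinv_0_lt_compat; lra).
        assert (0 <= R ^ S p) by now apply pow_le.
        pose proof (exp_pos (- k * R)). pose proof (pos_INR (S p)).
        assert (0 <= R ^ S p * exp (- k * R) / k).
        { apply Rmult_le_pos; [apply Rmult_le_pos|]; lra. }
        replace (INR (S p) * INR (fact p) / k ^ S (S p)) with (INR (S p) / k * (INR (fact p) / k ^ S p)).
        2:{ simpl pow. field. split; [apply pow_nonzero|]; lra. }
        assert (INR (S p) / k * G <= INR (S p) / k * (INR (fact p) / k ^ S p)).
        { apply Rmult_le_compat_l; [|assumption]. apply Rmult_le_pos; lra. }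
        lra. }
  destruct H as [G [HG1 HG2]]. exists (K * G); split.
  - exact (is_RInt_scal (V := R_NormedModule) (edom p k) 0 R K G HG1).
  - now apply Rmult_le_compat_l.
Qed.

Lemma IInf_ex_edom f p k K : 0 < k -> 0 <= K ->
  (forall r, 0 <= r -> ccont f r) ->
  (forall r, 0 <= r -> Cmod (f r) <= K * edom p k r) -> exists l, IInf f l.
Proof.
  intros Hk HK Hc Hle.
  exact (IInf_ex f (fun r => K * edom p k r) _ Hc Hle (edom_RInt p k K Hk HK)).
Qed.

Lemma IInf_Cmod_le_edom f l p k K : 0 < k -> 0 <= K ->
  (forall r, 0 < r -> Cmod (f r) <= K * edom p k r) -> IInf f l ->
  Cmod l <= K * (INR (fact p) / k ^ S p).
Proof.
  intros Hk HK Hle Hf.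
  exact (IInf_Cmod_le f (fun r => K * edom p k r) l _ Hle (edom_RInt p k K Hk HK) Hf).
Qed.

(** * Complex series: componentwise convergence, tails and domination *)

Lemma Re_csum a n : Re (csum a n) = sum_n (fun k => Re (a k)) n.
Proof.
  unfold csum; induction n; [now rewrite !sum_O|rewrite !sum_Sn, <- IHn; reflexivity].
Qed.

Lemma Im_csum a n : Im (csum a n) = sum_n (fun k => Im (a k)) n.
Proof.
  unfold csum; induction n; [now rewrite !sum_O|rewrite !sum_Sn, <- IHn; reflexivity].
Qed.

Lemma csum_O a : csum a 0 = a 0%nat.
Proof. exact (sum_O (G := C_AbelianMonoid) a). Qed.

Lemma csum_S a n : csum a (S n) = (csum a n + a (S n))%C.
Proof. exact (sum_Sn (G := C_AbelianMonoid) a n). Qed.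

Lemma csum_ext a b n : (forall k, (k <= n)%nat -> a k = b k) -> csum a n = csum b n.
Proof. exact (sum_n_ext_loc (G := C_AbelianMonoid) a b n). Qed.

Lemma csum_scal (c : C) a n : csum (fun k => c * a k)%C n = (c * csum a n)%C.
Proof. induction n; rewrite ?csum_O, ?csum_S, ?IHn; [reflexivity|ring]. Qed.

Lemma csum_plus a b n : csum (fun k => a k + b k)%C n = (csum a n + csum b n)%C.
Proof. induction n; rewrite ?csum_O, ?csum_S, ?IHn; [reflexivity|ring]. Qed.

Lemma csum_switch (a : nat -> nat -> C) m n :
  csum (fun i => csum (a i) n) m = csum (fun j => csum (fun i => a i j) m) n.
Proof. exact (sum_n_switch (G := C_AbelianMonoid) a m n). Qed.

Lemma Cmod_csum_le a u n : (forall k, Cmod (a k) <= u k) -> Cmod (csum a n) <= sum_n u n.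
Proof.
  intros H; induction n; [rewrite csum_O, sum_O; apply H|].
  rewrite csum_S, sum_Sn. eapply Rle_trans; [apply Cmod_triangle|].
  apply Rplus_le_compat; [assumption|apply H].
Qed.

Lemma cseries_is_series a l : cseries a l -> is_series (V := C_NormedModule) a l.
Proof.
  intros [H1 H2]. unfold is_series in *.
  intros P HP. destruct HP as [eps HP].
  destruct (proj1 (filterlim_locally _ _) H1 eps) as [n1 N1].
  destruct (proj1 (filterlim_locally _ _) H2 eps) as [n2 N2].
  exists (max n1 n2); intros n Hn. apply HP. split.
  - generalize (N1 n ltac:(lia)). now rewrite <- Re_csum.
  - generalize (N2 n ltac:(lia)). now rewrite <- Im_csum.
Qed.

Lemma cseries_ext a b l : (forall n, a n = b n) -> cseries a l -> cseries b l.
Proof.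
  intros E [H1 H2]; split; (eapply is_series_ext; [|eassumption]); intros; simpl; now rewrite E.
Qed.

Lemma cseries_unique a l k : cseries a l -> cseries a k -> l = k.
Proof.
  intros [H1 H2] [H3 H4]; apply C_ext.
  - now rewrite <- (is_series_unique _ _ H1), <- (is_series_unique _ _ H3).
  - now rewrite <- (is_series_unique _ _ H2), <- (is_series_unique _ _ H4).
Qed.

Lemma cseries_plus a b l k : cseries a l -> cseries b k -> cseries (fun n => a n + b n)%C (l + k).
Proof. intros [] []; split; now apply (is_series_plus (V := R_NormedModule)). Qed.

Lemma cseries_scal a l (c : C) : cseries a l -> cseries (fun n => c * a n)%C (c * l).
Proof.
  intros [H1 H2]; split.
  - apply (is_series_minus (V := R_NormedModule)); now apply (is_series_scal (V := R_NormedModule)).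
  - apply (is_series_plus (V := R_NormedModule)); now apply (is_series_scal (V := R_NormedModule)).
Qed.

Lemma cseries_minus a b l k : cseries a l -> cseries b k -> cseries (fun n => a n - b n)%C (l - k).
Proof. intros [] []; split; now apply (is_series_minus (V := R_NormedModule)). Qed.

Lemma cseries_RtoC a l : is_series a l -> cseries (fun n => RtoC (a n)) l.
Proof.
  intros H; split; [exact H|]. simpl.
  apply (is_series_ext (fun n => 0 * a n)); [intros; apply Rmult_0_l|].
  pose proof (is_series_scal_l 0 a l H) as X.
  change (is_series (fun n => 0 * a n) (0 * l)) in X. now rewrite (Rmult_0_l l) in X.
Qed.

Lemma cseries_Cmod (a : nat -> C) l (e : nat -> R) :
  (forall n, Cmod (l - csum a n) <= e n) -> is_lim_seq e 0 -> cseries a l.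
Proof.
  intros H He.
  assert (K : forall (h : C -> R), (forall z w : C, h (z - w)%C = h z - h w) -> (forall z, Rabs (h z) <= Cmod z) ->
    is_lim_seq (fun n => h (csum a n)) (h l)).
  { intros h Hl Hh. apply (is_lim_seq_ext (fun n => h l - h (l - csum a n)%C)).
    { intros n; rewrite Hl; ring. }
    replace (Finite (h l)) with (Rbar_minus (h l) 0) by (simpl; f_equal; ring).
    apply (is_lim_seq_minus _ _ (h l) 0); [apply is_lim_seq_const| |reflexivity].
    apply is_lim_seq_abs_0. apply (is_lim_seq_le_le (fun _ => 0) _ e); [|apply is_lim_seq_const|exact He].
    intros n; split; [apply Rabs_pos|]. eapply Rle_trans; [apply Hh|apply H]. }
  split.
  - change (is_lim_seq (sum_n (fun n => Re (a n))) (Re l)).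
    apply (is_lim_seq_ext (fun n => Re (csum a n))); [intros; apply Re_csum|].
    apply K; [reflexivity|apply Re_le_Cmod].
  - change (is_lim_seq (sum_n (fun n => Im (a n))) (Im l)).
    apply (is_lim_seq_ext (fun n => Im (csum a n))); [intros; apply Im_csum|].
    apply K; [reflexivity|apply Im_le_Cmod].
Qed.

Lemma cseries_lim_Cmod a l : cseries a l -> is_lim_seq (fun n => Cmod (l - csum a n)) 0.
Proof.
  intros [H1 H2].
  apply (is_lim_seq_le_le (fun _ => 0) _ (fun n => Rabs (Re l - sum_n (fun k => Re (a k)) n) + Rabs (Im l - sum_n (fun k => Im (a k)) n))).
  - intros n; split; [apply Cmod_ge_0|]. eapply Rle_trans; [apply Cmod_le_abs|].
    simpl. rewrite <- Re_csum, <- Im_csum. apply Rle_refl.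
  - apply is_lim_seq_const.
  - replace (Finite 0) with (Finite (0 + 0)) by (f_equal; ring).
    apply is_lim_seq_plus'.
    + replace 0 with (Rabs (Re l - Re l)) by (rewrite Rminus_diag, Rabs_R0; reflexivity).
      apply (is_lim_seq_abs _ (Finite _)), is_lim_seq_minus'; [apply is_lim_seq_const|exact H1].
    + replace 0 with (Rabs (Im l - Im l)) by (rewrite Rminus_diag, Rabs_R0; reflexivity).
      apply (is_lim_seq_abs _ (Finite _)), is_lim_seq_minus'; [apply is_lim_seq_const|exact H2].
Qed.

Lemma sum_n_le_Series u n : (forall k, 0 <= u k) -> ex_series u -> sum_n u n <= Series u.
Proof.
  intros H [l Hl]. rewrite (is_series_unique _ _ Hl).
  apply (is_lim_seq_incr_compare (sum_n u)); [exact Hl|].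
  intros k; rewrite sum_Sn; unfold plus; simpl; specialize (H (S k)); lra.
Qed.

Lemma cseries_ex a u : (forall n, Cmod (a n) <= u n) -> ex_series u -> exists l, cseries a l.
Proof.
  intros H Hu.
  destruct (ex_series_le (V := R_CompleteNormedModule) (fun n => Re (a n)) u) as [l1 H1]; [|exact Hu|].
  { intros n; eapply Rle_trans; [apply Re_le_Cmod|apply H]. }
  destruct (ex_series_le (V := R_CompleteNormedModule) (fun n => Im (a n)) u) as [l2 H2]; [|exact Hu|].
  { intros n; eapply Rle_trans; [apply Im_le_Cmod|apply H]. }
  exists (l1, l2); split; assumption.
Qed.

Lemma is_lim_seq_Cmod_le (z : C) (e : nat -> R) B :
  (forall n, Cmod z <= B + e n) -> is_lim_seq e 0 -> Cmod z <= B.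
Proof.
  intros H He.
  assert (X : Rbar_le (Cmod z) (B + 0)).
  { apply (is_lim_seq_le (fun _ => Cmod z) (fun n => B + e n)); [exact H|apply is_lim_seq_const|].
    apply is_lim_seq_plus'; [apply is_lim_seq_const|exact He]. }
  simpl in X; lra.
Qed.

Lemma sum_n_diff_le a (u : nat -> R) n m : (n <= m)%nat -> (forall k, Cmod (a k) <= u k) ->
  Cmod (csum a m - csum a n) <= sum_n u m - sum_n u n.
Proof.
  intros Hnm H; induction Hnm as [|m Hm IH].
  - replace (csum a n - csum a n)%C with (RtoC 0) by ring. rewrite Cmod_0; lra.
  - rewrite csum_S, sum_Sn.
    replace (csum a m + a (S m) - csum a n)%C with ((csum a m - csum a n) + a (S m))%C by ring.
    eapply Rle_trans; [apply Cmod_triangle|]. unfold plus; simpl. specialize (H (S m)); lra.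
Qed.

Lemma cseries_tail a u l n : (forall k, Cmod (a k) <= u k) -> ex_series u -> cseries a l ->
  Cmod (l - csum a n) <= Series u - sum_n u n.
Proof.
  intros H Hu Hl.
  assert (H0 : forall k, 0 <= u k) by (intros k; eapply Rle_trans; [apply Cmod_ge_0|apply H]).
  apply cseries_lim_Cmod in Hl.
  apply is_lim_seq_incr_n with (N := n) in Hl.
  apply (is_lim_seq_Cmod_le _ _ _) with (2 := Hl). intros k.
  replace (l - csum a n)%C with ((csum a (k + n) - csum a n) + (l - csum a (k + n)))%C by ring.
  eapply Rle_trans; [apply Cmod_triangle|]. apply Rplus_le_compat_r.
  eapply Rle_trans; [apply sum_n_diff_le with (u := u); [lia|exact H]|].
  pose proof (sum_n_le_Series u (k + n) H0 Hu); lra.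
Qed.

Lemma cseries_Cmod_le a u l : (forall k, Cmod (a k) <= u k) -> ex_series u -> cseries a l ->
  Cmod l <= Series u.
Proof.
  intros H Hu Hl.
  assert (H0 : forall k, 0 <= u k) by (intros k; eapply Rle_trans; [apply Cmod_ge_0|apply H]).
  pose proof (cseries_tail a u l 0 H Hu Hl) as T. rewrite csum_O, sum_O in T.
  replace l with ((l - a 0%nat) + a 0%nat)%C by ring.
  eapply Rle_trans; [apply Cmod_triangle|]. specialize (H 0%nat); lra.
Qed.

Lemma Series_tail_lim u : ex_series u -> is_lim_seq (fun n => Series u - sum_n u n) 0.
Proof.
  intros [l Hl]. rewrite (is_series_unique _ _ Hl).
  replace 0 with (l - l) by ring. apply is_lim_seq_minus'; [apply is_lim_seq_const|exact Hl].
Qed.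

Lemma IInf_csum (f : nat -> R -> C) (l : nat -> C) n :
  (forall n, IInf (f n) (l n)) -> IInf (fun r => csum (fun k => f k r) n) (csum l n).
Proof.
  intros H; induction n.
  - rewrite csum_O. apply (IInf_ext (f 0%nat)); [intros; now rewrite csum_O|apply H].
  - rewrite csum_S. eapply IInf_ext; [|apply IInf_plus; [exact IHn|apply (H (S n))]].
    intros; simpl; now rewrite csum_S.
Qed.

(* The tail of the pointwise series is bounded by [g] times a null sequence, so no
   uniform convergence is needed. *)
Lemma IInf_series (f : nat -> R -> C) (F : R -> C) (l : nat -> C) L u g B :
  (forall n, IInf (f n) (l n)) -> IInf F L ->
  (forall n r, 0 < r -> Cmod (f n r) <= u n * g r) -> ex_series u ->
  (forall R, 0 <= R -> exists G, is_RInt g 0 R G /\ G <= B) ->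
  (forall r, 0 < r -> 0 <= g r) -> (forall n, 0 <= u n) ->
  (forall r, 0 < r -> cseries (fun n => f n r) (F r)) -> cseries l L.
Proof.
  intros Hf HF Hle Hu HG Hg Hu0 Hs.
  apply cseries_Cmod with (e := fun n => (Series u - sum_n u n) * B).
  - intros n.
    pose proof (IInf_minus _ _ _ _ HF (IInf_csum f l n Hf)) as HI.
    apply (IInf_Cmod_le _ (fun r => (Series u - sum_n u n) * g r) _ _) with (3 := HI).
    + intros r Hr.
      assert (X : ex_series (fun n => u n * g r)) by now apply ex_series_scal_r.
      pose proof (cseries_tail _ (fun n => u n * g r) _ n (fun k => Hle k r Hr) X (Hs r Hr)) as T.
      rewrite Series_scal_r in T. eapply Rle_trans; [exact T|].
      assert (E : sum_n (fun n => u n * g r) n = sum_n u n * g r) by exact (sum_n_mult_r (K := R_Ring) (g r) u n).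
      rewrite E. lra.
    + intros R HR. destruct (HG R HR) as [G [H1 H2]].
      exists ((Series u - sum_n u n) * G); split.
      * exact (is_RInt_scal (V := R_NormedModule) g 0 R _ G H1).
      * apply Rmult_le_compat_l; [|assumption].
        pose proof (sum_n_le_Series u n Hu0 Hu); lra.
  - replace 0 with (0 * B) by ring.
    exact (is_lim_seq_scal_r _ B _ (Series_tail_lim u Hu)).
Qed.

Lemma is_lim_seq_inv_INR : is_lim_seq (fun n => / INR n) 0.
Proof.
  replace (Finite 0) with (Rbar_inv p_infty) by reflexivity.
  apply is_lim_seq_inv; [apply is_lim_seq_INR|discriminate].
Qed.

(** * Poisson summation and the Mittag-Leffler expansion *)

Definition freq (d : nat) : R := 2 * PI * INR (S d).

Lemma freq_pos d : 0 < freq d.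
Proof. unfold freq; pose proof PI_RGT_0; pose proof (lt_0_INR (S d) ltac:(lia)); nra. Qed.

(* [bern2''] is [-2] times the Dirichlet kernel of degree [D + 1], and [bern2 D] tends to [1/6] on [0, 1]. *)
Definition bern2 (D : nat) (t : R) : R := t * (1 - t) + sum_n (fun d => 4 * cos (freq d * t) / freq d ^ 2) D.
Definition bern2' (D : nat) (t : R) : R := 1 - 2 * t - sum_n (fun d => 4 * sin (freq d * t) / freq d) D.
Definition bern2'' (D : nat) (t : R) : R := - 2 - 4 * sum_n (fun d => cos (freq d * t)) D.

Lemma is_derive_sum_n (f df : nat -> R -> R) n t :
  (forall k, is_derive (f k) t (df k t)) ->
  is_derive (fun s => sum_n (fun k => f k s) n) t (sum_n (fun k => df k t) n).
Proof.
  intros H; induction n.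
  - rewrite sum_O. apply (is_derive_ext (f 0%nat)); [intros; now rewrite sum_O|apply H].
  - rewrite sum_Sn. apply (is_derive_ext (fun s => plus (sum_n (fun k => f k s) n) (f (S n) s))).
    { intros; now rewrite sum_Sn. }
    apply (is_derive_plus (V := R_NormedModule)); [exact IHn|apply H].
Qed.

Lemma sum_n_scal (c : R) (u : nat -> R) n : sum_n (fun k => c * u k) n = c * sum_n u n.
Proof. exact (sum_n_mult_l (K := R_Ring) c u n). Qed.

Lemma bern2_derive D t : is_derive (bern2 D) t (bern2' D t).
Proof.
  unfold bern2, bern2'.
  replace (1 - 2 * t - sum_n (fun d => 4 * sin (freq d * t) / freq d) D)
    with (plus (1 - 2 * t) (sum_n (fun d => - (4 * sin (freq d * t) / freq d)) D)).
  2:{ unfold plus; simpl.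
      rewrite (sum_n_ext _ (fun d => (-1) * (4 * sin (freq d * t) / freq d))) by (intros; simpl; ring).
      rewrite sum_n_scal; ring. }
  apply (is_derive_plus (V := R_NormedModule)).
  - auto_derive; [exact I|ring].
  - apply (is_derive_sum_n (fun d t => 4 * cos (freq d * t) / freq d ^ 2) (fun d t => - (4 * sin (freq d * t) / freq d))).
    intros d; pose proof (freq_pos d). auto_derive; [exact I|field; lra].
Qed.

Lemma bern2'_derive D t : is_derive (bern2' D) t (bern2'' D t).
Proof.
  unfold bern2', bern2''.
  replace (-2 - 4 * sum_n (fun d => cos (freq d * t)) D)
    with (minus (-2) (sum_n (fun d => 4 * cos (freq d * t)) D)).
  2:{ rewrite sum_n_scal. reflexivity. }
  apply (is_derive_minus (V := R_NormedModule)).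
  - auto_derive; [exact I|ring].
  - apply (is_derive_sum_n (fun d t => 4 * sin (freq d * t) / freq d) (fun d t => 4 * cos (freq d * t))).
    intros d; pose proof (freq_pos d). auto_derive; [exact I|field; lra].
Qed.

Lemma dirichlet_kernel D t :
  sin (PI * t) * bern2'' D t = - 2 * sin (INR (2 * D + 3) * (PI * t)).
Proof.
  unfold bern2''. set (x := PI * t).
  induction D.
  - rewrite sum_O. unfold freq.
    replace (2 * PI * INR 1 * t) with (2 * x) by (simpl; unfold x; ring).
    replace (INR (2 * 0 + 3) * x) with (2 * x + x) by (simpl; ring).
    rewrite sin_plus, cos_2a, sin_2a.
    pose proof (sin2_cos2 x) as H; unfold Rsqr in H.
    replace (cos x * cos x) with (1 - sin x * sin x) by lra.
    transitivity (-2 * sin x * (1 + 2 * (1 - 2 * (sin x * sin x)))); [ring|].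
    transitivity (-2 * sin x * (2 * (cos x * cos x) + (1 - 2 * (sin x * sin x)))); [|ring].
    replace (cos x * cos x) with (1 - sin x * sin x) by lra. ring.
  - rewrite sum_Sn. change plus with Rplus.
    replace (freq (S D) * t) with (INR (2 * D + 4) * x).
    2:{ unfold freq, x. rewrite !S_INR, plus_INR, mult_INR; simpl; ring. }
    replace (sin x * (-2 - 4 * (sum_n (fun d => cos (freq d * t)) D + cos (INR (2 * D + 4) * x))))
      with (sin x * (-2 - 4 * sum_n (fun d => cos (freq d * t)) D) - 4 * sin x * cos (INR (2 * D + 4) * x)) by ring.
    rewrite IHD.
    replace (INR (2 * S D + 3)) with (INR (2 * D + 4) + 1) by (rewrite <- S_INR; f_equal; lia).
    replace (INR (2 * D + 3)) with (INR (2 * D + 4) - 1) by (replace (2 * D + 4)%nat with (S (2 * D + 3)) by lia; rewrite S_INR; ring).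
    rewrite Rmult_minus_distr_r, Rmult_plus_distr_r, Rmult_1_l, sin_minus, sin_plus. ring.
Qed.

Lemma sin_freq_half d : sin (freq d * (1 / 2)) = 0.
Proof.
  apply sin_eq_0_1. exists (Z.of_nat (S d)). unfold freq; rewrite <- INR_IZR_INZ; field.
Qed.

Lemma cos_freq_1 d : cos (freq d) = 1.
Proof.
  replace (freq d) with (0 + 2 * INR (S d) * PI) by (unfold freq; ring).
  rewrite cos_period; apply cos_0.
Qed.

Lemma sin_freq_1 d : sin (freq d) = 0.
Proof.
  replace (freq d) with (0 + 2 * INR (S d) * PI) by (unfold freq; ring).
  rewrite sin_period; apply sin_0.
Qed.

Lemma sum_n_zero (u : nat -> R) n : (forall k, u k = 0) -> sum_n u n = 0.
Proof.
  intros H; induction n; [now rewrite sum_O|rewrite sum_Sn, IHn, H; unfold plus; simpl; ring].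
Qed.

Lemma bern2'_half D : bern2' D (1 / 2) = 0.
Proof.
  unfold bern2'. rewrite sum_n_zero; [field|].
  intros k; rewrite sin_freq_half; unfold Rdiv; ring.
Qed.

Lemma bern2'_0 D : bern2' D 0 = 1.
Proof.
  unfold bern2'. rewrite sum_n_zero; [ring|]. intros k; rewrite Rmult_0_r, sin_0; unfold Rdiv; ring.
Qed.

Lemma bern2'_1 D : bern2' D 1 = -1.
Proof.
  unfold bern2'. rewrite sum_n_zero; [ring|]. intros k; rewrite Rmult_1_r, sin_freq_1; unfold Rdiv; ring.
Qed.

Lemma bern2_sym D t : bern2 D (1 - t) = bern2 D t.
Proof.
  assert (E : forall d, 4 * cos (freq d * (1 - t)) / freq d ^ 2 = 4 * cos (freq d * t) / freq d ^ 2).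
  2:{ unfold bern2; f_equal; [ring|exact (sum_n_ext _ _ D E)]. }
  intros d. replace (freq d * (1 - t)) with (freq d - freq d * t) by ring.
  rewrite cos_minus, cos_freq_1, sin_freq_1; unfold Rdiv; ring.
Qed.

Lemma derive_bound (h dh : R -> R) a b B :
  a <= b -> (forall t, a <= t <= b -> is_derive h t (dh t)) ->
  (forall t, a <= t <= b -> Rabs (dh t) <= B) -> Rabs (h b - h a) <= B * (b - a).
Proof.
  intros Hab Hd HB.
  destruct (MVT_gen h a b dh) as [c [Hc E]].
  - rewrite Rmin_left, Rmax_right by assumption; intros; apply Hd; lra.
  - rewrite Rmin_left, Rmax_right by assumption; intros.
    apply continuity_pt_filterlim, (ex_derive_continuous (V := R_NormedModule)). eexists; now apply Hd.
  - rewrite Rmin_left, Rmax_right in Hc by assumption.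
    rewrite E, Rabs_mult, (Rabs_pos_eq (b - a)) by lra.
    apply Rmult_le_compat_r; [lra|now apply HB].
Qed.

Lemma sin_PI_lower t0 t : 0 < t0 <= t -> t <= 1 / 2 -> 0 < sin (PI * t0) <= sin (PI * t).
Proof.
  intros H1 H2; pose proof PI_RGT_0. split.
  - apply sin_gt_0; nra.
  - apply sin_incr_1; nra.
Qed.

(* Integrating the Dirichlet kernel by parts from [1/2], where [bern2'] vanishes. *)
Lemma bern2'_bound t0 : 0 < t0 <= 1 / 2 ->
  exists K, 0 <= K /\ forall D t, t0 <= t <= 1 / 2 -> Rabs (bern2' D t) <= K / INR (2 * D + 3).
Proof.
  intros Ht0. pose proof PI_RGT_0 as HP.
  set (m := sin (PI * t0)).
  assert (Hm : 0 < m) by (apply (sin_PI_lower t0 t0); lra).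
  exists (2 / (m * m) + 2 / (PI * m)).
  assert (P1 : 0 < 2 / (m * m)) by (apply Rdiv_lt_0_compat; nra).
  assert (P2 : 0 < 2 / (PI * m)) by (apply Rdiv_lt_0_compat; nra).
  split; [lra|].
  intros D t Ht. set (q := INR (2 * D + 3)).
  assert (Hq : 0 < q) by (apply lt_0_INR; lia).
  assert (Hqm : 0 < 2 / (q * (m * m))).
  { apply Rdiv_lt_0_compat; [lra|repeat apply Rmult_lt_0_compat; assumption]. }
  assert (Hqp : 0 < 2 / (q * PI)) by (apply Rdiv_lt_0_compat; nra).
  assert (Ht1 : 1 / 2 - t <= 1) by lra.
  (* Removing the boundary term of this integration by parts leaves the derivative [W'], in which
     the factor 1 / q has been gained. *)
  set (W := fun s => bern2' D s - 2 / (q * PI) * (cos (q * (PI * s)) / sin (PI * s))).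
  set (W' := fun s => 2 / q * (cos (q * (PI * s)) * cos (PI * s) / (sin (PI * s) * sin (PI * s)))).
  assert (HW : forall s, t <= s <= 1 / 2 -> is_derive W s (W' s)).
  { intros s Hs. destruct (sin_PI_lower t0 s) as [S1 S2]; [lra|lra|]. fold m in S1, S2.
    unfold W. evar_last.
    - apply (is_derive_minus (V := R_NormedModule)); [apply bern2'_derive|].
      auto_derive; [lra|reflexivity].
    - pose proof (dirichlet_kernel D s) as K. fold q in K.
      unfold minus, plus, opp; simpl. unfold W'.
      replace (bern2'' D s) with (-2 * sin (q * (PI * s)) / sin (PI * s)).
      2:{ rewrite <- K; field; lra. }
      field. repeat split; lra. }
  assert (BW : Rabs (W (1 / 2) - W t) <= 2 / (q * (m * m)) * (1 / 2 - t)).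
  { apply (derive_bound W W'); [lra|exact HW|].
    intros s Hs. destruct (sin_PI_lower t0 s) as [S1 S2]; [lra|lra|]. fold m in S1, S2.
    unfold W'. rewrite Rabs_mult, (Rabs_pos_eq (2 / q)) by (left; apply Rdiv_lt_0_compat; lra).
    replace (2 / (q * (m * m))) with (2 / q * (1 / (m * m))) by (field; lra).
    apply Rmult_le_compat_l; [left; apply Rdiv_lt_0_compat; lra|].
    unfold Rdiv. rewrite !Rabs_mult, Rabs_inv, (Rabs_pos_eq (sin _ * sin _)) by nra.
    assert (Rabs (cos (q * (PI * s))) <= 1) by (apply Rabs_le, COS_bound).
    assert (Rabs (cos (PI * s)) <= 1) by (apply Rabs_le, COS_bound).
    pose proof (Rabs_pos (cos (q * (PI * s)))). pose proof (Rabs_pos (cos (PI * s))).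
    apply Rmult_le_compat; [nra| |nra|].
    - left; apply Rinv_0_lt_compat; nra.
    - apply Rinv_le_contravar; nra. }
  (* Since [q] is odd, cos (q pi / 2) = 0 and the boundary term vanishes at 1 / 2. *)
  assert (W0 : W (1 / 2) = 0).
  { unfold W. rewrite bern2'_half.
    replace (q * (PI * (1 / 2))) with (PI / 2 + 2 * 0 * PI + INR (D + 1) * PI).
    2:{ unfold q. rewrite !plus_INR, mult_INR; simpl; field. }
    replace (PI / 2 + 2 * 0 * PI + INR (D + 1) * PI) with (INR (D + 1) * PI + PI / 2) by ring.
    rewrite cos_plus, cos_PI2, sin_PI2.
    replace (sin (INR (D + 1) * PI)) with 0; [unfold Rdiv; ring|].
    symmetry; apply sin_eq_0_1; exists (Z.of_nat (D + 1)); now rewrite <- INR_IZR_INZ. }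
  rewrite W0 in BW.
  destruct (sin_PI_lower t0 t) as [S1 S2]; [lra|lra|]. fold m in S1, S2.
  replace (bern2' D t) with (- (0 - W t) + 2 / (q * PI) * (cos (q * (PI * t)) / sin (PI * t))) by (unfold W; ring).
  eapply Rle_trans; [apply Rabs_triang|]. rewrite Rabs_Ropp.
  replace ((2 / (m * m) + 2 / (PI * m)) / q) with (2 / (q * (m * m)) * 1 + 2 / (q * PI) * (1 / m)) by (field; lra).
  apply Rplus_le_compat.
  - eapply Rle_trans; [exact BW|]. apply Rmult_le_compat_l; [left; exact Hqm|exact Ht1].
  - rewrite Rabs_mult, (Rabs_pos_eq (2 / (q * PI))) by (left; exact Hqp).
    apply Rmult_le_compat_l; [left; exact Hqp|].
    unfold Rdiv; rewrite Rabs_mult, Rabs_inv, (Rabs_pos_eq (sin _)) by lra.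
    apply Rmult_le_compat; [apply Rabs_pos|left; apply Rinv_0_lt_compat; lra|apply Rabs_le, COS_bound|].
    apply Rinv_le_contravar; lra.
Qed.

(** The term added at frequency 2 pi n is at most 1 / (pi^2 n^2), which is below the telescoping
    difference 1 / (n-1) - 1 / n. *)
Lemma bern2_tail D E t : (D <= E)%nat -> Rabs (bern2 E t - bern2 D t) <= / INR (S D) - / INR (S E).
Proof.
  intros H; induction H as [|E H IH].
  - rewrite Rminus_diag, Rabs_R0; lra.
  - replace (bern2 (S E) t - bern2 D t) with ((bern2 E t - bern2 D t) + 4 * cos (freq (S E) * t) / freq (S E) ^ 2).
    2:{ unfold bern2; rewrite sum_Sn; unfold plus; simpl; ring. }
    eapply Rle_trans; [apply Rabs_triang|].
    assert (K : Rabs (4 * cos (freq (S E) * t) / freq (S E) ^ 2) <= / INR (S E) - / INR (S (S E))).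
    { pose proof (lt_0_INR (S E) ltac:(lia)). pose proof PI_RGT_0. pose proof PI2_3_2.
      replace (/ INR (S E) - / INR (S (S E))) with (1 * / (INR (S E) * INR (S (S E)))).
      2:{ rewrite (S_INR (S E)). field; lra. }
      replace (4 * cos (freq (S E) * t) / freq (S E) ^ 2) with (cos (freq (S E) * t) * / (PI * PI * (INR (S (S E)) * INR (S (S E))))).
      2:{ set (c := cos (freq (S E) * t)). unfold freq. field. rewrite S_INR; lra. }
      rewrite Rabs_mult, Rabs_inv. rewrite S_INR in *.
      apply Rmult_le_compat; [apply Rabs_pos| |apply Rabs_le, COS_bound|].
      - left; apply Rinv_0_lt_compat, Rabs_pos_lt. rewrite S_INR; nra.
      - rewrite S_INR. set (e := INR E) in *. rewrite Rabs_pos_eq by nra.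
        apply Rinv_le_contravar; [nra|]. assert (1 <= PI * PI) by nra. assert (0 < (e + 1 + 1) * (e + 1 + 1)) by nra. nra. }
    lra.
Qed.

(** As [E] grows, [bern2' E] tends to 0 uniformly on [t, 1/2], so [bern2 E] becomes constant there;
    passing from [D] to [E] costs at most 1 / (D+1) at each of the two points. The limiting constant
    itself is never evaluated. *)
Lemma bern2_const_open D t : 0 < t <= 1 / 2 -> Rabs (bern2 D t - bern2 D (1 / 2)) <= 2 / INR (S D).
Proof.
  intros Ht.
  destruct (bern2'_bound t Ht) as [K [HK HB]].
  assert (X : Rbar_le (Rabs (bern2 D t - bern2 D (1 / 2))) (2 / INR (S D) + K * 0)).
  { refine (is_lim_seq_le_loc (fun _ => Rabs (bern2 D t - bern2 D (1 / 2))) (fun n => 2 / INR (S D) + K * / INR n) _ _ _ (is_lim_seq_const _) _).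
    - exists (S D); intros E HE.
      pose proof (bern2_tail D E t ltac:(lia)) as T1. pose proof (bern2_tail D E (1 / 2) ltac:(lia)) as T2.
      assert (0 < / INR (S E)) by (apply Rinv_0_lt_compat, lt_0_INR; lia).
      assert (T3 : Rabs (bern2 E (1 / 2) - bern2 E t) <= K / INR (2 * E + 3) * (1 / 2 - t)).
      { apply (derive_bound (bern2 E) (bern2' E)); [lra|intros; apply bern2_derive|intros; now apply HB]. }
      assert (T4 : K / INR (2 * E + 3) * (1 / 2 - t) <= K * / INR E).
      { assert (I1 : 0 < / INR (2 * E + 3)) by (apply Rinv_0_lt_compat, lt_0_INR; lia).
        assert (/ INR (2 * E + 3) <= / INR E) by (apply Rinv_le_contravar; [apply lt_0_INR; lia|apply le_INR; lia]).
        unfold Rdiv. assert (0 <= K * / INR (2 * E + 3)) by nra. nra. }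
      replace (bern2 D t - bern2 D (1 / 2)) with (- (bern2 E t - bern2 D t) + ((bern2 E (1 / 2) - bern2 D (1 / 2)) + - (bern2 E (1 / 2) - bern2 E t))) by ring.
      eapply Rle_trans; [apply Rabs_triang|]. rewrite Rabs_Ropp.
      eapply Rle_trans; [apply Rplus_le_compat_l, Rabs_triang|]. rewrite Rabs_Ropp. unfold Rdiv in *; lra.
    - apply is_lim_seq_plus'; [apply is_lim_seq_const|].
      apply (is_lim_seq_scal_l _ K 0).
      apply is_lim_seq_inv_INR. }
  unfold Rbar_le in X; lra.
Qed.

(** The bound on (0, 1/2] does not depend on [t], so continuity adds the point 0, and the symmetry
    about 1/2 adds the other half. *)
Lemma bern2_osc D t : 0 <= t <= 1 -> Rabs (bern2 D t - bern2 D 0) <= 4 / INR (S D).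
Proof.
  intros Ht.
  assert (H0 : Rabs (bern2 D 0 - bern2 D (1 / 2)) <= 2 / INR (S D)).
  { assert (X : Rbar_le (Rabs (bern2 D 0 - bern2 D (1 / 2))) (2 / INR (S D))); [|exact X].
    assert (C : continuous (bern2 D) 0).
    { apply (ex_derive_continuous (V := R_NormedModule)); eexists; apply bern2_derive. }
    refine (is_lim_seq_le_loc (fun n => Rabs (bern2 D (/ INR n) - bern2 D (1 / 2))) (fun _ => 2 / INR (S D)) _ _ _ _ (is_lim_seq_const _)).
    - exists 2%nat; intros n Hn. apply bern2_const_open. 
      assert (2 <= INR n) by (apply (le_INR 2); lia).
      split; [apply Rinv_0_lt_compat; lra|]. replace (1 / 2) with (/ 2) by lra. apply Rinv_le_contravar; lra.
    - apply (is_lim_seq_abs _ (Finite _)), is_lim_seq_minus'; [|apply is_lim_seq_const].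
      apply (is_lim_seq_continuous (bern2 D)); [now apply continuity_pt_filterlim|].
      apply is_lim_seq_inv_INR. }
  assert (Hh : forall s, 0 <= s <= 1 / 2 -> Rabs (bern2 D s - bern2 D (1 / 2)) <= 2 / INR (S D)).
  { intros s [Hs1 Hs2]. destruct Hs1 as [Hs1|<-]; [apply bern2_const_open; lra|exact H0]. }
  assert (Ha : Rabs (bern2 D t - bern2 D (1 / 2)) <= 2 / INR (S D)).
  { destruct (Rle_dec t (1 / 2)); [apply Hh; lra|]. rewrite <- bern2_sym. apply Hh; lra. }
  replace (bern2 D t - bern2 D 0) with ((bern2 D t - bern2 D (1 / 2)) + - (bern2 D 0 - bern2 D (1 / 2))) by ring.
  eapply Rle_trans; [apply Rabs_triang|]. rewrite Rabs_Ropp. unfold Rdiv in *; lra.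
Qed.

Lemma cint_csum (f : nat -> R -> C) a b (l : nat -> C) n :
  (forall k, cint (f k) a b (l k)) -> cint (fun t => csum (fun k => f k t) n) a b (csum l n).
Proof.
  intros H; induction n.
  - rewrite csum_O. eapply cint_ext; [|apply (H 0%nat)]. intros; now rewrite csum_O.
  - rewrite csum_S. eapply cint_ext; [|apply cint_plus; [exact IHn|apply (H (S n))]].
    intros; simpl; now rewrite csum_S.
Qed.

Lemma RtoC_sum_n (u : nat -> R) n : RtoC (sum_n u n) = csum (fun k => RtoC (u k)) n.
Proof.
  induction n; [now rewrite sum_O, csum_O|rewrite sum_Sn, csum_S, <- IHn].
  unfold plus; simpl; now rewrite RtoC_plus.
Qed.

(** The trapezoidal rule corrected by finitely many cosine coefficients. Integrating by parts twice
    against [bern2 D], recentred at its value at 0, turns the defect into an integral of [f2] with a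
    kernel of size O(1/D). *)
Lemma poisson_unit (f f1 f2 : R -> C) I0 (J : nat -> C) g G D :
  (forall t, 0 <= t <= 1 -> cder f t (f1 t)) ->
  (forall t, 0 <= t <= 1 -> cder f1 t (f2 t)) ->
  (forall t, 0 <= t <= 1 -> ccont f2 t) ->
  cint f 0 1 I0 ->
  (forall d, cint (fun t => RtoC (cos (freq d * t)) * f t)%C 0 1 (J d)) ->
  (forall t, 0 < t < 1 -> Cmod (f2 t) <= g t) -> is_RInt g 0 1 G ->
  Cmod ((f 0 + f 1) / 2 - I0 - 2 * csum J D)%C <= 2 / INR (S D) * G.
Proof.
  intros H1 H2 H3 HI HJ Hle HG.
  (* The sum of [P'] and [bern2'' D * f] is the small kernel times [f2]. Subtracting [bern2 D 0]
     makes the kernel small and removes the boundary terms in [f1]; the values 1 and -1 of [bern2']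
     at the ends produce f 0 + f 1. *)
  set (P := fun t => (RtoC (bern2 D t - bern2 D 0) * f1 t - RtoC (bern2' D t) * f t)%C).
  set (P' := fun t => (RtoC (bern2 D t - bern2 D 0) * f2 t - RtoC (bern2'' D t) * f t)%C).
  assert (DP : forall t, 0 <= t <= 1 -> cder P t (P' t)).
  { intros t Ht. eapply cder_eq.
    - apply cder_minus.
      + apply cder_mult; [apply (cder_RtoC (fun t => bern2 D t - bern2 D 0))|now apply H2].
        apply (is_derive_minus (V := R_NormedModule)); [apply bern2_derive|apply (is_derive_const (V := R_NormedModule))].
      + apply cder_mult; [apply (cder_RtoC (bern2' D)), bern2'_derive|now apply H1].
    - unfold P', minus, plus, opp, zero; simpl. rewrite Ropp_0, Rplus_0_r. ring. }
  assert (Cb : forall t, continuous (fun t => bern2 D t - bern2 D 0) t).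
  { intros t; apply (ex_derive_continuous (V := R_NormedModule)); eexists.
    apply (is_derive_minus (V := R_NormedModule)); [apply bern2_derive|apply (is_derive_const (V := R_NormedModule))]. }
  assert (Cb2 : forall t, continuous (bern2'' D) t).
  { intros t. apply (ex_derive_continuous (V := R_NormedModule)). exists (minus 0 (4 * sum_n (fun d => - (freq d * sin (freq d * t))) D)).
    unfold bern2''. apply (is_derive_minus (V := R_NormedModule)); [apply (is_derive_const (V := R_NormedModule))|].
    apply is_derive_scal. apply (is_derive_sum_n (fun d t => cos (freq d * t)) (fun d t => - (freq d * sin (freq d * t)))).
    intros d; auto_derive; [exact I|ring]. }
  assert (IP : cint P' 0 1 (P 1 - P 0)).
  { apply cint_derive; rewrite Rmin_left, Rmax_right by lra; [exact DP|].
    intros t Ht; apply ccont_minus; apply ccont_mult; try (apply ccont_RtoC; auto); auto.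
    eapply cder_ccont, H1; exact Ht. }
  assert (I2 : cint (fun t => RtoC (bern2'' D t) * f t)%C 0 1 ((- 2) * I0 + (- 4) * csum J D)).
  { eapply cint_ext; [|apply cint_plus; [apply cint_scal, HI|apply cint_scal, cint_csum, HJ]].
    intros t _; simpl. unfold bern2''. rewrite RtoC_minus, RtoC_mult, RtoC_sum_n.
    rewrite (csum_ext (fun k => RtoC (cos (freq k * t)) * f t)%C (fun k => f t * RtoC (cos (freq k * t)))%C) by (intros; ring).
    rewrite csum_scal. ring. }
  pose proof (cint_plus _ _ _ _ _ _ IP I2) as I3.
  assert (Hbd : Cmod (P 1 - P 0 + ((- 2) * I0 + (- 4) * csum J D))%C <= 4 / INR (S D) * G).
  { refine (cint_norm_le _ (fun t => 4 / INR (S D) * g t) 0 1 _ _ Rle_0_1 _ I3 _).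
    - intros t Ht. unfold P'.
      replace (RtoC (bern2 D t - bern2 D 0) * f2 t - RtoC (bern2'' D t) * f t + RtoC (bern2'' D t) * f t)%C
        with (RtoC (bern2 D t - bern2 D 0) * f2 t)%C by ring.
      rewrite Cmod_mult, Cmod_R. apply Rmult_le_compat; [apply Rabs_pos|apply Cmod_ge_0|apply bern2_osc; lra|now apply Hle].
    - exact (is_RInt_scal (V := R_NormedModule) g 0 1 _ G HG). }
  replace (P 1 - P 0 + ((- 2) * I0 + (- 4) * csum J D))%C
    with (2 * ((f 0 + f 1) / 2 - I0 - 2 * csum J D))%C in Hbd.
  2:{ unfold P. rewrite bern2'_0, bern2'_1, Rminus_diag.
      replace (bern2 D 1) with (bern2 D 0) by (rewrite <- (bern2_sym D 0); f_equal; ring).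
      rewrite Rminus_diag. replace (RtoC (-1)) with (- RtoC 1)%C by (rewrite <- RtoC_opp; reflexivity).
      replace (RtoC (-2)) with (- RtoC 2)%C by (rewrite <- RtoC_opp; reflexivity).
      replace (RtoC (-4)) with (- (RtoC 2 * RtoC 2))%C by (rewrite <- RtoC_mult, <- RtoC_opp; f_equal; ring).
      field. }
  rewrite Cmod_mult, Cmod_R, (Rabs_pos_eq 2) in Hbd by lra. unfold Rdiv in *; lra.
Qed.

Lemma exp_le x y : x <= y -> exp x <= exp y.
Proof. intros [H| ->]; [left; now apply exp_increasing|apply Rle_refl]. Qed.

Lemma ex_series_inv_sq : ex_series (fun n => / INR (S n) ^ 2).
Proof.
  assert (T : is_series (fun n => / INR (S n) - / INR (S (S n))) 1).
  { change (is_lim_seq (sum_n (fun n => / INR (S n) - / INR (S (S n)))) 1).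
    apply (is_lim_seq_ext (fun n => 1 - / INR (S (S n)))).
    - induction n as [|n IH]; [rewrite sum_O; simpl; field|].
      rewrite sum_Sn, <- IH. change plus with Rplus. ring.
    - replace (Finite 1) with (Finite (1 - 0)) by (f_equal; ring).
      apply is_lim_seq_minus'; [apply is_lim_seq_const|].
      apply (is_lim_seq_incr_1 (fun n => / INR (S n))), (is_lim_seq_incr_1 (fun n => / INR n)).
      apply is_lim_seq_inv_INR. }
  apply (ex_series_le (K := R_AbsRing) (V := R_CompleteNormedModule) _ (fun n => 2 * (/ INR (S n) - / INR (S (S n))))).
  - intros n. change norm with Rabs. pose proof (pos_INR n). rewrite !S_INR.
    rewrite Rabs_pos_eq by (left; apply Rinv_0_lt_compat; nra).
    replace (2 * (/ (INR n + 1) - / (INR n + 1 + 1))) with (/ ((INR n + 1) * ((INR n + 1 + 1) / 2))) by (field; lra).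
    apply Rinv_le_contravar; nra.
  - exists (2 * 1). exact (is_series_scal 2 _ _ T).
Qed.

Lemma freq_ge d : INR (S d) <= freq d.
Proof. unfold freq. pose proof (lt_0_INR (S d) ltac:(lia)). pose proof PI2_3_2. nra. Qed.

Lemma inv_freq_pow_le d k : (2 <= k)%nat -> / freq d ^ k <= / INR (S d) ^ 2.
Proof.
  intros Hk. pose proof (freq_ge d). assert (1 <= INR (S d)) by (apply (le_INR 1); lia).
  apply Rinv_le_contravar; [apply pow_lt; lra|].
  eapply Rle_trans; [apply pow_incr; split; [lra|exact H]|]. apply Rle_pow; [lra|assumption].
Qed.

Lemma is_lim_seq_inv_S B : is_lim_seq (fun D => 2 / INR (S D) * B) 0.
Proof.
  replace 0 with (0 * B) by ring.
  apply (is_lim_seq_scal_r (fun D => 2 / INR (S D)) B (Finite 0)).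
  replace (Finite 0) with (Finite (2 * 0)) by (f_equal; ring).
  apply (is_lim_seq_scal_l _ 2 (Finite 0)).
  apply (is_lim_seq_incr_1 (fun n => / INR n)).
  apply is_lim_seq_inv_INR.
Qed.

Lemma poisson_unit_series (f f1 f2 : R -> C) I0 (J : nat -> C) g G :
  (forall t, 0 <= t <= 1 -> cder f t (f1 t)) ->
  (forall t, 0 <= t <= 1 -> cder f1 t (f2 t)) ->
  (forall t, 0 <= t <= 1 -> ccont f2 t) ->
  cint f 0 1 I0 ->
  (forall d, cint (fun t => RtoC (cos (freq d * t)) * f t)%C 0 1 (J d)) ->
  (forall t, 0 < t < 1 -> Cmod (f2 t) <= g t) -> is_RInt g 0 1 G ->
  cseries (fun d => 2 * J d)%C ((f 0 + f 1) / 2 - I0).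
Proof.
  intros. apply cseries_Cmod with (e := fun D => 2 / INR (S D) * G); [|apply is_lim_seq_inv_S].
  intros D. rewrite csum_scal. eapply poisson_unit; eassumption.
Qed.

Lemma sq_plus_sq_neq_0 (w : C) (D : R) : 0 < Re w -> (w * w + RtoC D * RtoC D)%C <> 0%C.
Proof.
  intros Hw E. apply (f_equal Re) in E as E1; apply (f_equal Im) in E as E2.
  destruct w as [p q]; unfold Re, Im in *; simpl in *.
  assert (q = 0) by nra. subst; nra.
Qed.

Lemma Cexp_neg_neq_1 (w : C) : 0 < Re w -> (1 - Cexp (- w))%C <> 0%C.
Proof.
  intros Hw E. assert (H : Cexp (- w) = 1%C).
  { replace (Cexp (- w)) with (1 - (1 - Cexp (- w)))%C by ring. rewrite E; ring. }
  apply (f_equal Cmod) in H. rewrite Cmod_Cexp, Cmod_1 in H.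
  rewrite <- exp_0 in H. apply exp_inv in H. simpl in H; unfold Re in *; lra.
Qed.

Lemma cder_exp_lin (w : C) t : cder (fun s => Cexp (- (w * s))) t (- w * Cexp (- (w * t)))%C.
Proof.
  eapply cder_eq; [apply cder_Cexp, cder_opp, cder_scal, cder_id|cbv beta; ring].
Qed.

(** Poisson summation on [0, 1] for exp (-w t): its integral and all its cosine coefficients carry
    the factor 1 - exp (-w), and dividing by this factor turns the trapezoidal term into 1/(exp w -
    1) + 1/2. *)
Lemma mittag_leffler (w : C) : 0 < Re w ->
  cseries (fun d => 2 * w / (w * w + RtoC (freq d) * RtoC (freq d)))%C (/ (Cexp w - 1) - / w + 1 / 2)%C.
Proof.
  intros Hw.
  assert (Hw0 : w <> 0%C) by (intros ->; simpl in Hw; lra).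
  assert (He : (1 - Cexp (- w))%C <> 0%C) by now apply Cexp_neg_neq_1.
  set (q := fun d => (w * w + RtoC (freq d) * RtoC (freq d))%C).
  assert (Hq : forall d, q d <> 0%C) by (intros; now apply sq_plus_sq_neq_0).
  assert (S : cseries (fun d => 2 * (w * (1 - Cexp (- w)) / q d))%C ((Cexp (- (w * 0)) + Cexp (- (w * 1))) / 2 - (1 - Cexp (- w)) / w)%C).
  { apply (poisson_unit_series (fun t => Cexp (- (w * t))) (fun t => - w * Cexp (- (w * t)))%C (fun t => w * w * Cexp (- (w * t)))%C _ _ (fun _ => Cmod (w * w)) (scal (1 - 0) (Cmod (w * w)))).
    - intros; apply cder_exp_lin.
    - intros t _. eapply cder_eq; [apply cder_scal, cder_exp_lin|cbv beta; ring].
    - intros t _. eapply cder_ccont, cder_scal, cder_exp_lin.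
    - replace ((1 - Cexp (- w)) / w)%C with (- / w * Cexp (- (w * 1)) - (- / w * Cexp (- (w * 0))))%C.
      2:{ rewrite Cmult_1_r, Cmult_0_r. replace (- RtoC 0)%C with (RtoC 0) by ring. rewrite Cexp_0. field; exact Hw0. }
      apply (cint_derive (fun t => - / w * Cexp (- (w * t)))%C).
      + intros t _. eapply cder_eq; [apply cder_scal, cder_exp_lin|]. cbv beta; field; exact Hw0.
      + intros t _. eapply cder_ccont, cder_exp_lin.
    - intros d. set (o := freq d).
      set (A := fun t : R => (/ q d * (Cexp (- (w * t)) * (RtoC (o * sin (o * t)) - w * RtoC (cos (o * t)))))%C).
      replace (w * (1 - Cexp (- w)) / q d)%C with (A 1 - A 0)%C.
      2:{ unfold A. rewrite !Rmult_0_r, !Rmult_1_r. unfold o; rewrite cos_freq_1, sin_freq_1, cos_0, sin_0.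
          rewrite Cmult_1_r, Cmult_0_r. replace (- RtoC 0)%C with (RtoC 0) by ring. rewrite Cexp_0, !Rmult_0_r. field. apply Hq. }
      apply cint_derive.
      + intros t _. unfold A. eapply cder_eq.
        * apply cder_scal, cder_mult; [apply cder_exp_lin|].
          apply cder_minus; [apply (cder_RtoC (fun t => o * sin (o * t)) t (o * o * cos (o * t)))|apply cder_scal, (cder_RtoC (fun t => cos (o * t)) t (- o * sin (o * t)))];
          auto_derive; try exact I; ring.
        * cbv beta. rewrite !RtoC_mult, RtoC_opp.
          transitivity (/ q d * (q d * (RtoC (cos (o * t)) * Cexp (- (w * t)))))%C; [unfold q; fold o; ring|].
          field; apply Hq.
      + intros t _. apply ccont_mult; [|eapply cder_ccont, cder_exp_lin].
        apply ccont_RtoC. apply (ex_derive_continuous (V := R_NormedModule)); auto_derive; exact I.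
    - intros t Ht. rewrite Cmod_mult, Cmod_Cexp.
      assert (exp (Re (- (w * t))) <= 1).
      { rewrite <- exp_0. apply exp_le. simpl. unfold Re in *. nra. }
      pose proof (Cmod_ge_0 (w * w)). nra.
    - apply (is_RInt_const (V := R_NormedModule)). }
  apply (cseries_scal _ _ (/ (1 - Cexp (- w)))%C) in S.
  assert (E1 : (Cexp w - 1)%C <> 0%C).
  { intros E. assert (K : Cexp w = 1%C) by (replace (Cexp w) with (Cexp w - 1 + 1)%C by ring; rewrite E; ring).
    apply He. pose proof (Cexp_opp_l w) as X. rewrite K, Cmult_1_r in X. rewrite X; ring. }
  replace (/ (Cexp w - 1) - / w + 1 / 2)%C with
    (/ (1 - Cexp (- w)) * ((Cexp (- (w * 0)) + Cexp (- (w * 1))) / 2 - (1 - Cexp (- w)) / w))%C.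
  - eapply cseries_ext; [|exact S]. intros d; cbv beta. fold (q d). field. split; [apply Hq|exact He].
  - rewrite Cmult_1_r, Cmult_0_r. replace (- RtoC 0)%C with (RtoC 0) by ring. rewrite Cexp_0.
    rewrite Cexp_opp in *. pose proof (Cexp_nz w).
    assert ((1 - / Cexp w) * Cexp w = Cexp w - 1)%C by (field; assumption).
    field. repeat split; try assumption.
Qed.

(** * Poisson summation on the half-line *)

Lemma cos_freq_shift d n t : cos (freq d * (INR n + t)) = cos (freq d * t).
Proof.
  replace (freq d * (INR n + t)) with (freq d * t + 2 * INR (S d * n) * PI).
  - apply cos_period.
  - unfold freq; rewrite mult_INR; ring.
Qed.

Lemma is_lim_seq_csum_bound (z : nat -> C) l B :
  is_lim_seq (fun n => Cmod (l - z n)) 0 -> (forall n, Cmod (z n) <= B) -> Cmod l <= B.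
Proof.
  intros H HB. apply is_lim_seq_Cmod_le with (e := fun n => Cmod (l - z n)); [|exact H].
  intros n. replace l with (z n + (l - z n))%C at 1 by ring.
  eapply Rle_trans; [apply Cmod_triangle|]. specialize (HB n); lra.
Qed.

Definition cconv (z : nat -> C) (l : C) : Prop := is_lim_seq (fun n => Cmod (l - z n)) 0.

Lemma cconv_plus z w l k : cconv z l -> cconv w k -> cconv (fun n => z n + w n)%C (l + k).
Proof.
  intros Hz Hw. apply (is_lim_seq_le_le (fun _ => 0) _ (fun n => Cmod (l - z n) + Cmod (k - w n))).
  - intros n; split; [apply Cmod_ge_0|].
    replace (l + k - (z n + w n))%C with ((l - z n) + (k - w n))%C by ring. apply Cmod_triangle.
  - apply is_lim_seq_const.
  - replace (Finite 0) with (Finite (0 + 0)) by (f_equal; ring). now apply is_lim_seq_plus'.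
Qed.

Lemma cconv_scal z l (c : C) : cconv z l -> cconv (fun n => c * z n)%C (c * l).
Proof.
  intros Hz. apply (is_lim_seq_ext (fun n => Cmod c * Cmod (l - z n))).
  - intros n; rewrite <- Cmod_mult; f_equal; ring.
  - replace (Finite 0) with (Finite (Cmod c * 0)) by (f_equal; ring).
    exact (is_lim_seq_scal_l _ (Cmod c) (Finite 0) Hz).
Qed.

Lemma cconv_minus z w l k : cconv z l -> cconv w k -> cconv (fun n => z n - w n)%C (l - k).
Proof.
  intros Hz Hw. pose proof (cconv_plus _ _ _ _ Hz (cconv_scal _ _ (- (1)) Hw)) as H.
  replace (l - k)%C with (l + - (1) * k)%C by ring.
  eapply is_lim_seq_ext; [|exact H]. intros n; simpl; f_equal; ring.
Qed.

Lemma cconv_csum (z : nat -> nat -> C) (l : nat -> C) D :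
  (forall d, cconv (z d) (l d)) -> cconv (fun n => csum (fun d => z d n) D) (csum l D).
Proof.
  intros H; induction D.
  - apply (is_lim_seq_ext (fun n => Cmod (l 0%nat - z 0%nat n))); [|apply H].
    intros n; now rewrite !csum_O.
  - pose proof (cconv_plus _ _ _ _ IHD (H (S D))) as X.
    rewrite csum_S. eapply is_lim_seq_ext; [|exact X].
    intros n; simpl; now rewrite csum_S.
Qed.

Lemma clim_cconv F l : clim F l -> cconv (fun n => F (INR n)) l.
Proof.
  intros H.
  assert (K : clim (fun r => l + - F r)%C 0).
  { replace (RtoC 0) with (l + - l)%C by ring. apply clim_plus; [apply clim_const|now apply clim_opp]. }
  apply is_lim_Cmod in K. rewrite Cmod_0 in K.
  apply (is_lim_comp_seq _ _ _ _ K); [exists 0%nat; discriminate|apply is_lim_seq_INR].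
Qed.

Lemma cconv_term a l : cseries a l -> cconv a 0.
Proof.
  intros H. apply cseries_lim_Cmod in H as H0.
  assert (H1 : cconv (fun n => csum a (S n)) l) by (apply (is_lim_seq_incr_1 (fun n => Cmod (l - csum a n))), H0).
  pose proof (cconv_minus _ _ _ _ H1 H0) as H2.
  replace (l - l)%C with (RtoC 0) in H2 by ring.
  apply (is_lim_seq_incr_1 (fun n => Cmod (0 - a n))).
  eapply is_lim_seq_ext; [|exact H2]. intros n; simpl; rewrite csum_S; do 2 f_equal; ring.
Qed.

(** The unit-interval estimates add up: the total error is 2 / (D+1) times the integral of [g],
    uniformly in the number of intervals, so the limit over intervals can be taken at fixed [D]. The
    half weight at the left end disappears with [f 0], the one at the right end because terms of a
    convergent series tend to 0. *)
Lemma poisson (f f1 f2 : R -> C) I0 (J : nat -> C) g B L :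
  (forall t, 0 <= t -> cder f t (f1 t)) ->
  (forall t, 0 <= t -> cder f1 t (f2 t)) ->
  (forall t, 0 <= t -> ccont f2 t) ->
  f 0 = 0%C ->
  IInf f I0 -> (forall d, IInf (fun t => RtoC (cos (freq d * t)) * f t)%C (J d)) ->
  (forall t, 0 < t -> Cmod (f2 t) <= g t) ->
  (forall R, 0 <= R -> exists G, is_RInt g 0 R G /\ G <= B) ->
  cseries (fun n => f (INR (S n))) L ->
  cseries (fun d => 2 * J d)%C (L - I0).
Proof.
  intros H1 H2 H3 Hf0 HI HJ Hle HG HL.
  apply cseries_Cmod with (e := fun D => 2 / INR (S D) * B); [|apply is_lim_seq_inv_S].
  intros D. rewrite csum_scal.
  destruct HI as [F [HF LF]].
  (* The partial integrals given by [HJ] depend on [d] only existentially; writing them with [RInt]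
     yields one family without a choice principle. *)
  assert (HJ' : exists JF : nat -> R -> C, forall d, (forall r, 0 <= r -> cint (fun t => RtoC (cos (freq d * t)) * f t)%C 0 r (JF d r)) /\ clim (JF d) (J d)).
  { exists (fun d r => (RInt (fun t => Re (RtoC (cos (freq d * t)) * f t)%C) 0 r, RInt (fun t => Im (RtoC (cos (freq d * t)) * f t)%C) 0 r)).
    intros d. destruct (HJ d) as [K [HK LK]].
    assert (E : forall r, 0 <= r -> K r = (RInt (fun t => Re (RtoC (cos (freq d * t)) * f t)%C) 0 r, RInt (fun t => Im (RtoC (cos (freq d * t)) * f t)%C) 0 r)).
    { intros r Hr. destruct (HK r Hr) as [K1 K2].
      apply C_ext; simpl; symmetry; now apply is_RInt_unique. }
    split; [intros r Hr; rewrite <- E by assumption; now apply HK|].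
    eapply clim_ext_loc; [|exact LK]. exact E. }
  destruct HJ' as [JF HJF].
  assert (EG : forall r, 0 <= r -> is_RInt g 0 r (RInt g 0 r)).
  { intros r Hr; destruct (HG r Hr) as [G [HG1 _]]. apply (RInt_correct (V := R_CompleteNormedModule)); eexists; eassumption. }
  assert (BG : forall r, 0 <= r -> RInt g 0 r <= B).
  { intros r Hr; destruct (HG r Hr) as [G [HG1 HG2]]; now rewrite (is_RInt_unique _ _ _ _ HG1). }
  set (a := fun n => f (INR (S n))).
  (* The defect on [0, n+1]: a trapezoidal sum with [f 0 = 0], whose right end point [a n] is
     [f (n+1)]. *)
  set (T := fun n => (csum a n - / 2 * a n - F (INR (S n)) - 2 * csum (fun d => JF d (INR (S n))) D)%C).
  assert (Step : forall n : nat, Cmod ((f (INR n) + f (INR (S n))) / 2 - (F (INR (S n)) - F (INR n)) - 2 * csum (fun d => JF d (INR (S n)) - JF d (INR n))%C D)%C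
            <= 2 / INR (S D) * (RInt g 0 (INR (S n)) - RInt g 0 (INR n))).
  { intros n. pose proof (pos_INR n) as Hn0. pose proof (S_INR n) as HS.
    assert (Hsh : forall (h : R -> C) (Hf : R -> C), (forall r, 0 <= r -> cint h 0 r (Hf r)) ->
      cint (fun t => h (INR n + t)) 0 1 (Hf (INR (S n)) - Hf (INR n))).
    { intros h Hh Hc.
      assert (X : cint h (INR n) (INR (S n)) (- Hh (INR n) + Hh (INR (S n)))).
      { apply (cint_Chasles h _ 0 _); [|apply Hc; lra].
        destruct (Hc (INR n) Hn0) as [X1 X2]. split.
        - exact (is_RInt_swap (V := R_NormedModule) _ _ _ _ X1).
        - exact (is_RInt_swap (V := R_NormedModule) _ _ _ _ X2). }
      replace (Hh (INR (S n)) - Hh (INR n))%C with (- Hh (INR n) + Hh (INR (S n)))%C by ring.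
      apply (cint_ext (fun x => RtoC 1 * h (1 * x + INR n)%R)%C).
      { intros x _. rewrite Cmult_1_l, Rmult_1_l, Rplus_comm. reflexivity. }
      apply cint_comp_lin. replace (1 * 0 + INR n) with (INR n) by ring.
      replace (1 * 1 + INR n) with (INR (S n)) by lra. exact X. }
    assert (Dsh : forall (h h' : R -> C), (forall t, 0 <= t -> cder h t (h' t)) -> forall t, 0 <= t <= 1 -> cder (fun t => h (INR n + t)) t (h' (INR n + t))).
    { intros h h' Hh t Ht. destruct (Hh (INR n + t) ltac:(lra)) as [X1 X2].
      assert (S1 : is_derive (fun t => INR n + t) t 1) by (auto_derive; [exact I|ring]).
      split.
      - evar_last; [exact (is_derive_comp (fun s => Re (h s)) _ t _ _ X1 S1)|exact (Rmult_1_l _)].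
      - evar_last; [exact (is_derive_comp (fun s => Im (h s)) _ t _ _ X2 S1)|exact (Rmult_1_l _)]. }
    pose proof (poisson_unit (fun t => f (INR n + t)) (fun t => f1 (INR n + t)) (fun t => f2 (INR n + t))
      (F (INR (S n)) - F (INR n))%C (fun d => JF d (INR (S n)) - JF d (INR n))%C (fun t => g (INR n + t)) (RInt g 0 (INR (S n)) - RInt g 0 (INR n)) D) as U.
    cbv beta in U. replace (INR n + 0) with (INR n) in U by ring. replace (INR n + 1) with (INR (S n)) in U by lra.
    apply U; clear U.
    - exact (Dsh f f1 H1).
    - exact (Dsh f1 f2 H2).
    - intros t Ht. destruct (H3 (INR n + t) ltac:(lra)) as [X1 X2].
      assert (Hc : continuous (fun t => INR n + t) t) by (apply (continuous_plus (V := R_NormedModule)); [apply continuous_const|apply continuous_id]).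
      split; [exact (continuous_comp _ (fun s => Re (f2 s)) t Hc X1)|exact (continuous_comp _ (fun s => Im (f2 s)) t Hc X2)].
    - exact (Hsh f F HF).
    - intros d. eapply cint_ext; [|exact (Hsh _ (JF d) (proj1 (HJF d)))].
      intros t _; simpl; now rewrite cos_freq_shift.
    - intros t Ht. apply Hle; lra.
    - assert (X : is_RInt g (INR n) (INR (S n)) (RInt g 0 (INR (S n)) - RInt g 0 (INR n))).
      { replace (RInt g 0 (INR (S n)) - RInt g 0 (INR n)) with (plus (opp (RInt g 0 (INR n))) (RInt g 0 (INR (S n)))) by (unfold plus, opp; simpl; ring).
        apply (is_RInt_Chasles (V := R_NormedModule) g _ 0); [|apply EG; lra].
        apply (is_RInt_swap (V := R_NormedModule)), EG; lra. }
      apply (is_RInt_ext (fun y => scal 1 (g (1 * y + INR n)))).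
      { intros x _. unfold scal; simpl; unfold mult; simpl. rewrite !Rmult_1_l, Rplus_comm. reflexivity. }
      apply (is_RInt_comp_lin (V := R_NormedModule) g 1 (INR n) 0 1).
      replace (1 * 0 + INR n) with (INR n) by ring. replace (1 * 1 + INR n) with (INR (S n)) by lra. exact X. }
  assert (TB : forall n, Cmod (T n) <= 2 / INR (S D) * RInt g 0 (INR (S n))).
  { induction n as [|n IH].
    - pose proof (Step 0%nat) as X. change (INR 0) with 0 in X.
      rewrite (RInt_point (V := R_CompleteNormedModule)) in X. unfold zero in X; simpl in X.
      rewrite Rminus_0_r in X.
      assert (F0 : F 0 = 0%C) by (eapply cint_unique; [apply HF; lra|apply cint_point]).
      assert (J0 : forall d, JF d 0 = 0%C) by (intros d; eapply cint_unique; [apply HJF; lra|apply cint_point]).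
      replace (T 0%nat) with ((f 0 + f 1) / 2 - (F 1 - F 0) - 2 * csum (fun d => JF d 1 - JF d 0)%C D)%C; [exact X|].
      unfold T, a; rewrite csum_O. change (INR 1) with 1. rewrite Hf0, F0.
      rewrite (csum_ext (fun d => JF d 1 - JF d 0)%C (fun d => JF d 1)) by (intros; rewrite J0; ring). field.
    - pose proof (Step (S n)) as X.
      replace (T (S n)) with (T n + ((f (INR (S n)) + f (INR (S (S n)))) / 2 - (F (INR (S (S n))) - F (INR (S n))) - 2 * csum (fun d => JF d (INR (S (S n))) - JF d (INR (S n)))%C D))%C.
      + eapply Rle_trans; [apply Cmod_triangle|].
        replace (2 / INR (S D) * RInt g 0 (INR (S (S n)))) with (2 / INR (S D) * RInt g 0 (INR (S n)) + 2 / INR (S D) * (RInt g 0 (INR (S (S n))) - RInt g 0 (INR (S n)))) by ring.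
        now apply Rplus_le_compat.
      + unfold T. rewrite csum_S.
        rewrite (csum_ext (fun d => JF d (INR (S (S n))) - JF d (INR (S n)))%C (fun d => JF d (INR (S (S n))) + - (1) * JF d (INR (S n)))%C) by (intros; ring).
        rewrite csum_plus, csum_scal. unfold a. field. }
  apply (is_lim_seq_csum_bound T).
  - change (cconv T (L - I0 - 2 * csum J D)). unfold T.
    replace (L - I0 - 2 * csum J D)%C with (L - / 2 * 0 - I0 - 2 * csum J D)%C by ring.
    apply cconv_minus; [apply cconv_minus; [apply cconv_minus|]|].
    + now apply cseries_lim_Cmod.
    + apply cconv_scal. eapply cconv_term, HL.
    + apply (is_lim_seq_incr_1 (fun n => Cmod (I0 - F (INR n)))), clim_cconv, LF.
    + apply cconv_scal.
      apply (cconv_csum (fun d n => JF d (INR (S n)))). intros d.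
      apply (is_lim_seq_incr_1 (fun n => Cmod (J d - JF d (INR n)))), clim_cconv, (HJF d).
  - intros n. eapply Rle_trans; [apply TB|]. apply Rmult_le_compat_l; [|apply BG, pos_INR].
    left; apply Rdiv_lt_0_compat; [lra|apply lt_0_INR; lia].
Qed.

(** * Bernoulli numbers *)

Lemma length_bernoulli_seq n : length (bernoulli_seq n) = S n.
Proof. induction n; simpl; [reflexivity|]. rewrite length_app, IHn; simpl; lia. Qed.

Lemma nth_bernoulli_seq k n : (k <= n)%nat -> nth k (bernoulli_seq n) 0 = bernoulli k.
Proof.
  intros H; induction H as [|n H IH]; [reflexivity|].
  simpl. rewrite app_nth1; [exact IH|rewrite length_bernoulli_seq; lia].
Qed.

Lemma bernoulli_S p :
  bernoulli (S p) = - / INR (p + 2) * sum_n (fun k => Binomial.C (p + 2) k * bernoulli k) p.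
Proof.
  unfold bernoulli at 1. simpl. rewrite app_nth2; rewrite length_bernoulli_seq; [|lia].
  rewrite Nat.sub_diag. simpl. f_equal.
  apply sum_n_ext_loc; intros k Hk. now rewrite nth_bernoulli_seq.
Qed.

(** For k >= 2, the contribution of the frequencies +-(d+1) to the Fourier series at 0 of the
    Bernoulli polynomial of degree [k] divided by k!. It is 0 for odd [k]. *)
Definition zcoef (k d : nat) : R := - 2 * Re (Ci ^ k)%C / freq d ^ k.

Lemma Re_Ci_pow_le k : Rabs (Re (Ci ^ k)%C) <= 1.
Proof.
  eapply Rle_trans; [apply Re_le_Cmod|]. rewrite Cmod_pow, Cmod_Ci, pow1; lra.
Qed.

Lemma ex_series_zcoef k : (2 <= k)%nat -> ex_series (zcoef k).
Proof.
  intros Hk.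
  apply (ex_series_le (K := R_AbsRing) (V := R_CompleteNormedModule) _ (fun d => 2 * / INR (S d) ^ 2)).
  - intros d. change norm with Rabs. unfold zcoef, Rdiv.
    pose proof (pow_lt _ k (freq_pos d)).
    rewrite !Rabs_mult, Rabs_inv, (Rabs_pos_eq (freq d ^ k)) by lra.
    rewrite (Rabs_left (-2)) by lra. replace (- -2) with 2 by ring.
    pose proof (inv_freq_pow_le d k Hk). pose proof (Re_Ci_pow_le k). pose proof (Rabs_pos (Re (Ci ^ k)%C)).
    assert (0 < / freq d ^ k) by (apply Rinv_0_lt_compat; lra). nra.
  - exact (ex_series_scal_l 2 _ ex_series_inv_sq).
Qed.

Lemma zcoef_1 d : zcoef 1 d = 0.
Proof. unfold zcoef. simpl. unfold Rdiv. ring. Qed.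

(* The normalised Bernoulli numbers [B_k / k!] as read off the Fourier coefficients of [t ^ n]. *)
Definition zb (k : nat) : R :=
  match k with O => 1 | 1%nat => - / 2 | _ => Series (zcoef k) end.

Lemma is_series_zcoef k : (2 <= k)%nat -> is_series (zcoef k) (zb k).
Proof.
  intros Hk. destruct k as [|[|k]]; try lia. apply Series_correct, ex_series_zcoef, Hk.
Qed.

Definition Kcoef (d : nat) : C := (Ci / freq d)%C.

Lemma RtoC_neq_0 x : x <> 0 -> RtoC x <> 0%C.
Proof. intros H E; apply H, RtoC_inj, E. Qed.

Lemma INR_fact_C_nz n : RtoC (INR (fact n)) <> 0%C.
Proof. apply RtoC_neq_0, INR_fact_neq_0. Qed.

Lemma Cexp_Ci_freq d : Cexp (Ci * freq d) = 1%C.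
Proof.
  unfold Cexp. replace (Re (Ci * freq d)) with 0 by (unfold Re; simpl; ring).
  replace (Im (Ci * freq d)) with (freq d) by (unfold Im; simpl; ring).
  rewrite exp_0, cos_freq_1, sin_freq_1. apply C_ext; simpl; ring.
Qed.

(** Integration by parts with [Kcoef d] = -1 / (i freq d). The exponential equals 1 at both ends, so
    each step leaves one boundary term and the starting integral, n = 0, vanishes. *)
Lemma cint_monomial_char d n :
  cint (fun t => RtoC (t ^ n / INR (fact n)) * Cexp (Ci * freq d * t))%C 0 1
    (match n with O => 0 | S p => - csum (fun k => Kcoef d ^ (S k) * / INR (fact (n - k)))%C p end).
Proof.
  pose proof (freq_pos d) as Hf.
  assert (Hf0 : RtoC (freq d) <> 0%C) by (apply RtoC_neq_0; lra).
  assert (Hi0 : Ci <> 0%C) by (intros E; apply (f_equal Im) in E; simpl in E; lra).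
  assert (De : forall t, cder (fun t : R => Cexp (Ci * freq d * t)) t (Ci * freq d * Cexp (Ci * freq d * t))%C).
  { intros t; eapply cder_eq; [apply cder_Cexp, cder_scal, cder_id|cbv beta; ring]. }
  induction n as [|n IH].
  - replace (RtoC 0) with (/ (Ci * freq d) * Cexp (Ci * freq d * 1) - / (Ci * freq d) * Cexp (Ci * freq d * 0))%C.
    2:{ rewrite Cmult_1_r, Cmult_0_r, Cexp_Ci_freq, Cexp_0; ring. }
    apply (cint_derive (fun t : R => / (Ci * freq d) * Cexp (Ci * freq d * t))%C).
    + intros t _. eapply cder_eq; [apply cder_scal, De|].
      simpl. replace (1 / 1) with 1 by field. field. split; assumption.
    + intros t _. apply ccont_mult; [apply ccont_RtoC, continuous_const|eapply cder_ccont, De].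
  - set (G := fun t : R => (RtoC (t ^ S n / INR (fact (S n))) * (/ (Ci * freq d) * Cexp (Ci * freq d * t)))%C).
    assert (D : cint (fun t => RtoC (t ^ S n / INR (fact (S n))) * Cexp (Ci * freq d * t) + / (Ci * freq d) * (RtoC (t ^ n / INR (fact n)) * Cexp (Ci * freq d * t)))%C 0 1 (G 1 - G 0)%C).
    { apply cint_derive.
      - intros t _. eapply cder_eq.
        + apply cder_mult; [apply (cder_RtoC (fun t => t ^ S n / INR (fact (S n))) t (t ^ n / INR (fact n)))|apply cder_scal, De].
          auto_derive; [exact I|]. change (Init.Nat.pred (S n)) with n.
          change (match n with 0%nat => 1 | S _ => INR n + 1 end) with (INR (S n)).
          change (fact n + n * fact n)%nat with (fact (S n)).
          rewrite fact_simpl, mult_INR. field. split; [apply INR_fact_neq_0|apply not_0_INR; lia].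
        + cbv beta. field. split; assumption.
      - intros t _.
        assert (Cp : forall k, ccont (fun t => RtoC (t ^ k / INR (fact k))) t).
        { intros k; apply ccont_RtoC, (ex_derive_continuous (V := R_NormedModule)); auto_derive; exact I. }
        assert (Ce : ccont (fun t : R => Cexp (Ci * freq d * t)) t) by (eapply cder_ccont, De).
        apply ccont_plus; [apply ccont_mult; auto|apply ccont_mult; [apply ccont_const|apply ccont_mult; auto]]. }
    pose proof (cint_minus _ _ _ _ _ _ D (cint_scal _ _ _ _ (/ (Ci * freq d))%C IH)) as X.
    eapply cint_ext with (g := fun t => (RtoC (t ^ S n / INR (fact (S n))) * Cexp (Ci * freq d * t))%C) in X.
    2:{ intros t _; simpl; ring. }
    match goal with |- cint _ _ _ ?z => match type of X with cint _ _ _ ?w => replace z with w; [exact X|] end end.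
    unfold G. rewrite Cmult_1_r, Cmult_0_r, Cexp_Ci_freq, Cexp_0, pow1, pow_i by lia.
    replace (RtoC (0 / INR (fact (S n)))) with (RtoC 0) by (f_equal; unfold Rdiv; ring).
    replace (RtoC (1 / INR (fact (S n)))) with (/ RtoC (INR (fact (S n))))%C.
    2:{ rewrite RtoC_div by apply INR_fact_neq_0. field. apply INR_fact_C_nz. }
    assert (EK : Kcoef d = (- / (Ci * freq d))%C).
    { unfold Kcoef. assert (E : (Ci * Ci = - (1))%C) by (apply C_ext; simpl; ring).
      transitivity (Ci * Ci / (Ci * freq d))%C; [field; split; assumption|]. rewrite E. field; split; assumption. }
    replace (/ (Ci * freq d))%C with (- Kcoef d)%C by (rewrite EK; ring).
    destruct n as [|n].
    + rewrite csum_O. change (1 - 0)%nat with 1%nat. rewrite Cpow_1_r. ring.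
    + assert (E : csum (fun k => Kcoef d ^ S k * / INR (fact (S (S n) - k)))%C (S n)
        = (Kcoef d * / INR (fact (S (S n))) + Kcoef d * csum (fun k => Kcoef d ^ S k * / INR (fact (S n - k)))%C n)%C).
      { rewrite <- csum_scal. clear.
        assert (Sh : forall (a : nat -> C) m, csum a (S m) = (a 0%nat + csum (fun k => a (S k)) m)%C).
        { intros a m; induction m; [rewrite csum_S, !csum_O; reflexivity|]. rewrite csum_S, IHm, csum_S; ring. }
        rewrite Sh, Cpow_1_r. f_equal. apply csum_ext; intros k _. rewrite (Cpow_S _ (S k)). 
        change (S (S n) - S k)%nat with (S n - k)%nat. ring. }
      rewrite E. ring.
Qed.

Lemma Re_Kcoef_pow d k : 2 * Re (Kcoef d ^ k)%C = - zcoef k d.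
Proof.
  unfold zcoef, Kcoef, Cdiv. rewrite Cpow_mult_l, <- RtoC_inv, <- RtoC_pow
    by (pose proof (freq_pos d); lra).
  rewrite re_scal_r, pow_inv. unfold Rdiv; ring.
Qed.

Lemma is_series_sum_n (u : nat -> nat -> R) (l : nat -> R) n :
  (forall k, (k <= n)%nat -> is_series (u k) (l k)) -> is_series (fun d => sum_n (fun k => u k d) n) (sum_n l n).
Proof.
  induction n; intros H.
  - rewrite sum_O. eapply is_series_ext; [|apply (H 0%nat); lia]. intros d; now rewrite sum_O.
  - rewrite sum_Sn. eapply is_series_ext; [|apply (is_series_plus (V := R_NormedModule)); [apply IHn; intros; apply H; lia|apply (H (S n)); lia]].
    intros d; simpl; now rewrite sum_Sn.
Qed.

(** The Bernoulli recurrence divided by (n+1)!, obtained from Poisson summation for t^n / n!. The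
    integral gives the term k = 0, the trapezoidal mean (f 0 + f 1) / 2 the term k = 1, and the
    cosine coefficients, expanded in powers of 1 / freq, the terms k >= 2. *)
Lemma zb_recurrence n : (1 <= n)%nat -> sum_n (fun k => zb k / INR (fact (S n - k))) n = 0 :> R.
Proof.
  intros Hn. destruct n as [|p]; [lia|].
  assert (H1 : cseries (fun d => 2 * RtoC (Re (- csum (fun k => Kcoef d ^ (S k) * / INR (fact (S p - k)))%C p)))%C
     (RtoC (/ 2 / INR (fact (S p)) - / INR (fact (S (S p)))))).
  { replace (RtoC (/ 2 / INR (fact (S p)) - / INR (fact (S (S p)))))
      with ((RtoC (0 ^ S p / INR (fact (S p))) + RtoC (1 ^ S p / INR (fact (S p)))) / 2 - RtoC (/ INR (fact (S (S p)))))%C.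
    2:{ rewrite pow_i, pow1 by lia. rewrite <- RtoC_plus, <- RtoC_div, <- RtoC_minus by lra. f_equal.
        field. split; apply INR_fact_neq_0. }
    apply (poisson_unit_series (fun t => RtoC (t ^ S p / INR (fact (S p)))) (fun t => RtoC (t ^ p / INR (fact p)))
      (fun t => RtoC (INR p * t ^ pred p / INR (fact p))) _ _ (fun _ => INR p / INR (fact p)) (scal (1 - 0) (INR p / INR (fact p)))).
    - intros t _. apply (cder_RtoC (fun t => t ^ S p / INR (fact (S p))) t). auto_derive; [exact I|].
      change (Init.Nat.pred (S p)) with p.
      change (match p with 0%nat => 1 | S _ => INR p + 1 end) with (INR (S p)).
      change (fact p + p * fact p)%nat with (fact (S p)).
      rewrite fact_simpl, mult_INR. field. split; [apply INR_fact_neq_0|apply not_0_INR; lia].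
    - intros t _. apply (cder_RtoC (fun t => t ^ p / INR (fact p)) t). auto_derive; [exact I|]. change Init.Nat.pred with pred. field. apply INR_fact_neq_0.
    - intros t _. apply ccont_RtoC, (ex_derive_continuous (V := R_NormedModule)); auto_derive; exact I.
    - replace (RtoC (/ INR (fact (S (S p))))) with (RtoC (1 ^ S (S p) / INR (fact (S (S p)))) - RtoC (0 ^ S (S p) / INR (fact (S (S p)))))%C.
      2:{ rewrite pow_i, pow1 by lia. rewrite <- RtoC_minus; f_equal. field. apply INR_fact_neq_0. }
      apply (cint_derive (fun t => RtoC (t ^ S (S p) / INR (fact (S (S p)))))).
      + intros t _. apply (cder_RtoC (fun t => t ^ S (S p) / INR (fact (S (S p)))) t). 
        rewrite (fact_simpl (S p)), mult_INR.
        auto_derive; [exact I|]. change (Init.Nat.pred (S (S p))) with (S p).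
        change (match p with 0%nat => 1 | S _ => INR p + 1 end) with (INR (S p)).
        change (fact p + p * fact p)%nat with (fact (S p)). rewrite <- (S_INR (S p)).
        simpl pow. field. split; [apply INR_fact_neq_0|apply not_0_INR; lia].
      + intros t _. apply ccont_RtoC, (ex_derive_continuous (V := R_NormedModule)); auto_derive; exact I.
    - intros d. destruct (cint_monomial_char d (S p)) as [X _]. split.
      + eapply is_RInt_ext; [|exact X]. intros t _. simpl. unfold Cexp; simpl.
        rewrite !Rmult_0_l, !Rmult_1_l, !Rmult_0_r, !Rplus_0_l, !Rminus_0_r.
        replace (exp _) with 1 by (rewrite <- exp_0; f_equal; ring). ring.
      + apply (is_RInt_ext (fun _ => 0)); [intros; simpl; ring|].
        evar_last; [apply (is_RInt_const (V := R_NormedModule))|]. unfold scal; simpl; unfold mult; simpl; ring.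
    - intros t Ht. rewrite Cmod_R, Rabs_pos_eq.
      + unfold Rdiv. apply Rmult_le_compat_r; [left; apply Rinv_0_lt_compat, INR_fact_lt_0|].
        pose proof (pos_INR p). assert (t ^ pred p <= 1 ^ pred p) by (apply pow_incr; lra). rewrite pow1 in *. nra.
      + apply Rmult_le_pos; [apply Rmult_le_pos; [apply pos_INR|apply pow_le; lra]|left; apply Rinv_0_lt_compat, INR_fact_lt_0].
    - apply (is_RInt_const (V := R_NormedModule)). }
  destruct H1 as [H1 _].
  assert (H2 : is_series (fun d => sum_n (fun k => zcoef (S k) d * / INR (fact (S p - k))) p) (/ 2 / INR (fact (S p)) - / INR (fact (S (S p))))).
  { eapply is_series_ext; [|exact H1]. intros d; cbv beta.
    rewrite re_scal_l, re_RtoC, re_opp, Re_csum.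
    rewrite <- Ropp_mult_distr_r, <- (Rmult_1_l (2 * _)), Ropp_mult_distr_l, <- Rmult_assoc, <- sum_n_scal.
    apply sum_n_ext; intros k.
    match goal with |- ?a = ?b => change (@eq R a b) end.
    rewrite <- RtoC_inv, re_scal_r by apply INR_fact_neq_0.
    pose proof (Re_Kcoef_pow d (S k)). cbv beta. 
    set (x := Re (Kcoef d ^ S k)%C) in *. replace (zcoef (S k) d) with (- (2 * x)) by lra. ring. }
  (* Index 0 stands for [zcoef 1], which vanishes although [zb 1] is -1/2; its sum over [d] is
     therefore entered as 0. *)
  assert (H3 : is_series (fun d => sum_n (fun k => zcoef (S k) d * / INR (fact (S p - k))) p)
     (sum_n (fun k => match k with O => 0 | S _ => zb (S k) * / INR (fact (S p - k)) end) p)).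
  { apply is_series_sum_n. intros [|k] _.
    - apply (is_series_ext (fun _ => 0)); [intros d; rewrite zcoef_1; symmetry; exact (Rmult_0_l _)|].
      change (is_lim_seq (sum_n (fun _ => 0)) 0). apply (is_lim_seq_ext (fun _ => 0)); [intros; now rewrite sum_n_zero|apply is_lim_seq_const].
    - apply is_series_scal_r, is_series_zcoef; lia. }
  assert (E := is_series_unique _ _ H2). rewrite (is_series_unique _ _ H3) in E.
  assert (Sh : forall (a : nat -> R) m, sum_n a (S m) = a 0%nat + sum_n (fun k => a (S k)) m :> R).
  { intros a m; induction m; [rewrite sum_Sn, !sum_O; reflexivity|]. rewrite sum_Sn, IHm, sum_Sn. exact (Rplus_assoc _ _ _). }
  rewrite Sh. replace (sum_n (fun k => zb (S k) / INR (fact (S (S p) - S k))) p)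
    with (sum_n (fun k => match k with O => 0 | S _ => zb (S k) * / INR (fact (S p - k)) end) p + - / 2 / INR (fact (S p))).
  - rewrite E. simpl zb. change (S (S p) - 0)%nat with (S (S p)). field. split; apply INR_fact_neq_0.
  - destruct p as [|p]; [rewrite !sum_O; simpl; field|].
    rewrite !Sh. change (S (S (S p)) - 1)%nat with (S (S p)). simpl zb.
    rewrite Rplus_0_l, Rplus_comm. reflexivity.
Qed.

Lemma bernoulli_zb k : bernoulli k = INR (fact k) * zb k.
Proof.
  induction k as [k IH] using lt_wf_ind.
  destruct k as [|p]; [unfold bernoulli; simpl; ring|].
  rewrite bernoulli_S.
  replace (sum_n (fun k => Binomial.C (p + 2) k * bernoulli k) p)
    with (INR (fact (p + 2)) * sum_n (fun k => zb k / INR (fact (S (S p) - k))) p).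
  2:{ rewrite <- sum_n_scal. apply sum_n_ext_loc; intros k Hk.
      rewrite IH by lia. unfold Binomial.C. replace (S (S p) - k)%nat with (p + 2 - k)%nat by lia.
      match goal with |- ?a = ?b => change (@eq R a b) end.
      field. split; apply INR_fact_neq_0. }
  pose proof (zb_recurrence (S p) ltac:(lia)) as R. rewrite sum_Sn in R. change plus with Rplus in R.
  replace (S (S p) - S p)%nat with 1%nat in R by lia. change (INR (fact 1)) with 1 in R.
  replace (sum_n (fun k => zb k / INR (fact (S (S p) - k))) p) with (- zb (S p)) by lra.
  replace (p + 2)%nat with (S (S p)) by lia.
  rewrite (fact_simpl (S p)), mult_INR. field. apply not_0_INR; lia.
Qed.

(** Euler's evaluation of the zeta function at 2K, in the form in which the polar term 1/w will
    produce it. *)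
Lemma is_series_bernoulli K : (1 <= K)%nat ->
  is_series (fun d => - 2 * (-1) ^ K / freq d ^ (2 * K)) (bernoulli (2 * K) / INR (fact (2 * K))).
Proof.
  intros HK. rewrite bernoulli_zb.
  replace (INR (fact (2 * K)) * zb (2 * K) / INR (fact (2 * K))) with (zb (2 * K)) by (field; apply INR_fact_neq_0).
  eapply is_series_ext; [|apply is_series_zcoef; lia].
  intros d; unfold zcoef; cbv beta. do 2 f_equal.
  rewrite Cpow_mult_r. replace (Ci ^ 2)%C with (RtoC (-1)) by (apply C_ext; simpl; ring).
  rewrite <- RtoC_pow. reflexivity.
Qed.

Lemma cconv_unique z l k : cconv z l -> cconv z k -> l = k.
Proof.
  intros H1 H2. pose proof (cconv_minus _ _ _ _ H1 H2) as H.
  assert (X : Cmod (l - k) <= 0).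
  { apply (is_lim_seq_csum_bound _ _ 0 H). intros n. replace (z n - z n)%C with (RtoC 0) by ring. rewrite Cmod_0; lra. }
  pose proof (Cmod_ge_0 (l - k)). assert (E : (l - k)%C = 0%C) by (apply Cmod_eq_0; lra).
  replace l with (l - k + k)%C by ring. rewrite E; ring.
Qed.

Lemma cseries_cconv a l : cseries a l <-> cconv (csum a) l.
Proof.
  split; [apply cseries_lim_Cmod|].
  intros H. now apply cseries_Cmod with (e := fun n => Cmod (l - csum a n)); [intros; apply Rle_refl|].
Qed.

Lemma csum_minus a b n : csum (fun k => a k - b k)%C n = (csum a n - csum b n)%C.
Proof. induction n; rewrite ?csum_O, ?csum_S, ?IHn; [reflexivity|ring]. Qed.

(** * Double series *)

Section DominatedDouble.

Variables (b : nat -> nat -> C) (u v : nat -> R).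
Hypothesis Hb : forall i j, Cmod (b i j) <= u i * v j.
Hypothesis Hu0 : forall i, 0 <= u i.
Hypothesis Hv0 : forall j, 0 <= v j.
Hypothesis Hu : ex_series u.
Hypothesis Hv : ex_series v.

(** The limit of the square partial sums is the common value through which sums by rows, by columns
    and by groups are compared. *)
Let square (K : nat) : C := csum (fun i => csum (b i) K) K.

Lemma cseries_row_ex i : exists l, cseries (b i) l.
Proof. apply (cseries_ex _ (fun j => u i * v j)); [apply Hb|now apply (ex_series_scal_l (u i) v)]. Qed.

(** The first [K] rows differ from the square by their tails, at most [u i] times the tail of [v];
    summed over [i] this is the sum of [u] times a null sequence. *)
Lemma cseries_rows_square r :
  (forall i, cseries (b i) (r i)) -> exists A, cseries r A /\ cconv square A.
Proof.
  intros Hr.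
  assert (Hx : forall i, ex_series (fun j => u i * v j)) by (intros i; exact (ex_series_scal_l (u i) v Hv)).
  assert (Br : forall i, Cmod (r i) <= u i * Series v).
  { intros i. rewrite <- Series_scal_l. exact (cseries_Cmod_le _ _ _ (Hb i) (Hx i) (Hr i)). }
  destruct (cseries_ex r (fun i => u i * Series v) Br) as [A HA]; [exact (ex_series_scal_r (Series v) u Hu)|].
  exists A; split; [exact HA|].
  assert (D : cconv (fun K => csum r K - square K)%C 0).
  { apply (is_lim_seq_le_le (fun _ => 0) _ (fun K => Series u * (Series v - sum_n v K))).
    - intros K; split; [apply Cmod_ge_0|].
      replace (0 - (csum r K - square K))%C with (- csum (fun i => r i - csum (b i) K)%C K)%C by (rewrite csum_minus; unfold square; ring).
      rewrite Cmod_opp.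
      eapply Rle_trans; [apply (Cmod_csum_le _ (fun i => (Series v - sum_n v K) * u i))|].
      + intros i. pose proof (cseries_tail _ _ _ K (Hb i) (Hx i) (Hr i)) as T.
        rewrite Series_scal_l, sum_n_scal in T. lra.
      + rewrite sum_n_scal, Rmult_comm. apply Rmult_le_compat_r.
        * pose proof (sum_n_le_Series v K Hv0 Hv); lra.
        * now apply sum_n_le_Series.
    - apply is_lim_seq_const.
    - replace (Finite 0) with (Finite (Series u * 0)) by (f_equal; ring).
      exact (is_lim_seq_scal_l _ (Series u) (Finite 0) (Series_tail_lim v Hv)). }
  pose proof (cconv_minus _ _ _ _ (proj1 (cseries_cconv _ _) HA) D) as X.
  replace (A - 0)%C with A in X by ring.
  eapply is_lim_seq_ext; [|exact X]. intros n; simpl; f_equal; ring.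
Qed.

Lemma square_conv : exists A, cconv square A.
Proof.
  set (r := fun i => (Series (fun j => Re (b i j)), Series (fun j => Im (b i j)))).
  assert (Hr : forall i, cseries (b i) (r i)).
  { intros i. destruct (cseries_row_ex i) as [l [H1 H2]].
    replace (r i) with l; [split; assumption|].
    apply C_ext; simpl; symmetry; now apply is_series_unique. }
  destruct (cseries_rows_square r Hr) as [A [_ HA]]. now exists A.
Qed.

Lemma cseries_rows r A : (forall i, cseries (b i) (r i)) -> cconv square A -> cseries r A.
Proof.
  intros Hr HA. destruct (cseries_rows_square r Hr) as [B [H1 H2]].
  now rewrite (cconv_unique _ _ _ HA H2).
Qed.

Variable phi : nat -> nat -> nat.
Hypothesis Hphi : forall i j, (S i <= phi i j /\ S j <= phi i j)%nat.

(** As [phi] exceeds both indices, every group of label at most M + 1 lies inside the square of size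
    [M]; hence this is the partial sum of the series of groups. *)
Let grp (M : nat) : C := csum (fun i => csum (fun j => if (phi i j <=? S M)%nat then b i j else 0%C) M) M.

Lemma csum_zero (a : nat -> C) n : (forall k, (k <= n)%nat -> a k = 0%C) -> csum a n = 0%C.
Proof.
  induction n; intros H; [rewrite csum_O; apply H; lia|].
  rewrite csum_S, IHn, H by (intros; try apply H; lia). ring.
Qed.

Lemma csum_extend (a : nat -> C) n M :
  (n <= M)%nat -> (forall k, (n < k)%nat -> a k = 0%C) -> csum a M = csum a n.
Proof.
  intros H Ha; induction H as [|M H IH]; [reflexivity|].
  rewrite csum_S, IH, Ha by lia. ring.
Qed.

Lemma csum_indicator (c : C) p M : (1 <= p)%nat ->
  csum (fun n => if (p =? S n)%nat then c else 0%C) M = if (p <=? S M)%nat then c else 0%C.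
Proof.
  intros Hp; induction M.
  - rewrite csum_O. destruct (Nat.eqb_spec p 1), (Nat.leb_spec p 1); try lia; reflexivity.
  - rewrite csum_S, IHM.
    destruct (Nat.leb_spec p (S M)), (Nat.eqb_spec p (S (S M))), (Nat.leb_spec p (S (S M))); try lia; ring.
Qed.

Lemma csum_groups M :
  csum (fun n => csum (fun i => csum (fun j => if (phi i j =? S n)%nat then b i j else 0%C) n) n) M = grp M.
Proof.
  transitivity (csum (fun n => csum (fun i => csum (fun j => if (phi i j =? S n)%nat then b i j else 0%C) M) M) M).
  - apply csum_ext; intros n Hn.
    rewrite (csum_extend (fun i => csum (fun j => if (phi i j =? S n)%nat then b i j else 0%C) M) n M Hn).
    + apply csum_ext; intros i Hi. symmetry; apply csum_extend; [exact Hn|].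
      intros j Hj. pose proof (Hphi i j). destruct (Nat.eqb_spec (phi i j) (S n)); [lia|reflexivity].
    + intros i Hi. apply csum_zero; intros j _. pose proof (Hphi i j).
      destruct (Nat.eqb_spec (phi i j) (S n)); [lia|reflexivity].
  - rewrite csum_switch. apply csum_ext; intros i _.
    rewrite csum_switch. apply csum_ext; intros j _.
    apply csum_indicator. pose proof (Hphi i j); lia.
Qed.

Lemma sum_n_cut (w : nat -> R) K M : (K <= M)%nat ->
  sum_n (fun i => if (i <=? K)%nat then w i else 0) M = sum_n w K.
Proof.
  intros H; induction H as [|M H IH].
  - apply sum_n_ext_loc; intros i Hi. destruct (Nat.leb_spec i K); [reflexivity|lia].
  - rewrite sum_Sn, IH. destruct (Nat.leb_spec (S M) K); [lia|]. exact (Rplus_0_r _).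
Qed.

(** The pairs missed by [grp M] lie in the square of size [M] but outside that of size [K], so the
    product bound summed over the difference of the two squares controls them. *)
Lemma square_minus_grp K M : (K <= M)%nat ->
  (forall i j, (i <= K)%nat -> (j <= K)%nat -> (phi i j <= S M)%nat) ->
  Cmod (square M - grp M) <= sum_n u M * sum_n v M - sum_n u K * sum_n v K.
Proof.
  intros HKM HK. unfold square, grp.
  rewrite <- csum_minus.
  set (uK := fun i => if (i <=? K)%nat then u i else 0). set (vK := fun j => if (j <=? K)%nat then v j else 0).
  eapply Rle_trans; [apply (Cmod_csum_le _ (fun i => sum_n v M * u i + (-1) * (sum_n v K * uK i)))|].
  - intros i. rewrite <- csum_minus.
    eapply Rle_trans; [apply (Cmod_csum_le _ (fun j => u i * v j + (-1) * (uK i * vK j)))|].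
    + intros j. unfold uK, vK. specialize (Hb i j). pose proof (Hu0 i). pose proof (Hv0 j).
      destruct (Nat.leb_spec (phi i j) (S M)) as [L|L].
      * replace (b i j - b i j)%C with (RtoC 0) by ring. rewrite Cmod_0.
        destruct (i <=? K)%nat, (j <=? K)%nat; nra.
      * replace (b i j - 0)%C with (b i j) by ring.
        destruct (Nat.leb_spec i K), (Nat.leb_spec j K); try nra.
        specialize (HK i j ltac:(assumption) ltac:(assumption)); lia.
    + rewrite (sum_n_plus (G := R_AbelianGroup)), !sum_n_scal. unfold vK. rewrite sum_n_cut by assumption.
      change plus with Rplus. lra.
  - rewrite (sum_n_plus (G := R_AbelianGroup)), !sum_n_scal. unfold uK. rewrite sum_n_cut by assumption.
    change plus with Rplus. lra.
Qed.

Hypothesis Hphi_fin : forall K, exists M0, forall i j, (i <= K)%nat -> (j <= K)%nat -> (phi i j <= M0)%nat.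

Lemma cseries_groups A : cconv square A ->
  cseries (fun n => csum (fun i => csum (fun j => if (phi i j =? S n)%nat then b i j else 0%C) n) n) A.
Proof.
  intros HA. apply cseries_cconv.
  assert (D : cconv (fun M => square M - grp M)%C 0).
  { apply is_lim_seq_spec; intros eps.
    assert (LUV : is_lim_seq (fun K => Series u * Series v - sum_n u K * sum_n v K) 0).
    { replace 0 with (Series u * Series v - Series u * Series v) by ring.
      apply is_lim_seq_minus'; [apply is_lim_seq_const|].
      apply is_lim_seq_mult'; [exact (Series_correct u Hu)|exact (Series_correct v Hv)]. }
    destruct (proj2 (is_lim_seq_spec _ _) LUV eps) as [K HK].
    specialize (HK K (Nat.le_refl _)). rewrite Rminus_0_r in HK.
    (* Beyond K + M0 every pair of the square of size [K] has been collected in its group. *)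
    destruct (Hphi_fin K) as [M0 HM0]. exists (K + M0)%nat; intros M HM.
    rewrite Rminus_0_r, Rabs_pos_eq by apply Cmod_ge_0.
    replace (0 - (square M - grp M))%C with (- (square M - grp M))%C by ring. rewrite Cmod_opp.
    eapply Rle_lt_trans; [apply (square_minus_grp K M); [lia|]|].
    { intros i j Hi Hj; specialize (HM0 i j Hi Hj); lia. }
    eapply Rle_lt_trans; [|eapply Rle_lt_trans; [apply Rle_abs|exact HK]].
    apply Rplus_le_compat_r. apply Rmult_le_compat; try (apply sum_n_le_Series; assumption).
    - clear -Hu0; induction M; [rewrite sum_O; apply Hu0|rewrite sum_Sn; apply Rplus_le_le_0_compat; [assumption|apply Hu0]].
    - clear -Hv0; induction M; [rewrite sum_O; apply Hv0|rewrite sum_Sn; apply Rplus_le_le_0_compat; [assumption|apply Hv0]]. }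
  pose proof (cconv_minus _ _ _ _ HA D) as X.
  replace (A - 0)%C with A in X by ring.
  eapply is_lim_seq_ext; [|exact X]. intros n; cbv beta. rewrite csum_groups. f_equal; ring.
Qed.

End DominatedDouble.

(* Both iterated sums are limits of the square partial sums, which are symmetric. *)
Lemma cseries_fubini (b : nat -> nat -> C) u v r c A :
  (forall i j, Cmod (b i j) <= u i * v j) -> (forall i, 0 <= u i) -> (forall j, 0 <= v j) ->
  ex_series u -> ex_series v ->
  (forall i, cseries (b i) (r i)) -> (forall j, cseries (fun i => b i j) (c j)) ->
  cseries r A -> cseries c A.
Proof.
  intros Hb Hu0 Hv0 Hu Hv Hr Hc HA.
  destruct (cseries_rows_square b u v Hb Hu0 Hv0 Hu Hv r Hr) as [B [HB SB]].
  rewrite (cseries_unique _ _ _ HA HB).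
  apply (cseries_rows (fun j i => b i j) v u) with (1 := fun j i => eq_ind _ (fun x => Cmod (b i j) <= x) (Hb i j) _ (Rmult_comm _ _)); try assumption.
  eapply is_lim_seq_ext; [|exact SB]. intros n; cbv beta. now rewrite csum_switch.
Qed.

Lemma ccont_ext_loc f g t : locally t (fun s => f s = g s) -> ccont f t -> ccont g t.
Proof.
  intros E [H1 H2]; split.
  - apply (continuous_ext_loc (fun s => Re (g s)) (fun s => Re (f s))); [|exact H1].
    eapply filter_imp; [|exact E]; intros s Hs; simpl; now rewrite Hs.
  - apply (continuous_ext_loc (fun s => Im (g s)) (fun s => Im (f s))); [|exact H2].
    eapply filter_imp; [|exact E]; intros s Hs; simpl; now rewrite Hs.
Qed.

Lemma ccont_lipschitz f a K :
  (forall t, Rabs (t - a) <= 1 -> Cmod (f t - f a) <= K * Rabs (t - a)) -> ccont f a.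
Proof.
  intros H.
  assert (G : forall h : C -> R, (forall z w : C, h (z - w)%C = h z - h w) -> (forall z, Rabs (h z) <= Cmod z) ->
    continuous (fun s => h (f s)) a).
  { intros h Hl Hh. apply continuity_pt_filterlim. intros eps Heps.
    set (K' := Rmax K 1). assert (HK : K <= K') by apply Rmax_l. assert (HK1 : 1 <= K') by apply Rmax_r.
    exists (Rmin 1 (eps / (2 * K'))). split.
    - apply Rmin_pos; [lra|apply Rdiv_lt_0_compat; lra].
    - intros t [_ Ht]. simpl in *. unfold Rdist in *.
      rewrite <- Hl. eapply Rle_lt_trans; [apply Hh|].
      assert (T1 : Rabs (t - a) <= 1) by (left; eapply Rlt_le_trans; [exact Ht|apply Rmin_l]).
      assert (T2 : Rabs (t - a) < eps / (2 * K')) by (eapply Rlt_le_trans; [exact Ht|apply Rmin_r]).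
      eapply Rle_lt_trans; [now apply H|]. pose proof (Rabs_pos (t - a)).
      assert (K' * Rabs (t - a) <= K' * (eps / (2 * K'))) by (apply Rmult_le_compat_l; lra).
      replace (K' * (eps / (2 * K'))) with (eps / 2) in * by (field; lra). nra. }
  split; apply G; try reflexivity; [apply Re_le_Cmod|apply Im_le_Cmod].
Qed.

(** Stands in for differentiation under the integral sign: for a parameter integral it is enough to
    estimate the Taylor remainder of the integrand. Used for [Ein] and in [cauchy_triangle]. *)
Lemma cder_quadratic f s l K :
  (forall t, Rabs (t - s) <= 1 -> Cmod (f t - f s - RtoC (t - s) * l) <= K * (t - s) ^ 2) -> cder f s l.
Proof.
  intros H.
  assert (G : forall h : C -> R, (forall z w : C, h (z - w)%C = h z - h w) ->
    (forall (x : R) (w : C), h (RtoC x * w)%C = x * h w) -> (forall z, Rabs (h z) <= Cmod z) ->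
    is_derive (fun s => h (f s)) s (h l)).
  { intros h Hl Hs Hh. apply is_derive_Reals. intros eps Heps.
    set (K' := Rmax K 1). assert (HK : K <= K') by apply Rmax_l. assert (HK1 : 1 <= K') by apply Rmax_r.
    assert (Hd : 0 < Rmin 1 (eps / (2 * K'))) by (apply Rmin_pos; [lra|apply Rdiv_lt_0_compat; lra]).
    exists (mkposreal _ Hd); intros x Hx0 Hx; simpl in Hx.
    assert (T1 : Rabs x <= 1) by (left; eapply Rlt_le_trans; [exact Hx|apply Rmin_l]).
    assert (T2 : Rabs x < eps / (2 * K')) by (eapply Rlt_le_trans; [exact Hx|apply Rmin_r]).
    assert (Ex : s + x - s = x) by ring.
    pose proof (H (s + x)) as B. rewrite Ex in B. specialize (B T1).
    replace ((h (f (s + x)) - h (f s)) / x - h l) with ((h (f (s + x)) - h (f s) - x * h l) / x) by (field; assumption).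
    rewrite <- Hl, <- Hs, <- Hl. unfold Rdiv; rewrite Rabs_mult, Rabs_inv.
    pose proof (Rabs_pos_lt x Hx0) as Hpx.
    apply (Rmult_lt_reg_r (Rabs x)); [assumption|].
    rewrite Rmult_assoc, Rinv_l, Rmult_1_r by lra.
    eapply Rle_lt_trans; [apply Hh|]. eapply Rle_lt_trans; [exact B|].
    rewrite <- (pow2_abs x).
    assert (K' * Rabs x < eps).
    { assert (K' * Rabs x < K' * (eps / (2 * K'))) by (apply Rmult_lt_compat_l; lra).
      replace (K' * (eps / (2 * K'))) with (eps / 2) in * by (field; lra). lra. }
    simpl. nra. }
  split; apply G; try reflexivity; try apply Re_le_Cmod; try apply Im_le_Cmod; intros; [apply re_scal_l|apply im_scal_l].
Qed.

Lemma Cexp_minus_1_le (u : C) : Cmod (Cexp u - 1) <= Cmod u * exp (Cmod u).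
Proof.
  assert (I : cint (fun s => u * Cexp (s * u))%C 0 1 (Cexp (1 * u) - Cexp (0 * u))).
  { assert (D : forall x : R, cder (fun s : R => Cexp (s * u)) x (u * Cexp (x * u))%C).
    { intros x. eapply cder_eq; [apply cder_Cexp, cder_mult; [apply cder_id|apply cder_const]|cbv beta; ring]. }
    apply (cint_derive (fun s : R => Cexp (s * u))).
    - intros x _; apply D.
    - intros x _; eapply cder_ccont, cder_scal, D. }
  rewrite Cmult_1_l, Cmult_0_l, Cexp_0 in I.
  refine (cint_norm_le_unit _ _ _ _ I).
  intros x Hx. rewrite Cmod_mult, Cmod_Cexp. apply Rmult_le_compat_l; [apply Cmod_ge_0|].
  apply exp_le. rewrite re_scal_l. pose proof (Re_le_Cmod u). apply Rabs_le_between in H. nra.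
Qed.

Lemma Cexp_remainder_le (u : C) : Cmod (1 - Cexp (- u) - u) <= Cmod u ^ 2 * exp (Cmod u).
Proof.
  assert (I : cint (fun s => u * (Cexp (- (s * u)) - 1))%C 0 1 ((1 - Cexp (- (1 * u)) - 1 * u) - (1 - Cexp (- (0 * u)) - 0 * u))%C).
  { assert (D : forall x : R, cder (fun s : R => Cexp (- (s * u))) x (- u * Cexp (- (x * u)))%C).
    { intros x. eapply cder_eq; [apply cder_Cexp, cder_opp, cder_mult; [apply cder_id|apply cder_const]|cbv beta; ring]. }
    apply (cint_derive (fun s : R => 1 - Cexp (- (s * u)) - s * u)%C).
    - intros x _. eapply cder_eq.
      + apply cder_minus; [apply cder_minus; [apply cder_const|apply D]|apply cder_mult; [apply cder_id|apply cder_const]].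
      + cbv beta; ring.
    - intros x _. apply ccont_mult; [apply ccont_const|apply ccont_minus; [eapply cder_ccont, D|apply ccont_const]]. }
  rewrite Cmult_1_l, Cmult_0_l in I. replace (- RtoC 0)%C with (RtoC 0) in I by ring. rewrite Cexp_0 in I.
  replace (1 - Cexp (- u) - u - (1 - 1 - 0))%C with (1 - Cexp (- u) - u)%C in I by ring.
  refine (cint_norm_le_unit _ _ _ _ I).
  intros x Hx. rewrite Cmod_mult. simpl. rewrite Rmult_1_r, Rmult_assoc.
  apply Rmult_le_compat_l; [apply Cmod_ge_0|].
  eapply Rle_trans; [apply Cexp_minus_1_le|]. rewrite Cmod_opp, Cmod_mult, Cmod_R, Rabs_pos_eq by lra.
  pose proof (Cmod_ge_0 u). pose proof (exp_pos (x * Cmod u)).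
  apply Rmult_le_compat; [nra|lra|nra|apply exp_le; nra].
Qed.

(** * The hyperbolic integrals as integrals along two rays *)

(** Integrand of the entire part of the exponential integral: E_1 (z) = Ein z - gamma - log z. Both
    Shi and Chi are combinations of Ein z and Ein (-z), so that all branch questions are confined to
    the logarithm. *)
Definition Ein_int (z : C) (t : R) : C := ((1 - Cexp (- (t * z))) / t)%C.

Definition Ein (z : C) : C := (RInt (fun t => Re (Ein_int z t)) 0 1, RInt (fun t => Im (Ein_int z t)) 0 1).

Lemma Ein_int_near_0 z t : t <> 0 -> Rabs t <= 1 ->
  Cmod (Ein_int z t - z) <= Cmod z ^ 2 * exp (Cmod z) * Rabs t.
Proof.
  intros Ht Ht1.
  assert (Ht0 : RtoC t <> 0%C) by (intros E; apply Ht, RtoC_inj, E).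
  replace (Ein_int z t - z)%C with ((1 - Cexp (- (t * z)) - t * z) / t)%C by (unfold Ein_int; field; assumption).
  rewrite Cmod_div, Cmod_R by assumption.
  pose proof (Rabs_pos_lt t Ht).
  apply (Rmult_le_reg_r (Rabs t)); [assumption|]. unfold Rdiv; rewrite Rmult_assoc, Rinv_l, Rmult_1_r by lra.
  eapply Rle_trans; [apply Cexp_remainder_le|]. rewrite Cmod_mult, Cmod_R.
  pose proof (Cmod_ge_0 z).
  replace ((Rabs t * Cmod z) ^ 2 * exp (Rabs t * Cmod z)) with (Cmod z ^ 2 * exp (Rabs t * Cmod z) * Rabs t * Rabs t) by ring.
  apply Rmult_le_compat_r; [lra|]. apply Rmult_le_compat_r; [lra|].
  apply Rmult_le_compat_l; [apply pow2_ge_0|]. apply exp_le; nra.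
Qed.

Lemma cint_Ein z : cint (Ein_int z) 0 1 (Ein z).
Proof.
  (* At t = 0 the quotient takes a default value instead of its limit [z]; [g] repairs it without
     affecting the integral. *)
  set (g := fun t => if Req_EM_T t 0 then z else Ein_int z t).
  destruct (cint_ex g 0 1) as [l Hl].
  { intros t _. destruct (Req_EM_T t 0) as [->|Ht].
    - apply ccont_lipschitz with (K := Cmod z ^ 2 * exp (Cmod z)). intros t Ht. rewrite Rminus_0_r in *.
      unfold g. destruct (Req_EM_T 0 0); [|lra]. destruct (Req_EM_T t 0) as [->|Ht0].
      + replace (z - z)%C with (RtoC 0) by ring. rewrite Cmod_0, Rabs_R0; lra.
      + now apply Ein_int_near_0.
    - apply (ccont_ext_loc (Ein_int z)).
      + assert (Hp : 0 < Rabs t) by now apply Rabs_pos_lt.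
        exists (mkposreal _ Hp). intros s Hs. unfold g. destruct (Req_EM_T s 0) as [->|]; [|reflexivity].
        exfalso. unfold ball in Hs; simpl in Hs. unfold AbsRing_ball, abs, minus, plus, opp in Hs; simpl in Hs.
        rewrite Rplus_0_l, Rabs_Ropp in Hs. lra.
      + apply ccont_div; [apply ccont_minus; [apply ccont_const|apply ccont_Cexp, ccont_opp, ccont_mult; [apply ccont_id|apply ccont_const]]|apply ccont_id|].
        intros E; apply Ht, RtoC_inj, E. }
  assert (X : cint (Ein_int z) 0 1 l).
  { eapply cint_ext; [|exact Hl]. rewrite Rmin_left by lra. intros x Hx. unfold g. destruct (Req_EM_T x 0); [lra|reflexivity]. }
  replace (Ein z) with l; [exact X|].
  destruct X as [X1 X2]. apply C_ext; simpl; symmetry; now apply is_RInt_unique.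
Qed.

(** The increment of the integrand is Cexp (-t z) times [Ein_int h t], so the remainder is governed
    by the behaviour of [Ein_int h] alone, quadratic in [h]. The 3 bounds exp 1. *)
Lemma Ein_increment (z h : C) : z <> 0%C -> Cmod h <= 1 ->
  Cmod (Ein (z + h) - Ein z - h * ((1 - Cexp (- z)) / z)) <= exp (Cmod z) * 3 * Cmod h ^ 2.
Proof.
  intros Hz Hh.
  assert (D : forall x : R, cder (fun t : R => Cexp (- (t * z))) x (- z * Cexp (- (x * z)))%C).
  { intros x. eapply cder_eq; [apply cder_Cexp, cder_opp, cder_mult; [apply cder_id|apply cder_const]|cbv beta; ring]. }
  assert (I : cint (fun t => h * Cexp (- (t * z)))%C 0 1 (- h / z * Cexp (- (1 * z)) - - h / z * Cexp (- (0 * z)))%C).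
  { apply (cint_derive (fun t : R => - h / z * Cexp (- (t * z)))%C).
    - intros x _. eapply cder_eq; [apply cder_scal, D|cbv beta; field; assumption].
    - intros x _. eapply cder_ccont, cder_scal, D. }
  rewrite Cmult_1_l, Cmult_0_l in I. replace (- RtoC 0)%C with (RtoC 0) in I by ring. rewrite Cexp_0 in I.
  replace (Ein (z + h) - Ein z - h * ((1 - Cexp (- z)) / z))%C
    with (Ein (z + h) - Ein z - (- h / z * Cexp (- z) - - h / z * 1))%C by (field; assumption).
  pose proof (cint_minus _ _ _ _ _ _ (cint_minus _ _ _ _ _ _ (cint_Ein (z + h)) (cint_Ein z)) I) as X.
  refine (cint_norm_le_unit _ _ _ _ X).
  intros t Ht.
  assert (Ht0 : RtoC t <> 0%C) by (intros E; apply RtoC_inj in E; lra).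
  replace (Ein_int (z + h) t - Ein_int z t - h * Cexp (- (t * z)))%C
    with (Cexp (- (t * z)) * (Ein_int h t - h))%C.
  2:{ unfold Ein_int. replace (- (t * (z + h)))%C with (- (t * z) + - (t * h))%C by ring. rewrite Cexp_plus. field; assumption. }
  rewrite Cmod_mult, Cmod_Cexp.
  assert (B1 : exp (Re (- (t * z))) <= exp (Cmod z)).
  { apply exp_le. rewrite re_opp, re_scal_l. pose proof (Re_le_Cmod z) as B; apply Rabs_le_between in B. pose proof (Cmod_ge_0 z). nra. }
  assert (B2 : Cmod (Ein_int h t - h) <= 3 * Cmod h ^ 2).
  { eapply Rle_trans; [apply Ein_int_near_0; [lra|rewrite Rabs_pos_eq; lra]|].
    rewrite Rabs_pos_eq by lra. pose proof (pow2_ge_0 (Cmod h)).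
    assert (exp (Cmod h) <= 3) by (eapply Rle_trans; [apply exp_le, Hh|apply exp_le_3]).
    pose proof (exp_pos (Cmod h)). 
    assert (exp (Cmod h) * t <= 3) by nra. nra. }
  rewrite Rmult_assoc. apply Rmult_le_compat; [left; apply exp_pos|apply Cmod_ge_0|exact B1|exact B2].
Qed.

Lemma cder_Ein_line (w e : C) (s : R) : (w + s * e)%C <> 0%C ->
  cder (fun s : R => Ein (w + s * e)) s (e * ((1 - Cexp (- (w + s * e))) / (w + s * e)))%C.
Proof.
  intros Hv. set (v := (w + s * e)%C) in *.
  destruct (Req_EM_T (Cmod e) 0) as [He|He].
  - assert (e = 0%C) by now apply Cmod_eq_0. subst e.
    apply (cder_ext (fun _ => Ein w)); [intros; f_equal; ring|].
    rewrite Cmult_0_l; apply cder_const.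
  - pose proof (Cmod_ge_0 e) as He0. assert (Hep : 0 < Cmod e) by lra.
    (* The direction is normalised to length 1, so that parameter increments up to 1 meet the
       restriction on [h] in [Ein_increment]; the chain rule then restores the speed [u]. *)
    set (u := Cmod e) in *.
    assert (X : cder (fun x : R => Ein (v + x * (e / u))) 0 (e / u * ((1 - Cexp (- v)) / v))%C).
    { apply cder_quadratic with (K := exp (Cmod v) * 3). intros t Ht. rewrite Rminus_0_r in *.
      assert (Hu : RtoC u <> 0%C) by (intros E; apply RtoC_inj in E; lra).
      assert (Ec : Cmod (t * (e / u)) = Rabs t).
      { rewrite Cmod_mult, Cmod_div, !Cmod_R by assumption. rewrite (Rabs_pos_eq u) by lra. fold u. field; lra. }
      replace (v + 0 * (e / u))%C with v by ring.
      pose proof (Ein_increment v (t * (e / u)) Hv) as B. rewrite Ec, pow2_abs in B. specialize (B Ht).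
      replace (RtoC t * (e / u * ((1 - Cexp (- v)) / v)))%C with (t * (e / u) * ((1 - Cexp (- v)) / v))%C by ring.
      exact B. }
    destruct X as [X1 X2].
    assert (S1 : is_derive (fun x => u * (x - s)) s u) by (auto_derive; [exact I|ring]).
    assert (E0 : u * (s - s) = 0) by ring.
    rewrite <- E0 in X1, X2.
    assert (Hu : RtoC u <> 0%C) by (intros E; apply RtoC_inj in E; lra).
    apply (cder_ext (fun x : R => Ein (v + (u * (x - s))%R * (e / u)))).
    { intros x. f_equal. rewrite RtoC_mult, RtoC_minus. unfold v. field; assumption. }
    replace (e * ((1 - Cexp (- v)) / v))%C with (RtoC u * (e / u * ((1 - Cexp (- v)) / v)))%C by (field; split; assumption).
    split.
    + rewrite re_scal_l. exact (is_derive_comp (fun x : R => Re (Ein (v + x * (e / u)))) (fun x => u * (x - s)) s _ u X1 S1).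
    + rewrite im_scal_l. exact (is_derive_comp (fun x : R => Im (Ein (v + x * (e / u)))) (fun x => u * (x - s)) s _ u X2 S1).
Qed.

(* The principal logarithm on the right half plane. *)
Definition L0 (v : C) : C := (/ 2 * ln (Re v * Re v + Im v * Im v), atan (Im v / Re v)).

Lemma cder_L0 f t a : cder f t a -> 0 < Re (f t) -> cder (fun s => L0 (f s)) t (a / f t)%C.
Proof.
  intros [F1 F2] Hp.
  set (u := fun s => Re (f s)) in *; set (v := fun s => Im (f s)) in *.
  assert (E1 := is_derive_unique _ _ _ F1 : Derive (fun s => u s) t = Re a).
  assert (E2 := is_derive_unique _ _ _ F2 : Derive (fun s => v s) t = Im a).
  assert (X1 : ex_derive u t) by (eexists; exact F1).
  assert (X2 : ex_derive v t) by (eexists; exact F2).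
  change (Re (f t)) with (u t) in Hp.
  assert (Ef : f t = (u t, v t)) by (apply injective_projections; reflexivity).
  assert (Hq : 0 < u t * u t + v t * v t) by nra.
  split.
  - change (is_derive (fun s => / 2 * ln (u s * u s + v s * v s)) t (Re (a / f t)%C)).
    auto_derive; [repeat split; assumption|]. rewrite E1, E2, Ef.
    unfold Cdiv, Cmult, Cinv, Re, Im; simpl. rewrite !Rmult_1_r. field. lra.
  - change (is_derive (fun s => atan (v s / u s)) t (Im (a / f t)%C)).
    auto_derive; [repeat split; try assumption; lra|]. rewrite E1, E2, Ef.
    unfold Cdiv, Cmult, Cinv, Re, Im; simpl. rewrite !Rmult_1_r. field. split; lra.
Qed.

Lemma cos_pos_small x : Rabs x < 3 * PI / 2 -> 0 < cos x -> Rabs x < PI / 2.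
Proof.
  intros H1 H2. pose proof PI_RGT_0.
  destruct (Rlt_dec (Rabs x) (PI / 2)) as [|H3]; [assumption|exfalso].
  apply Rnot_lt_le in H3.
  assert (H4 : cos (Rabs x) <= 0) by (apply cos_le_0; lra).
  unfold Rabs in H4; destruct Rcase_abs; rewrite ?cos_neg in H4; lra.
Qed.

(** Positivity of cos (Im w) excludes everything between pi/2 and 3 pi/2. The generous bound leaves
    room to add to an argument below pi/2 any angle below pi. *)
Lemma L0_unique (w v : C) : Cexp w = v -> 0 < Re v -> Rabs (Im w) < 3 * PI / 2 -> w = L0 v.
Proof.
  intros E Hv Hw.
  assert (E1 : Re v = exp (Re w) * cos (Im w)) by (rewrite <- E; reflexivity).
  assert (E2 : Im v = exp (Re w) * sin (Im w)) by (rewrite <- E; reflexivity).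
  pose proof (exp_pos (Re w)) as He.
  assert (Hc : 0 < cos (Im w)).
  { rewrite E1 in Hv. destruct (Rle_dec (cos (Im w)) 0); [nra|lra]. }
  pose proof (cos_pos_small _ Hw Hc) as Hs. apply Rabs_lt_between in Hs.
  pose proof (sin2_cos2 (Im w)) as SC; unfold Rsqr in SC.
  unfold L0; apply C_ext; simpl.
  - replace (Re v * Re v + Im v * Im v) with (exp (Re w) * exp (Re w)).
    + rewrite ln_mult, ln_exp by assumption. field.
    + rewrite E1, E2. transitivity (exp (Re w) * exp (Re w) * (sin (Im w) * sin (Im w) + cos (Im w) * cos (Im w))); [rewrite SC; ring|ring].
  - replace (Im v / Re v) with (tan (Im w)) by (rewrite E1, E2; unfold tan; field; split; lra).
    symmetry; apply atan_tan; lra.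
Qed.

Lemma Cexp_L0 (v : C) : 0 < Re v -> Cexp (L0 v) = v.
Proof.
  intros Hv. set (q := Re v * Re v + Im v * Im v).
  assert (Hq : 0 < q) by (unfold q; nra).
  assert (Hs : 0 < sqrt q) by now apply sqrt_lt_R0.
  assert (Es : exp (/ 2 * ln q) = sqrt q).
  { apply Rsqr_inj; [left; apply exp_pos|lra|]. unfold Rsqr. rewrite <- exp_plus, sqrt_sqrt by lra.
    replace (/ 2 * ln q + / 2 * ln q) with (ln q) by field. now apply exp_ln. }
  assert (Er : sqrt (1 + (Im v / Re v)²) = sqrt q / Re v).
  { replace (1 + (Im v / Re v)²) with (q / (Re v)²) by (unfold q, Rsqr; field; lra).
    rewrite sqrt_div_alt, sqrt_Rsqr; [reflexivity|lra|apply Rsqr_pos_lt; lra]. }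
  unfold Cexp, L0. simpl. fold q. rewrite Es, cos_atan, sin_atan, Er.
  apply C_ext; simpl; field; lra.
Qed.

Lemma L0_Im (v : C) : Rabs (Im (L0 v)) < PI / 2.
Proof. simpl. pose proof (atan_bound (Im v / Re v)). apply Rabs_lt_between; lra. Qed.

Lemma Cexp_Clog (z : C) : z <> 0%C -> Cexp (Clog z) = z.
Proof.
  intros Hz. pose proof (Cmod_gt_0 z) as [Hm _]. specialize (Hm Hz).
  pose proof (Cmod_sqr z) as Hq. set (r := Cmod z) in *.
  assert (Hx : -1 <= Re z / r <= 1).
  { pose proof (Re_le_Cmod z) as H. fold r in H. apply Rabs_le_between in H.
    split; apply (Rmult_le_reg_r r); try assumption; unfold Rdiv; rewrite Rmult_assoc, Rinv_l by lra; lra. }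
  assert (Hsin : sin (acos (Re z / r)) = Rabs (Im z) / r).
  { rewrite sin_acos by exact Hx. replace (1 - (Re z / r)²) with ((Im z / r)²).
    - rewrite sqrt_Rsqr_abs. unfold Rdiv; rewrite Rabs_mult, Rabs_inv, (Rabs_pos_eq r); lra.
    - unfold Rsqr. replace (Im z / r * (Im z / r)) with ((Im z * Im z) / (r * r)) by (field; lra).
      replace (Im z * Im z) with (r * r - Re z * Re z) by lra. field; lra. }
  unfold Cexp, Clog, Carg; simpl. fold r. rewrite exp_ln by assumption.
  destruct Rle_dec.
  - rewrite Hsin, cos_acos by exact Hx. apply C_ext; simpl; [field; lra|].
    rewrite Rabs_pos_eq by lra. field; lra.
  - rewrite cos_neg, sin_neg, Hsin, cos_acos by exact Hx. apply C_ext; simpl; [field; lra|].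
    rewrite Rabs_left by lra. field; lra.
Qed.

Lemma Clog_L0 (z : C) : 0 < Re z -> Clog z = L0 z.
Proof.
  intros Hz. apply L0_unique; [|exact Hz|].
  - apply Cexp_Clog. intros ->. simpl in Hz; lra.
  - simpl. unfold Carg. pose proof (acos_bound (Re z / Cmod z)). pose proof PI_RGT_0.
    destruct Rle_dec; apply Rabs_lt_between; lra.
Qed.

(** * Euler's constant and the exponential integral at infinity *)

Definition harm (n : nat) : R := sum_n_m (fun k => / INR k) 1 n.

Lemma harm_S n : harm (S n) = harm n + / INR (S n).
Proof. unfold harm. rewrite sum_n_Sm by lia. reflexivity. Qed.

Lemma ln_le_sub x : 0 < x -> ln x <= x - 1.
Proof.
  intros Hx. pose proof (exp_ineq1_le (ln x)) as H. rewrite exp_ln in H by assumption. lra.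
Qed.

Lemma ln_succ_bounds n : (1 <= n)%nat -> / INR (S n) <= ln (INR (S n)) - ln (INR n) <= / INR n.
Proof.
  intros Hn. assert (H1 : 1 <= INR n) by (apply (le_INR 1); lia).
  rewrite S_INR. rewrite <- ln_div by lra. split.
  - pose proof (ln_le_sub (INR n / (INR n + 1)) ltac:(apply Rdiv_lt_0_compat; lra)) as H.
    replace ((INR n + 1) / INR n) with (/ (INR n / (INR n + 1))) by (field; lra).
    rewrite ln_Rinv by (apply Rdiv_lt_0_compat; lra).
    replace (INR n / (INR n + 1) - 1) with (- / (INR n + 1)) in H by (field; lra). lra.
  - pose proof (ln_le_sub ((INR n + 1) / INR n) ltac:(apply Rdiv_lt_0_compat; lra)) as H.
    replace ((INR n + 1) / INR n - 1) with (/ INR n) in H by (field; lra). lra.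
Qed.

(** [euler_gamma] is the real part of a limit that is always defined, so convergence has to be
    established: the sequence decreases and stays nonnegative by [ln_succ_bounds]. *)
Lemma is_lim_seq_gamma : is_lim_seq (fun n => harm n - ln (INR n)) euler_gamma.
Proof.
  (* The shift avoids n = 0, where ln 0 is a default value and monotonicity fails. *)
  assert (Hex : ex_finite_lim_seq (fun n => harm (S n) - ln (INR (S n)))).
  { apply ex_finite_lim_seq_decr with (M := 0).
    - intros n. rewrite (harm_S (S n)). pose proof (ln_succ_bounds (S n) ltac:(lia)). lra.
    - intros n. induction n.
      + unfold harm. rewrite sum_n_n. simpl. rewrite ln_1. lra.
      + assert (forall k, ln (INR (S (S k))) <= harm (S k)).
        { induction k.
          - unfold harm; rewrite sum_n_n. pose proof (ln_succ_bounds 1 ltac:(lia)) as [_ H]. simpl in *. rewrite ln_1 in H. lra.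
          - rewrite harm_S. pose proof (ln_succ_bounds (S (S k)) ltac:(lia)) as [_ H]. lra. }
        specialize (H n). rewrite harm_S.
        assert (0 < / INR (S (S n))) by (apply Rinv_0_lt_compat, lt_0_INR; lia). lra. }
  destruct Hex as [l Hl].
  assert (H : is_lim_seq (fun n => harm n - ln (INR n)) l) by (apply is_lim_seq_incr_1; exact Hl).
  replace euler_gamma with l; [exact H|].
  exact (f_equal real (eq_sym (is_lim_seq_unique _ _ H))).
Qed.

(** One more power adds the integral of (1 - s)^n, which is 1 / (n+1). This finite analogue of [Ein]
    is what brings Euler's constant into play. *)
Lemma is_RInt_harm n : is_RInt (fun s => (1 - (1 - s) ^ n) / s) 0 1 (harm n).
Proof.
  induction n.
  - unfold harm. rewrite sum_n_m_zero by lia.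
    apply (is_RInt_ext (fun _ => 0)).
    { intros x Hx. rewrite Rmin_left in Hx by lra. simpl. unfold Rdiv; ring. }
    evar_last; [apply (is_RInt_const (V := R_NormedModule))|]. unfold scal, zero; simpl; unfold mult; simpl; ring.
  - rewrite harm_S.
    apply (is_RInt_ext (fun s => plus ((1 - (1 - s) ^ n) / s) ((1 - s) ^ n))).
    { intros x Hx. rewrite Rmin_left in Hx by lra. unfold plus; simpl. field; lra. }
    apply (is_RInt_plus (V := R_NormedModule)); [exact IHn|].
    replace (/ INR (S n)) with (- (1 - 1) ^ S n / INR (S n) - (- (1 - 0) ^ S n / INR (S n))).
    2:{ rewrite Rminus_diag, Rminus_0_r, pow_i, pow1 by lia. field. apply not_0_INR; lia. }
    refine (is_RInt_derive (V := R_CompleteNormedModule) (fun s => - (1 - s) ^ S n / INR (S n)) _ 0 1 _ _).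
    + intros x _. auto_derive; [exact I|]. change (Init.Nat.pred (S n)) with n.
      change (match n with 0%nat => 1 | S _ => INR n + 1 end) with (INR (S n)). replace (1 + - x) with (1 - x) by ring. field. apply not_0_INR; lia.
    + intros x _. apply (ex_derive_continuous (V := R_NormedModule)); auto_derive; exact I.
Qed.

Lemma pow_diff_le a b n : 0 <= b <= a -> a ^ n - b ^ n <= INR n * a ^ pred n * (a - b).
Proof.
  intros H; induction n; [simpl; lra|].
  simpl pred. destruct n; [simpl; lra|]. simpl pred in IHn.
  rewrite (S_INR (S n)). change (a ^ S (S n)) with (a * a ^ S n). change (b ^ S (S n)) with (b * b ^ S n).
  assert (b ^ S n <= a ^ S n) by (apply pow_incr; lra).
  assert (0 <= b ^ S n) by (apply pow_le; lra).
  change (a ^ S n) with (a * a ^ n) in *. set (p := a ^ n) in *. set (q := b ^ S n) in *.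
  assert (a * (a * p - q) <= a * (INR (S n) * p * (a - b))) by (apply Rmult_le_compat_l; lra).
  replace (a * (a * p) - b * q) with (a * (a * p - q) + q * (a - b)) by ring.
  assert (q * (a - b) <= a * p * (a - b)) by (apply Rmult_le_compat_r; lra).
  lra.
Qed.

Lemma exp_neg_sub_le s : 0 <= s -> 0 <= exp (- s) - (1 - s) <= s ^ 2.
Proof.
  intros Hs. pose proof (exp_ineq1_le (- s)) as H. split; [lra|].
  pose proof (exp_ineq1_le s) as H2. pose proof (exp_pos s). pose proof (exp_pos (- s)).
  assert (E : exp (- s) * exp s = 1) by (rewrite <- exp_plus, Rplus_opp_l; apply exp_0).
  assert (E2 : exp (- s) * (1 + s) <= 1) by nra.
  assert (1 <= (1 - s + s ^ 2) * (1 + s)) by nra. 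
  apply (Rmult_le_reg_r (1 + s)); [lra|]. nra.
Qed.

(** Replacing (1 - s)^n by exp (-n s) changes the integrand by at most n s exp (-(n-1) s), because
    exp (-s) - (1 - s) <= s^2 and a^n - b^n <= n a^(n-1) (a - b). *)
Lemma Ein_harm n : (2 <= n)%nat -> Cmod (Ein (INR n) - harm n) <= INR n * (1 / (INR (pred n)) ^ 2).
Proof.
  intros Hn. assert (Hn1 : 1 <= INR (pred n)) by (apply (le_INR 1); lia).
  assert (Hh : cint (fun s => RtoC ((1 - (1 - s) ^ n) / s)) 0 1 (harm n)).
  { split; [exact (is_RInt_harm n)|]. simpl.
    evar_last; [apply (is_RInt_const (V := R_NormedModule))|]. unfold scal; simpl; unfold mult; simpl; ring. }
  pose proof (cint_minus _ _ _ _ _ _ (cint_Ein (INR n)) Hh) as X.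
  destruct (edom_RInt 1 (INR (pred n)) (INR n) ltac:(lra) (pos_INR n) 1 Rle_0_1) as [G [HG1 HG2]].
  replace (INR n * (1 / INR (pred n) ^ 2)) with (INR n * (INR (fact 1) / INR (pred n) ^ 2)) by (simpl; reflexivity).
  eapply Rle_trans; [|exact HG2].
  refine (cint_norm_le _ _ 0 1 _ _ Rle_0_1 _ X HG1).
  intros s Hs. unfold Ein_int.
  replace (- (s * INR n))%C with (RtoC (- (s * INR n))) by (now rewrite RtoC_opp, RtoC_mult).
  rewrite Cexp_RtoC, <- RtoC_minus, <- RtoC_div, <- RtoC_minus by lra. rewrite Cmod_R.
  replace ((1 - exp (- (s * INR n))) / s - (1 - (1 - s) ^ n) / s) with (- ((exp (- s) ^ n - (1 - s) ^ n) / s)).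
  2:{ replace (exp (- (s * INR n))) with (exp (- s) ^ n); [field; lra|]. 
      clear. induction n; [simpl; rewrite Rmult_0_r, Ropp_0, exp_0; reflexivity|].
      rewrite <- tech_pow_Rmult, IHn, <- exp_plus, S_INR. f_equal; ring. }
  rewrite Rabs_Ropp.
  destruct (exp_neg_sub_le s ltac:(lra)) as [E1 E2].
  assert (P : 0 <= exp (- s) ^ n - (1 - s) ^ n).
  { assert ((1 - s) ^ n <= exp (- s) ^ n) by (apply pow_incr; lra). lra. }
  rewrite Rabs_pos_eq by (apply Rmult_le_pos; [exact P|left; apply Rinv_0_lt_compat; lra]).
  pose proof (pow_diff_le (exp (- s)) (1 - s) n ltac:(lra)) as D.
  assert (Ep : exp (- s) ^ pred n = exp (- INR (pred n) * s)).
  { generalize (pred n). clear. intros n. induction n; [simpl; rewrite Ropp_0, Rmult_0_l, exp_0; reflexivity|].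
    rewrite <- tech_pow_Rmult, IHn, <- exp_plus, S_INR. f_equal; ring. }
  rewrite Ep in D. unfold edom. rewrite pow_1.
  apply (Rmult_le_reg_r s); [lra|]. unfold Rdiv at 1; rewrite Rmult_assoc, Rinv_l, Rmult_1_r by lra.
  eapply Rle_trans; [exact D|].
  replace (INR n * (s * exp (- INR (pred n) * s)) * s) with (INR n * exp (- INR (pred n) * s) * s ^ 2) by ring.
  apply Rmult_le_compat_l; [|exact E2].
  apply Rmult_le_pos; [apply pos_INR|left; apply exp_pos].
Qed.

(* The exponential integral [E_1]. *)
Definition Erem (v : C) : C := (Ein v - euler_gamma - L0 v)%C.

Lemma L0_RtoC x : 0 < x -> L0 x = RtoC (ln x).
Proof.
  intros Hx. symmetry. apply L0_unique; [rewrite Cexp_RtoC, exp_ln; auto|exact Hx|].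
  simpl. rewrite Rabs_R0. pose proof PI_RGT_0; lra.
Qed.

Lemma Erem_INR_lim : is_lim_seq (fun n => Cmod (Erem (INR n))) 0.
Proof.
  apply (is_lim_seq_le_le_loc (fun _ => 0) _ (fun n => INR n * (1 / (INR (pred n)) ^ 2) + Rabs (harm n - ln (INR n) - euler_gamma))).
  - exists 2%nat; intros n Hn. split; [apply Cmod_ge_0|].
    assert (0 < INR n) by (apply lt_0_INR; lia).
    unfold Erem. rewrite L0_RtoC by assumption.
    replace (Ein (INR n) - euler_gamma - ln (INR n))%C with ((Ein (INR n) - harm n) + RtoC (harm n - ln (INR n) - euler_gamma))%C by (rewrite !RtoC_minus; ring).
    eapply Rle_trans; [apply Cmod_triangle|]. rewrite Cmod_R.
    apply Rplus_le_compat_r, Ein_harm, Hn.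
  - apply is_lim_seq_const.
  - replace (Finite 0) with (Finite (0 + 0)) by (f_equal; ring). apply is_lim_seq_plus'.
    + apply (is_lim_seq_incr_n _ 2). 
      apply (is_lim_seq_le_le (fun _ => 0) _ (fun n => 2 * / INR (S n))).
      * intros n. replace (n + 2)%nat with (S (S n)) by lia. simpl pred.
        assert (1 <= INR (S n)) by (apply (le_INR 1); lia). rewrite (S_INR (S n)).
        set (x := INR (S n)) in *.
        assert (0 < / x) by (apply Rinv_0_lt_compat; lra).
        replace ((x + 1) * (1 / x ^ 2)) with ((1 + / x) * / x) by (field; lra).
        assert (/ x <= 1) by (rewrite <- Rinv_1; apply Rinv_le_contravar; lra). nra.
      * apply is_lim_seq_const.
      * replace (Finite 0) with (Finite (2 * 0)) by (f_equal; ring).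
        apply (is_lim_seq_scal_l _ 2 (Finite 0)), (is_lim_seq_incr_1 (fun n => / INR n)).
        apply is_lim_seq_inv_INR.
    + replace 0 with (Rabs (euler_gamma - euler_gamma)) by (rewrite Rminus_diag; apply Rabs_R0).
      apply (is_lim_seq_abs _ (Finite _)), is_lim_seq_minus'; [apply is_lim_seq_gamma|apply is_lim_seq_const].
Qed.

Lemma cder_line (w e : C) (s : R) : cder (fun s : R => w + s * e)%C s e.
Proof.
  eapply cder_eq; [apply cder_plus; [apply cder_const|apply cder_mult; [apply cder_id|apply cder_const]]|cbv beta; ring].
Qed.

Lemma cder_Erem_line (w e : C) (s : R) : 0 < Re (w + s * e)%C ->
  cder (fun s : R => Erem (w + s * e)) s (- (e * Cexp (- (w + s * e)) / (w + s * e)))%C.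
Proof.
  intros Hv. assert (Hv0 : (w + s * e)%C <> 0%C) by (intros E; rewrite E in Hv; simpl in Hv; lra).
  eapply cder_eq.
  - apply cder_minus; [apply cder_minus; [now apply cder_Ein_line|apply cder_const]|apply cder_L0; [apply cder_line|exact Hv]].
  - cbv beta. field. exact Hv0.
Qed.

(** The derivative of E_1 is -exp (-v) / v, of modulus at most exp (-m) / m for Re v >= m, and this
    half plane is convex. *)
Lemma Erem_segment (p q : C) m : 0 < m -> m <= Re p -> m <= Re q ->
  Cmod (Erem q - Erem p) <= Cmod (q - p) * (exp (- m) / m).
Proof.
  intros Hm Hp Hq. set (e := (q - p)%C).
  assert (Hv : forall s, 0 <= s <= 1 -> m <= Re (p + s * e)%C).
  { intros s Hs. unfold e. rewrite re_plus, re_scal_l. unfold Cminus. rewrite re_plus, re_opp. nra. }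
  assert (Hnz : forall s : R, 0 <= s <= 1 -> (p + s * e)%C <> 0%C).
  { intros s Hs E. specialize (Hv s Hs). rewrite E in Hv. simpl in Hv; lra. }
  assert (I : cint (fun s : R => - (e * Cexp (- (p + s * e)) / (p + s * e)))%C 0 1 (Erem (p + 1 * e) - Erem (p + 0 * e))%C).
  { apply (cint_derive (fun s : R => Erem (p + s * e))); rewrite Rmin_left, Rmax_right by lra; intros s Hs.
    - apply cder_Erem_line. specialize (Hv s Hs); lra.
    - assert (Cl : ccont (fun s : R => p + s * e)%C s) by (eapply cder_ccont, cder_line).
      apply ccont_opp, ccont_div; [|exact Cl|now apply Hnz].
      apply ccont_mult; [apply ccont_const|apply ccont_Cexp, ccont_opp, Cl]. }
  replace (p + 1 * e)%C with q in I by (unfold e; ring). replace (p + 0 * e)%C with p in I by ring.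
  refine (cint_norm_le_unit _ _ _ _ I).
  intros s Hs. assert (Hs' : 0 <= s <= 1) by lra.
  rewrite Cmod_opp, Cmod_div, Cmod_mult, Cmod_Cexp by now apply Hnz.
  pose proof (Hv s Hs') as V. pose proof (Re_le_Cmod (p + s * e)) as V2. apply Rabs_le_between in V2.
  unfold Rdiv. rewrite Rmult_assoc. apply Rmult_le_compat_l; [apply Cmod_ge_0|].
  apply Rmult_le_compat; [left; apply exp_pos|left; apply Rinv_0_lt_compat; lra| |apply Rinv_le_contravar; lra].
  apply exp_le. rewrite re_opp. lra.
Qed.

Lemma is_lim_exp_neg_INR : is_lim_seq (fun n => exp (- INR n)) 0.
Proof.
  apply (is_lim_comp_seq exp (fun n => - INR n) m_infty 0 is_lim_exp_m).
  - exists 0%nat; intros; discriminate.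
  - replace m_infty with (Rbar_opp p_infty) by reflexivity. apply -> is_lim_seq_opp. apply is_lim_seq_INR.
Qed.

(** E_1 is so far known to vanish at infinity only along the integers. A point of the line is joined
    to the integer part [n] of its real part; the segment has length O(n) and the derivative on it
    is at most exp (-n) / n. *)
Lemma Erem_line_lim (w e : C) : 0 < Re e -> clim (fun s : R => Erem (w + s * e)) 0.
Proof.
  intros He.
  (* With n the integer part of Re v one has s <= (n + 1 + |w|) / Re e, whence |v - n| <= A + B
     n. *)
  set (A := (Cmod w + 1 + Cmod w) / Re e * Cmod e + Cmod w). set (B := Cmod e / Re e + 1).
  assert (L : is_lim_seq (fun n => Cmod (Erem (INR n)) + (A + B) * exp (- INR n)) 0).
  { replace (Finite 0) with (Finite (0 + (A + B) * 0)) by (f_equal; ring).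
    apply is_lim_seq_plus'; [apply Erem_INR_lim|].
    exact (is_lim_seq_scal_l _ (A + B) (Finite 0) is_lim_exp_neg_INR). }
  pose proof (Cmod_ge_0 w) as Hw0. pose proof (Cmod_ge_0 e) as He0.
  assert (Hie : 0 < / Re e) by now apply Rinv_0_lt_compat.
  assert (HA : 0 <= A) by (unfold A, Rdiv; assert (0 <= (Cmod w + 1 + Cmod w) * / Re e) by nra; nra).
  assert (HB : 0 <= B) by (unfold B, Rdiv; nra).
  assert (K : is_lim (fun s => Cmod (Erem (w + s * e))) p_infty 0).
  { apply is_lim_spec. intros eps.
    destruct (proj2 (is_lim_seq_spec _ _) L eps) as [n0 Hn0].
    exists ((INR (S (S n0)) + Cmod w) / Re e); intros s Hs.
    assert (Hs1 : INR (S (S n0)) + Cmod w < s * Re e).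
    { apply (Rmult_lt_compat_r (Re e)) in Hs; [|assumption].
      unfold Rdiv in Hs; rewrite Rmult_assoc, Rinv_l, Rmult_1_r in Hs by lra. exact Hs. }
    set (v := (w + s * e)%C).
    assert (Rv : Re v = Re w + s * Re e) by (unfold v; rewrite re_plus, re_scal_l; reflexivity).
    pose proof (Re_le_Cmod w) as Rw. apply Rabs_le_between in Rw.
    rewrite !S_INR in Hs1. pose proof (pos_INR n0) as P0.
    destruct (nfloor_ex (Re v) ltac:(lra)) as [n Hn].
    assert (Hnn : (n0 < n)%nat) by (apply INR_lt; lra).
    assert (Hn1 : 1 <= INR n) by (apply (le_INR 1); lia).
    assert (Hs0 : 0 <= s) by nra.
    specialize (Hn0 n ltac:(lia)). rewrite Rminus_0_r in Hn0 |- *.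
    rewrite (Rabs_pos_eq (Cmod _)) by apply Cmod_ge_0.
    eapply Rle_lt_trans; [|eapply Rle_lt_trans; [apply Rle_abs|exact Hn0]].
    replace (Erem v) with (Erem (INR n) + (Erem v - Erem (INR n)))%C by ring.
    eapply Rle_trans; [apply Cmod_triangle|]. apply Rplus_le_compat_l.
    eapply Rle_trans; [apply (Erem_segment (INR n) v (INR n)); [lra|apply Rle_refl|lra]|].
    assert (Hd : Cmod (v - INR n) <= (A + B) * INR n).
    { eapply Rle_trans; [apply Cmod_triangle|]. rewrite Cmod_opp, Cmod_R, (Rabs_pos_eq (INR n)) by lra.
      assert (Cmod v <= Cmod w + s * Cmod e).
      { unfold v. eapply Rle_trans; [apply Cmod_triangle|]. rewrite Cmod_mult, Cmod_R, Rabs_pos_eq by lra. lra. }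
      assert (Hse : s <= (INR n + 1 + Cmod w) * / Re e).
      { apply (Rmult_le_reg_r (Re e)); [assumption|]. rewrite Rmult_assoc, Rinv_l, Rmult_1_r by lra. lra. }
      assert (s * Cmod e <= (INR n + 1 + Cmod w) * / Re e * Cmod e) by (apply Rmult_le_compat_r; lra).
      assert (HA1 : 0 <= Cmod w * / Re e * Cmod e) by (apply Rmult_le_pos; [apply Rmult_le_pos|]; lra).
      assert (HA2 : 0 <= / Re e * Cmod e) by (apply Rmult_le_pos; lra).
      unfold A, B, Rdiv. nra. }
    replace (Cmod (v - INR n) * (exp (- INR n) / INR n)) with (Cmod (v - INR n) * / INR n * exp (- INR n)) by (field; lra).
    apply Rmult_le_compat_r; [left; apply exp_pos|].
    apply (Rmult_le_reg_r (INR n)); [lra|]. rewrite Rmult_assoc, Rinv_l, Rmult_1_r by lra. exact Hd. }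
  apply clim_Cmod_0 with (g := fun s => Cmod (Erem (w + s * e))); [|exact K].
  exists 0; intros; apply Rle_refl.
Qed.

Lemma IInf_FTC (h dh : R -> C) l :
  (forall s, 0 <= s -> cder h s (dh s)) -> (forall s, 0 <= s -> ccont dh s) -> clim h l -> IInf dh (l - h 0)%C.
Proof.
  intros H1 H2 H3. exists (fun r => h r - h 0)%C; split.
  - intros r Hr. apply cint_derive; rewrite Rmin_left by assumption; intros; [apply H1|apply H2]; lra.
  - unfold Cminus. apply clim_plus; [exact H3|apply clim_const].
Qed.

(** Up to the factor -exp z the integrand is the derivative of E_1 along the ray from [z], which
    stays in the right half plane; the value is exp (z) E_1 (z), whatever the direction. *)
Lemma IInf_E1 (z e : C) : 0 < Re z -> 0 < Re e ->
  IInf (fun s : R => e * Cexp (- (s * e)) / (s * e + z))%C (Cexp z * (Ein z - euler_gamma - Clog z)).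
Proof.
  intros Hz He.
  assert (Hv : forall s, 0 <= s -> 0 < Re (z + s * e)%C).
  { intros s Hs. rewrite re_plus, re_scal_l. nra. }
  assert (Hnz : forall s : R, 0 <= s -> (z + s * e)%C <> 0%C).
  { intros s Hs E. specialize (Hv s Hs). rewrite E in Hv. simpl in Hv; lra. }
  pose proof (IInf_FTC (fun s : R => Erem (z + s * e)) (fun s : R => - (e * Cexp (- (z + s * e)) / (z + s * e)))%C 0) as X.
  assert (Y : IInf (fun s : R => - (e * Cexp (- (z + s * e)) / (z + s * e)))%C (0 - Erem (z + 0 * e))%C).
  { apply X.
    - intros s Hs; apply cder_Erem_line, Hv, Hs.
    - intros s Hs. assert (Cl : ccont (fun s : R => z + s * e)%C s) by (eapply cder_ccont, cder_line).
      apply ccont_opp, ccont_div; [|exact Cl|now apply Hnz].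
      apply ccont_mult; [apply ccont_const|apply ccont_Cexp, ccont_opp, Cl].
    - now apply Erem_line_lim. }
  apply (IInf_scal _ _ (- Cexp z)%C) in Y.
  replace (Cexp z * (Ein z - euler_gamma - Clog z))%C with (- Cexp z * (0 - Erem (z + 0 * e)))%C.
  - eapply IInf_ext; [|exact Y]. intros s Hs; cbv beta.
    replace (- (z + s * e))%C with (- z + - (s * e))%C by ring. rewrite Cexp_plus, Cexp_opp.
    assert ((s * e + z)%C <> 0%C) by (rewrite Cplus_comm; apply Hnz; lra).
    rewrite (Cplus_comm z). field. split; [assumption|apply Cexp_nz].
  - replace (z + 0 * e)%C with z by ring. unfold Erem. rewrite Clog_L0 by assumption. ring.
Qed.

(* The ray from [-z] in direction [tau + i sigma] stays in a half plane missing [0]; on it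
   [L0 (v * rho) + ell] is a branch of the logarithm, equal to [Log z + i pi sigma] at its
   origin and to the principal one near infinity. *)
Lemma IInf_Ei (z : C) (th sg : R) : 0 < th < PI / 2 -> sg * sg = 1 -> 0 < Re z ->
  tan th * Rabs (Im z) < Re z ->
  let e : C := (tan th, sg) in
  IInf (fun s : R => e * Cexp (- (s * e)) / (s * e - z))%C
    (Cexp (- z) * (Ein (- z) - euler_gamma - Clog z - Ci * PI * sg)).
Proof.
  intros Hth Hsg Hz Hsec e.
  assert (Hsg' : sg = 1 \/ sg = -1).
  { assert ((sg - 1) * (sg + 1) = 0) by nra. apply Rmult_integral in H; lra. }
  assert (Hcos : 0 < cos th) by (apply cos_gt_0; lra).
  assert (Hsin : 0 < sin th) by (apply sin_gt_0; pose proof PI_RGT_0; lra).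
  pose proof (sin2_cos2 th) as SC; unfold Rsqr in SC.
  set (tau := tan th) in *. assert (Htau : 0 < tau) by (apply tan_gt_0; lra).
  assert (Ht : tau * cos th = sin th) by (unfold tau, tan; field; lra).
  (* The product e * rho is purely imaginary, so [rho] carries the ray to a line of constant real
     part Re z - sg tau Im z, positive by the cone condition; [ell] is a logarithm of 1 / rho. *)
  set (rho := (- (1), - (sg * tau)) : C).
  set (ell := (ln (cos th), sg * (PI - th)) : C).
  assert (Hell : (Cexp ell * rho)%C = 1%C).
  { unfold Cexp, ell, rho; simpl. rewrite exp_ln by assumption.
    assert (C1 : cos (sg * (PI - th)) = - cos th).
    { destruct Hsg' as [-> | ->].
      - rewrite Rmult_1_l. replace (PI - th) with (PI + - th) by ring. rewrite Rplus_comm, neg_cos, cos_neg. reflexivity.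
      - replace (-1 * (PI - th)) with (- (PI + - th)) by ring. rewrite cos_neg, Rplus_comm, neg_cos, cos_neg. reflexivity. }
    assert (S1 : sin (sg * (PI - th)) = sg * sin th).
    { destruct Hsg' as [-> | ->].
      - rewrite !Rmult_1_l. apply sin_PI_x.
      - replace (-1 * (PI - th)) with (- (PI - th)) by ring. rewrite sin_neg, sin_PI_x. ring. }
    rewrite C1, S1. apply C_ext; simpl.
    - replace (cos th * - cos th * - (1) - cos th * (sg * sin th) * - (sg * tau)) with (cos th * cos th + (sg * sg) * sin th * (tau * cos th)) by ring.
      rewrite Hsg, Ht. lra.
    - replace (cos th * - cos th * - (sg * tau) + cos th * (sg * sin th) * - (1)) with (cos th * sg * (tau * cos th) - cos th * sg * sin th) by ring.
      rewrite Ht; ring. }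
  set (v := fun s : R => (- z + s * e)%C).
  assert (Hrho : forall s : R, (v s * rho)%C = (- z * rho + s * (e * rho))%C) by (intros; unfold v; ring).
  assert (Hv' : forall s : R, 0 < Re (v s * rho)%C).
  { intros s.
    replace (Re (v s * rho)%C) with (Re z - sg * Im z * tau).
    2:{ unfold v, rho, e, Re, Im. destruct z as [zx zy]; simpl.
      transitivity (zx - sg * zy * tau + s * tau * (sg * sg - 1)); [rewrite Hsg; ring|ring]. }
    pose proof (Rle_abs (Im z)). pose proof (Rle_abs (- Im z)) as Hab; rewrite Rabs_Ropp in Hab.
    destruct Hsg' as [-> | ->]; nra. }
  assert (Hv0 : forall s : R, v s <> 0%C).
  { intros s E. specialize (Hv' s). rewrite E, Cmult_0_l in Hv'. simpl in Hv'; lra. }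
  assert (Hrho0 : rho <> 0%C) by (intros E; apply (f_equal Re) in E; simpl in E; lra).
  assert (Ei : Cexp ell = (/ rho)%C).
  { transitivity (Cexp ell * rho / rho)%C; [field; assumption|rewrite Hell; field; assumption]. }
  set (h := fun s : R => (Ein (v s) - euler_gamma - L0 (v s * rho) - ell)%C).
  assert (Hder : forall s : R, cder h s (- (e * Cexp (- v s) / v s))%C).
  { intros s. eapply cder_eq.
    - apply cder_minus; [apply cder_minus; [apply cder_minus; [apply cder_Ein_line, Hv0|apply cder_const]|]|apply cder_const].
      apply cder_L0; [apply cder_mult; [apply cder_line|apply cder_const]|apply Hv'].
    - cbv beta. fold (v s). specialize (Hv0 s). field. split; assumption. }
  assert (Hcont : forall s : R, ccont (fun s => - (e * Cexp (- v s) / v s))%C s).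
  { intros s. assert (Cl : ccont v s) by (eapply cder_ccont, cder_line).
    apply ccont_opp, ccont_div; [|exact Cl|apply Hv0].
    apply ccont_mult; [apply ccont_const|apply ccont_Cexp, ccont_opp, Cl]. }
  pose proof PI_RGT_0 as HPI.
  assert (Hlim : clim h 0).
  { destruct (Erem_line_lim (- z) e) as [L1 L2]; [exact Htau|].
    (* Beyond this parameter the ray is in the right half plane. There the two logarithms agree,
       since the imaginary part of the branch is below pi/2 + (pi - th), within the range of
       [L0_unique]. *)
    assert (EE : forall s, Re z / tau < s -> Erem (- z + s * e) = h s).
    { intros s Hs. unfold h, Erem. fold (v s).
      assert (Rv : 0 < Re (v s)).
      { unfold v, e. rewrite re_plus, re_opp, re_scal_l. simpl.
        apply (Rmult_lt_compat_r tau) in Hs; [|assumption].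
        unfold Rdiv in Hs; rewrite Rmult_assoc, Rinv_l, Rmult_1_r in Hs by lra. unfold Re in *; lra. }
      assert (X : (L0 (v s * rho) + ell)%C = L0 (v s)).
      { apply L0_unique; [|exact Rv|].
        - rewrite Cexp_plus, Cexp_L0, Ei by apply Hv'. field; assumption.
        - rewrite im_plus. eapply Rle_lt_trans; [apply Rabs_triang|].
          pose proof (L0_Im (v s * rho)).
          assert (Rabs (Im ell) = PI - th).
          { unfold ell; simpl. rewrite Rabs_mult, (Rabs_pos_eq (PI - th)) by lra.
            destruct Hsg' as [-> | ->]; [rewrite Rabs_R1|rewrite Rabs_left by lra]; ring. }
          lra. }
      rewrite <- X. ring. }
    split; [eapply is_lim_ext_loc; [|exact L1]|eapply is_lim_ext_loc; [|exact L2]]; exists (Re z / tau); intros s Hs; rewrite EE by assumption; reflexivity. }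
  pose proof (IInf_FTC h _ 0 (fun s _ => Hder s) (fun s _ => Hcont s) Hlim) as Y.
  apply (IInf_scal _ _ (- Cexp (- z))%C) in Y.
  replace (Cexp (- z) * (Ein (- z) - euler_gamma - Clog z - Ci * PI * sg))%C with (- Cexp (- z) * (0 - h 0))%C.
  - eapply IInf_ext; [|exact Y]. intros s Hs; cbv beta.
    pose proof (Hv0 s) as N. unfold v in *.
    replace (- (- z + s * e))%C with (z + - (s * e))%C by ring. rewrite Cexp_plus, Cexp_opp.
    replace (- z + s * e)%C with (s * e - z)%C in * by ring.
    field. split; [assumption|apply Cexp_nz].
  - unfold h. replace (v 0) with (- z)%C by (unfold v; ring).
    assert (X : (L0 (- z * rho) + ell - Ci * PI * sg)%C = Clog z).
    { rewrite Clog_L0 by assumption. pose proof (Hv' 0) as P. replace (v 0) with (- z)%C in P by (unfold v; ring).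
      apply L0_unique; [|exact Hz|].
      - unfold Cminus. rewrite !Cexp_plus, Cexp_L0, Ei by assumption.
        replace (Cexp (- (Ci * PI * sg))) with (- RtoC 1)%C; [field; assumption|].
        symmetry. unfold Cexp. 
        replace (Re (- (Ci * PI * sg))) with 0 by (unfold Re; simpl; ring).
        replace (Im (- (Ci * PI * sg))) with (- sg * PI) by (unfold Im; simpl; ring).
        rewrite exp_0. destruct Hsg' as [-> | ->].
        + replace (- (1) * PI) with (- PI) by ring. rewrite cos_neg, sin_neg, cos_PI, sin_PI. apply C_ext; simpl; ring.
        + replace (- (-1) * PI) with PI by ring. rewrite cos_PI, sin_PI. apply C_ext; simpl; ring.
      - pose proof (L0_Im (- z * rho)) as B. apply Rabs_lt_between in B.
        replace (Im (L0 (- z * rho) + ell - Ci * PI * sg)) with (Im (L0 (- z * rho)) - sg * th).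
        + apply Rabs_lt_between. destruct Hsg' as [-> | ->]; lra.
        + unfold Cminus. rewrite !im_plus, im_opp. unfold ell. simpl (Im (ln _, _)).
          replace (Im (Ci * PI * sg)) with (PI * sg) by (unfold Im; simpl; ring). unfold Im; simpl; ring. }
    rewrite <- X. ring.
Qed.

(** * Shi and Chi through the entire function [Ein] *)

Lemma Shi_Ein (z : C) : z <> 0%C -> Shi z = ((Ein z - Ein (- z)) / 2)%C.
Proof.
  intros Hz. unfold Shi, CInt0.
  assert (X : cint (fun t : R => Csinh (t * z) / (t * z))%C 0 1 (/ (2 * z) * (Ein z - Ein (- z)))%C).
  { eapply cint_ext; [|apply cint_scal, cint_minus; [apply (cint_Ein z)|apply (cint_Ein (- z))]].
    rewrite Rmin_left by lra. intros t Ht. cbv beta. unfold Csinh, Ein_int.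
    assert (RtoC t <> 0%C) by (intros E; apply RtoC_inj in E; lra).
    replace (- (t * - z))%C with (t * z)%C by ring. field. split; assumption. }
  apply cint_is_RInt in X. rewrite (is_RInt_unique _ _ _ _ X). field. exact Hz.
Qed.

Lemma Chi_Ein (z : C) : z <> 0%C -> Chi z = (euler_gamma + Clog z - (Ein z + Ein (- z)) / 2)%C.
Proof.
  intros Hz. unfold Chi, CInt0.
  assert (X : cint (fun t : R => (Ccosh (t * z) - 1) / (t * z))%C 0 1 (- / (2 * z) * (Ein z + Ein (- z)))%C).
  { eapply cint_ext; [|apply cint_scal, cint_plus; [apply (cint_Ein z)|apply (cint_Ein (- z))]].
    rewrite Rmin_left by lra. intros t Ht. cbv beta. unfold Ccosh, Ein_int.
    assert (RtoC t <> 0%C) by (intros E; apply RtoC_inj in E; lra).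
    replace (- (t * - z))%C with (t * z)%C by ring. field. split; assumption. }
  apply cint_is_RInt in X. rewrite (is_RInt_unique _ _ _ _ X). field. exact Hz.
Qed.

Lemma sinhShi_coshChi_Ein (z : C) : z <> 0%C ->
  sinhShi_coshChi z = ((Cexp z * (Ein z - euler_gamma - Clog z) + Cexp (- z) * (Ein (- z) - euler_gamma - Clog z)) / 2)%C.
Proof.
  intros Hz. unfold sinhShi_coshChi. rewrite Shi_Ein, Chi_Ein by assumption. unfold Csinh, Ccosh. field.
Qed.

(* The two rays pass the pole [u = z] on either side; averaging cancels the residues [+- i pi]. *)
Lemma IInf_sinhShi_coshChi (z : C) (th : R) : 0 < th < PI / 2 -> 0 < Re z -> tan th * Rabs (Im z) < Re z ->
  exists l : R -> C,
    (forall sg : R, sg * sg = 1 -> let e : C := (tan th, sg) in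
       IInf (fun s : R => e * Cexp (- (s * e)) * (s * e) / ((s * e) * (s * e) - z * z))%C (l sg)) /\
    sinhShi_coshChi z = ((l 1 + l (-1)) / 2)%C.
Proof.
  intros Hth Hz Hsec.
  assert (Hz0 : z <> 0%C) by (intros ->; simpl in Hz; lra).
  assert (Htan : 0 < tan th) by (apply tan_gt_0; lra).
  exists (fun sg => (/ 2 * (Cexp z * (Ein z - euler_gamma - Clog z) + Cexp (- z) * (Ein (- z) - euler_gamma - Clog z - Ci * PI * sg)))%C).
  split.
  - intros sg Hsg e.
    pose proof (IInf_scal _ _ (/ 2)%C (IInf_plus _ _ _ _ (IInf_E1 z e Hz Htan) (IInf_Ei z th sg Hth Hsg Hz Hsec))) as X.
    eapply IInf_ext; [|exact X]. intros s Hs; cbv beta. fold e.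
    assert (N1 : (s * e + z)%C <> 0%C).
    { intros E. apply (f_equal Re) in E. rewrite re_plus, re_scal_l in E. simpl in E. unfold Re in *; nra. }
    (* On the ray tan th times |Im| equals Re, so the strict cone inequality keeps [z] off it. *)
    assert (N2 : (s * e - z)%C <> 0%C).
    { intros E. assert (Ez : z = (s * e)%C) by (rewrite <- (Cplus_0_r z), <- E; ring).
      rewrite Ez, im_scal_l, re_scal_l in Hsec. simpl in Hsec.
      assert (Rabs sg = 1) by (assert (Rabs sg * Rabs sg = 1) by (rewrite <- Rabs_mult, Hsg; apply Rabs_R1); pose proof (Rabs_pos sg); nra).
      rewrite Rabs_mult, (Rabs_pos_eq s), H in Hsec by lra. lra. }
    replace ((s * e) * (s * e) - z * z)%C with ((s * e + z) * (s * e - z))%C by ring.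
    field. split; assumption.
  - rewrite sinhShi_coshChi_Ein by assumption. replace (RtoC (-1)) with (- RtoC 1)%C by (rewrite <- RtoC_opp; reflexivity). field.
Qed.

(** * Rotating rays of integration *)

(* Complex differentiability of [g] in the form of the chain rule along arbitrary curves. *)
Definition chol (g g' : C -> C) : Prop :=
  forall (f : R -> C) t a, cder f t a -> cder (fun s => g (f s)) t (a * g' (f t))%C.

Definition lbdd (g : C -> C) : Prop :=
  forall M, exists K, forall x, Cmod x <= M -> Cmod (g x) <= K.

Lemma chol_eq g g' h : chol g g' -> (forall x, g' x = h x) -> chol g h.
Proof. intros H E f t a Hf. rewrite <- E. now apply H. Qed.

Lemma chol_const c : chol (fun _ => c) (fun _ => 0%C).
Proof. intros f t a _. rewrite Cmult_0_r. apply cder_const. Qed.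

Lemma chol_id : chol (fun x => x) (fun _ => 1%C).
Proof. intros f t a H. rewrite Cmult_1_r. exact H. Qed.

Lemma chol_plus g g' h h' : chol g g' -> chol h h' -> chol (fun x => g x + h x)%C (fun x => g' x + h' x)%C.
Proof. intros H1 H2 f t a Hf. rewrite Cmult_plus_distr_l. apply cder_plus; auto. Qed.

Lemma chol_mult g g' h h' : chol g g' -> chol h h' -> chol (fun x => g x * h x)%C (fun x => g' x * h x + g x * h' x)%C.
Proof.
  intros H1 H2 f t a Hf. eapply cder_eq; [apply cder_mult; [apply H1|apply H2]; exact Hf|cbv beta; ring].
Qed.

Lemma chol_pow n : chol (fun x => x ^ n)%C (fun x => INR n * x ^ pred n)%C.
Proof. intros f t a Hf. eapply cder_eq; [apply cder_pow, Hf|cbv beta; ring]. Qed.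

Lemma chol_Cexp g g' : chol g g' -> chol (fun x => Cexp (g x)) (fun x => g' x * Cexp (g x))%C.
Proof. intros H f t a Hf. eapply cder_eq; [apply cder_Cexp, H, Hf|cbv beta; ring]. Qed.

Lemma lbdd_const c : lbdd (fun _ => c).
Proof. intros M; exists (Cmod c); intros; apply Rle_refl. Qed.

Lemma lbdd_id : lbdd (fun x => x).
Proof. intros M; exists M; auto. Qed.

Lemma lbdd_plus g h : lbdd g -> lbdd h -> lbdd (fun x => g x + h x)%C.
Proof.
  intros Hg Hh M. destruct (Hg M) as [K1 H1], (Hh M) as [K2 H2]. exists (K1 + K2); intros x Hx.
  eapply Rle_trans; [apply Cmod_triangle|]. apply Rplus_le_compat; auto.
Qed.

Lemma lbdd_mult g h : lbdd g -> lbdd h -> lbdd (fun x => g x * h x)%C.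
Proof.
  intros Hg Hh M. destruct (Hg M) as [K1 H1], (Hh M) as [K2 H2]. exists (K1 * K2); intros x Hx.
  rewrite Cmod_mult. apply Rmult_le_compat; auto using Cmod_ge_0.
Qed.

Lemma lbdd_pow n : lbdd (fun x => x ^ n)%C.
Proof.
  intros M. exists (M ^ n); intros x Hx. rewrite Cmod_pow. apply pow_incr. split; [apply Cmod_ge_0|exact Hx].
Qed.

Lemma lbdd_Cexp g : lbdd g -> lbdd (fun x => Cexp (g x)).
Proof.
  intros Hg M. destruct (Hg M) as [K H]. exists (exp K); intros x Hx. rewrite Cmod_Cexp. apply exp_le.
  pose proof (Re_le_Cmod (g x)) as B; apply Rabs_le_between in B. specialize (H x Hx). lra.
Qed.

Lemma taylor_bound (h h1 h2 : R -> R) s t K :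
  (forall x, Rmin s t <= x <= Rmax s t -> is_derive h x (h1 x)) ->
  (forall x, Rmin s t <= x <= Rmax s t -> is_derive h1 x (h2 x)) ->
  (forall x, Rmin s t <= x <= Rmax s t -> Rabs (h2 x) <= K) ->
  Rabs (h t - h s - (t - s) * h1 s) <= K * (t - s) ^ 2.
Proof.
  intros H1 H2 H3.
  assert (Cn : forall (u u1 : R -> R), (forall x, Rmin s t <= x <= Rmax s t -> is_derive u x (u1 x)) ->
    forall x, Rmin s t <= x <= Rmax s t -> continuity_pt u x).
  { intros u u1 Hu x Hx. apply continuity_pt_filterlim, (ex_derive_continuous (V := R_NormedModule)). eexists; now apply Hu. }
  destruct (MVT_gen h s t h1) as [c [Hc Ec]]; [intros; apply H1; lra|now apply (Cn h h1)|].
  assert (Sub : forall x, Rmin s c <= x <= Rmax s c -> Rmin s t <= x <= Rmax s t).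
  { intros x. unfold Rmin, Rmax in *. destruct (Rle_dec s t), (Rle_dec s c); lra. }
  destruct (MVT_gen h1 s c h2) as [c' [Hc' Ec']].
  - intros x Hx; apply H2, Sub; lra.
  - intros x Hx; apply (Cn h1 h2); auto.
  - replace (h t - h s - (t - s) * h1 s) with (h2 c' * (c - s) * (t - s)) by (rewrite Ec, <- Ec'; ring).
    rewrite !Rabs_mult.
    assert (Hcs : Rabs (c - s) <= Rabs (t - s)).
    { unfold Rmin, Rmax in Hc. destruct (Rle_dec s t); [rewrite !Rabs_pos_eq by lra|rewrite !Rabs_left1 by lra]; lra. }
    specialize (H3 c' (Sub c' Hc')). pose proof (Rabs_pos (h2 c')). pose proof (Rabs_pos (c - s)). pose proof (Rabs_pos (t - s)).
    rewrite <- (pow2_abs (t - s)). simpl. rewrite Rmult_1_r, Rmult_assoc.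
    apply Rmult_le_compat; [assumption|nra|assumption|nra].
Qed.

Lemma ctaylor_bound (f f1 f2 : R -> C) s t K :
  (forall x, Rmin s t <= x <= Rmax s t -> cder f x (f1 x)) ->
  (forall x, Rmin s t <= x <= Rmax s t -> cder f1 x (f2 x)) ->
  (forall x, Rmin s t <= x <= Rmax s t -> Cmod (f2 x) <= K) ->
  Cmod (f t - f s - RtoC (t - s) * f1 s) <= 2 * K * (t - s) ^ 2.
Proof.
  intros H1 H2 H3. eapply Rle_trans; [apply Cmod_le_abs|].
  replace (2 * K * (t - s) ^ 2) with (K * (t - s) ^ 2 + K * (t - s) ^ 2) by ring.
  unfold Cminus. rewrite !re_plus, !im_plus, !re_opp, !im_opp, re_scal_l, im_scal_l.
  apply Rplus_le_compat.
  - apply (taylor_bound (fun x => Re (f x)) (fun x => Re (f1 x)) (fun x => Re (f2 x)));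
    intros x Hx; [apply H1|apply H2|eapply Rle_trans; [apply Re_le_Cmod|apply H3]]; exact Hx.
  - apply (taylor_bound (fun x => Im (f x)) (fun x => Im (f1 x)) (fun x => Im (f2 x)));
    intros x Hx; [apply H1|apply H2|eapply Rle_trans; [apply Im_le_Cmod|apply H3]]; exact Hx.
Qed.

(* Cauchy's theorem for the triangle [0, rr q0, rr q1]: the derivative in [q] of
   [q * int_0^rr g (r q) dr] is the total derivative [d/dr (r g (r q))]. *)
Lemma cauchy_triangle (g g' g'' : C -> C) (q0 q1 : C) rr (I0 I1 : C) :
  chol g g' -> chol g' g'' -> lbdd g' -> lbdd g'' -> 0 <= rr ->
  cint (fun r : R => q0 * g (r * q0))%C 0 rr I0 -> cint (fun r : R => q1 * g (r * q1))%C 0 rr I1 ->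
  cint (fun s : R => rr * (q1 - q0) * g (rr * (q0 + s * (q1 - q0))))%C 0 1 (I1 - I0).
Proof.
  intros Hg Hg' B1 B2 Hr HI0 HI1.
  set (D := (q1 - q0)%C). set (q := fun s : R => (q0 + s * D)%C).
  assert (Dq : forall s, cder q s D) by (intros; apply cder_line).
  set (I := fun s : R => (RInt (fun r : R => Re (q s * g (r * q s))%C) 0 rr, RInt (fun r : R => Im (q s * g (r * q s))%C) 0 rr)).
  assert (Dr : forall (s r : R), cder (fun r : R => r * q s)%C r (q s)).
  { intros s r. eapply cder_eq; [apply cder_mult; [apply cder_id|apply cder_const]|cbv beta; ring]. }
  assert (HI : forall s, cint (fun r : R => q s * g (r * q s))%C 0 rr (I s)).
  { intros s. destruct (cint_ex (fun r : R => q s * g (r * q s))%C 0 rr) as [l Hl].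
    - intros r _. eapply cder_ccont, cder_scal, Hg, Dr.
    - replace (I s) with l; [exact Hl|]. destruct Hl as [H1 H2]. apply C_ext; simpl; symmetry; now apply is_RInt_unique. }
  assert (DI : forall s, 0 <= s <= 1 -> cder I s (rr * D * g (rr * q s))%C).
  { intros s Hs.
    set (Q := Cmod q0 + 2 * Cmod D).
    assert (Hq : forall x, -1 <= x <= 2 -> Cmod (q x) <= Q).
    { intros x Hx. unfold q. eapply Rle_trans; [apply Cmod_triangle|]. rewrite Cmod_mult, Cmod_R. unfold Q.
      apply Rplus_le_compat_l, Rmult_le_compat_r; [apply Cmod_ge_0|apply Rabs_le; lra]. }
    assert (HQ0 : 0 <= Q) by (eapply Rle_trans; [apply Cmod_ge_0|apply (Hq 0); lra]).
    destruct (B1 (rr * Q)) as [K1 HK1]. destruct (B2 (rr * Q)) as [K2 HK2].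
    pose proof (Cmod_ge_0 D) as HD.
    (* Bounds the second derivative in [s] of q s * g (r * q s) for -1 <= s <= 2, the range reached
       from [0, 1] by increments of size at most 1. *)
    set (K := 2 * (Cmod D * Cmod D) * rr * K1 + Q * (rr * rr) * (Cmod D * Cmod D) * K2).
    assert (Hx0 : Cmod 0 <= rr * Q) by (rewrite Cmod_0; nra).
    assert (HK10 : 0 <= K1) by (eapply Rle_trans; [apply Cmod_ge_0|apply (HK1 0%C Hx0)]).
    assert (HK20 : 0 <= K2) by (eapply Rle_trans; [apply Cmod_ge_0|apply (HK2 0%C Hx0)]).
    apply cder_quadratic with (K := rr * (2 * K)). intros t Ht. apply Rabs_le_between in Ht.
    assert (J : cint (fun r : R => D * (g (r * q s) + r * (q s * g' (r * q s))))%C 0 rr (D * (rr * g (rr * q s)) - D * (0 * g (0 * q s)))%C).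
    { apply (cint_derive (fun r : R => D * (r * g (r * q s)))%C).
      - intros r _. eapply cder_eq; [apply cder_scal, cder_mult; [apply cder_id|apply Hg, Dr]|cbv beta; ring].
      - intros r _. apply ccont_mult; [apply ccont_const|apply ccont_plus; [eapply cder_ccont, Hg, Dr|]].
        apply ccont_mult; [apply ccont_id|eapply cder_ccont, cder_scal, Hg', Dr]. }
    replace (D * (rr * g (rr * q s)) - D * (0 * g (0 * q s)))%C with (rr * D * g (rr * q s))%C in J by ring.
    pose proof (cint_minus _ _ _ _ _ _ (cint_minus _ _ _ _ _ _ (HI t) (HI s)) (cint_scal _ _ _ _ (RtoC (t - s)) J)) as X.
    replace (rr * (2 * K) * (t - s) ^ 2) with ((rr - 0) * (2 * K * (t - s) ^ 2)) by ring.
    refine (cint_norm_le_const _ 0 rr _ _ Hr _ X).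
    intros r Hrr.
    assert (Dqr : forall x, cder (fun x => r * q x)%C x (r * D)%C) by (intros x; apply cder_scal, Dq).
    pose proof (ctaylor_bound (fun x => q x * g (r * q x))%C (fun x => D * g (r * q x) + q x * (r * D * g' (r * q x)))%C
      (fun x => 2 * (D * D) * (r * g' (r * q x)) + q x * (r * r * (D * D) * g'' (r * q x)))%C s t K) as T.
    replace (D * (g (r * q s) + r * (q s * g' (r * q s))))%C with (D * g (r * q s) + q s * (r * D * g' (r * q s)))%C by ring.
    assert (Hbt : forall x, Rmin s t <= x <= Rmax s t -> -1 <= x <= 2).
    { intros x Hx. unfold Rmin, Rmax in Hx. destruct (Rle_dec s t); lra. }
    apply T; clear T.
    - intros x _. apply cder_mult; [apply Dq|apply Hg, Dqr].
    - intros x _. eapply cder_eq.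
      + apply cder_plus; [apply cder_scal, Hg, Dqr|apply cder_mult; [apply Dq|apply cder_scal, Hg', Dqr]].
      + cbv beta; ring.
    - intros x Hx. specialize (Hq x (Hbt x Hx)).
      assert (Hrq : Cmod (r * q x) <= rr * Q).
      { rewrite Cmod_mult, Cmod_R, Rabs_pos_eq by lra. apply Rmult_le_compat; try lra. apply Cmod_ge_0. }
      specialize (HK1 _ Hrq). specialize (HK2 _ Hrq).
      eapply Rle_trans; [apply Cmod_triangle|]. unfold K.
      rewrite !Cmod_mult, !Cmod_R, (Rabs_pos_eq 2), (Rabs_pos_eq r) by lra.
      pose proof (Cmod_ge_0 (g' (r * q x)%C)). pose proof (Cmod_ge_0 (g'' (r * q x)%C)). pose proof (Cmod_ge_0 (q x)).
      set (DD := Cmod D * Cmod D) in *. assert (0 <= DD) by (unfold DD; nra).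
      apply Rplus_le_compat.
      + rewrite Rmult_assoc. 
        assert (r * Cmod (g' (r * q x)%C) <= rr * K1) by (apply Rmult_le_compat; lra). 
        replace (2 * DD * rr * K1) with (2 * DD * (rr * K1)) by ring.
        replace (2 * (DD * (r * Cmod (g' (r * q x)%C)))) with (2 * DD * (r * Cmod (g' (r * q x)%C))) by ring.
        apply Rmult_le_compat_l; [lra|assumption].
      + replace (Q * (rr * rr) * DD * K2) with (Q * (rr * rr * DD * K2)) by ring.
        assert (r * r <= rr * rr) by nra.
        assert (r * r * DD * Cmod (g'' (r * q x)%C) <= rr * rr * DD * K2).
        { apply Rmult_le_compat; [nra|assumption| |assumption]. apply Rmult_le_compat_r; assumption. }
        apply Rmult_le_compat; [assumption| |assumption|assumption].
        apply Rmult_le_pos; [nra|assumption]. }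
  replace (I1 - I0)%C with (I 1 - I 0)%C.
  - apply (cint_derive I); rewrite Rmin_left, Rmax_right by lra; [exact DI|].
    intros s Hs. apply ccont_mult; [apply ccont_const|].
    eapply cder_ccont, Hg, cder_scal, Dq.
  - f_equal; [|f_equal].
    + eapply cint_unique; [apply HI|]. replace (q 1) with q1 by (unfold q, D; ring). exact HI1.
    + eapply cint_unique; [apply HI|]. replace (q 0) with q0 by (unfold q, D; ring). exact HI0.
Qed.

(** A single term of the exponential series. The free exponent [p] is the means of trading powers of
    the integration variable for decay in a summation index. *)
Lemma exp_neg_le_inv_pow p x : 0 < x -> exp (- x) <= INR (fact p) / x ^ p.
Proof.
  intros Hx.
  pose proof (exp_ge_taylor x p ltac:(lra)) as T.
  assert (T2 : x ^ p / INR (fact p) <= exp x).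
  { eapply Rle_trans; [|exact T].
    destruct p as [|p']; [simpl; lra|]. rewrite tech5.
    assert (0 <= sum_f_R0 (fun k0 => x ^ k0 / INR (fact k0)) p').
    { apply cond_pos_sum. intros j. apply Rmult_le_pos; [apply pow_le; lra|left; apply Rinv_0_lt_compat, INR_fact_lt_0]. }
    lra. }
  rewrite exp_Ropp. pose proof (INR_fact_lt_0 p). pose proof (pow_lt x p Hx).
  replace (INR (fact p) / x ^ p) with (/ (x ^ p / INR (fact p))) by (field; lra).
  apply Rinv_le_contravar; [apply Rdiv_lt_0_compat; assumption|exact T2].
Qed.

Lemma is_lim_edom p k K : 0 < k -> is_lim (fun r => K * (r * edom p k r)) p_infty 0.
Proof.
  intros Hk.
  set (B := INR (fact (S (S p))) / k ^ (S (S p))).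
  assert (HB : forall r, 0 < r -> r * edom p k r <= B * / r).
  { intros r Hr. unfold edom.
    pose proof (exp_neg_le_inv_pow (S (S p)) (k * r) ltac:(nra)) as T.
    apply (Rmult_le_compat_l (r * r ^ p)) in T; [|pose proof (pow_lt r p Hr); nra].
    replace (- k * r) with (- (k * r)) by ring. rewrite <- Rmult_assoc.
    eapply Rle_trans; [exact T|]. right. unfold B. rewrite Rpow_mult_distr.
    pose proof (pow_lt k p Hk). pose proof (pow_lt r p Hr). simpl pow. field. repeat split; lra. }
  replace (Finite 0) with (Rbar_mult K 0) by (simpl; f_equal; ring).
  apply is_lim_scal_l.
  apply (is_lim_le_le_loc (fun _ => 0) (fun r => B * / r)); [|apply is_lim_const|].
  - exists 0; intros r Hr. split; [|now apply HB].
    apply Rmult_le_pos; [lra|apply edom_ge_0; lra].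
  - replace (Finite 0) with (Rbar_mult B 0) by (simpl; f_equal; ring). apply is_lim_scal_l.
    replace (Finite 0) with (Rbar_inv p_infty) by reflexivity. apply is_lim_inv; [apply is_lim_id|discriminate].
Qed.

(** By [cauchy_triangle] the partial integrals along the two directions differ by the integral over
    the far side, whose length is proportional to [r] and on which [g] decays exponentially. *)
Lemma IInf_rotate (g g' g'' : C -> C) (q0 q1 : C) l p k K :
  chol g g' -> chol g' g'' -> lbdd g' -> lbdd g'' -> 0 < k ->
  (forall r s, 0 <= r -> 0 <= s <= 1 -> Cmod (g (RtoC r * (q0 + RtoC s * (q1 - q0)))%C) <= K * edom p k r) ->
  IInf (fun r : R => q1 * g (r * q1))%C l -> IInf (fun r : R => q0 * g (r * q0))%C l.
Proof.
  intros Hg Hg' B1 B2 Hk Hb [F1 [HF1 LF1]].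
  assert (Dr : forall (r : R), cder (fun r : R => r * q0)%C r q0).
  { intros r. eapply cder_eq; [apply cder_mult; [apply cder_id|apply cder_const]|cbv beta; ring]. }
  set (F0 := fun R0 : R => (RInt (fun r : R => Re (q0 * g (r * q0))%C) 0 R0, RInt (fun r : R => Im (q0 * g (r * q0))%C) 0 R0)).
  assert (HF0 : forall r, 0 <= r -> cint (fun r : R => q0 * g (r * q0))%C 0 r (F0 r)).
  { intros s _. destruct (cint_ex (fun r : R => q0 * g (r * q0))%C 0 s) as [v Hv].
    - intros r _. eapply cder_ccont, cder_scal, Hg, Dr.
    - replace (F0 s) with v; [exact Hv|]. destruct Hv as [H1 H2]. apply C_ext; simpl; symmetry; now apply is_RInt_unique. }
  exists F0; split; [exact HF0|].
  assert (Z : clim (fun r => F1 r - F0 r)%C 0).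
  { apply clim_Cmod_0 with (g := fun r => Cmod (q1 - q0) * K * (r * edom p k r)); [|now apply is_lim_edom].
    exists 0; intros r Hr.
    pose proof (cauchy_triangle g g' g'' q0 q1 r _ _ Hg Hg' B1 B2 Hr (HF0 r Hr) (HF1 r Hr)) as X.
    refine (cint_norm_le_unit _ _ _ _ X).
    intros s Hs. rewrite !Cmod_mult, Cmod_R, Rabs_pos_eq by assumption.
    specialize (Hb r s Hr ltac:(lra)).
    replace (Cmod (q1 - q0) * K * (r * edom p k r)) with (r * Cmod (q1 - q0) * (K * edom p k r)) by ring.
    apply Rmult_le_compat_l; [|exact Hb]. apply Rmult_le_pos; [assumption|apply Cmod_ge_0]. }
  apply (clim_ext_loc (fun r => F1 r + - (F1 r - F0 r))%C); [intros; ring|].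
  replace l with (l + - 0)%C by ring. apply clim_plus; [exact LF1|now apply clim_opp].
Qed.

Definition gker (N n : nat) (la mu x : C) : C := (x ^ n * Cexp (- (la * x ^ N + mu * x)))%C.

Lemma gker_chol N n la mu : exists g' g'', chol (gker N n la mu) g' /\ chol g' g'' /\ lbdd g' /\ lbdd g''.
Proof.
  set (E := fun x : C => Cexp (- (la * x ^ N + mu * x))).
  set (w := fun x : C => (- la * (INR N * x ^ pred N) + - mu)%C).
  set (w' := fun x : C => (- la * (INR N * (INR (pred N) * x ^ pred (pred N))))%C).
  assert (HE : chol E (fun x => w x * E x)%C).
  { unfold E. eapply chol_eq.
    - apply (chol_Cexp (fun x => - (la * x ^ N + mu * x))%C w).
      eapply chol_eq; [|intros x; unfold w; reflexivity].
      assert (X : chol (fun x => - la * x ^ N + - mu * x)%C (fun x => - la * (INR N * x ^ pred N) + - mu)%C).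
      { eapply chol_eq; [apply chol_plus; [apply chol_mult; [apply chol_const|apply chol_pow]|apply chol_mult; [apply chol_const|apply chol_id]]|].
        intros x; cbv beta; ring. }
      intros f t a Hf. apply (cder_ext (fun s => - la * f s ^ N + - mu * f s)%C); [intros; ring|]. exact (X f t a Hf).
    - intros x; reflexivity. }
  assert (Hw : chol w w').
  { unfold w. eapply chol_eq.
    - apply chol_plus; [apply chol_mult; [apply chol_const|apply chol_mult; [apply chol_const|apply chol_pow]]|apply chol_const].
    - intros x; unfold w'; ring. }
  set (p1 := fun x : C => (INR n * x ^ pred n + x ^ n * w x)%C).
  set (p1' := fun x : C => (INR n * (INR (pred n) * x ^ pred (pred n)) + (INR n * x ^ pred n * w x + x ^ n * w' x))%C).
  assert (Hp1 : chol p1 p1').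
  { unfold p1. eapply chol_eq.
    - apply chol_plus; [apply chol_mult; [apply chol_const|apply chol_pow]|apply chol_mult; [apply chol_pow|apply Hw]].
    - intros x; unfold p1'; ring. }
  assert (BE : lbdd E).
  { unfold E. apply lbdd_Cexp.
    assert (X : lbdd (fun x => - la * x ^ N + - mu * x)%C) by (apply lbdd_plus; apply lbdd_mult; auto using lbdd_const, lbdd_pow, lbdd_id).
    intros M. destruct (X M) as [K HK]. exists K; intros x Hx. replace (- (la * x ^ N + mu * x))%C with (- la * x ^ N + - mu * x)%C by ring. auto. }
  assert (Bw : lbdd w) by (unfold w; apply lbdd_plus; [apply lbdd_mult; [apply lbdd_const|apply lbdd_mult]|]; auto using lbdd_const, lbdd_pow).
  assert (Bw' : lbdd w') by (unfold w'; repeat apply lbdd_mult; auto using lbdd_const, lbdd_pow).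
  assert (Bp1 : lbdd p1) by (unfold p1; apply lbdd_plus; apply lbdd_mult; auto using lbdd_const, lbdd_pow).
  assert (Bp1' : lbdd p1').
  { unfold p1'. apply lbdd_plus; [|apply lbdd_plus]; repeat apply lbdd_mult; auto using lbdd_const, lbdd_pow. }
  exists (fun x => p1 x * E x)%C, (fun x => (p1' x * E x + p1 x * (w x * E x)))%C.
  split; [|split; [|split]].
  - unfold gker. eapply chol_eq; [apply chol_mult; [apply chol_pow|exact HE]|].
    intros x; unfold p1, E; cbv beta; ring.
  - apply chol_mult; assumption.
  - now apply lbdd_mult.
  - apply lbdd_plus; [now apply lbdd_mult|apply lbdd_mult; [assumption|now apply lbdd_mult]].
Qed.

(** A total choice of the value, so that integrals depending on indices form sequences; it has
    meaning only through [IV_correct]. *)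
Definition IV (f : R -> C) : C :=
  (real (Lim (fun r => RInt (fun t => Re (f t)) 0 r) p_infty),
   real (Lim (fun r => RInt (fun t => Im (f t)) 0 r) p_infty)).

Lemma IV_correct f : (exists l, IInf f l) -> IInf f (IV f).
Proof.
  intros [l Hl]. replace (IV f) with l; [exact Hl|].
  destruct Hl as [F [HF [L1 L2]]].
  apply C_ext; unfold IV; simpl.
  - assert (X : is_lim (fun r => RInt (fun t => Re (f t)) 0 r) p_infty (Re l)).
    { eapply is_lim_ext_loc; [|exact L1]. exists 0; intros r Hr. symmetry. apply is_RInt_unique. destruct (HF r (Rlt_le _ _ Hr)); assumption. }
    now rewrite (is_lim_unique _ _ _ X).
  - assert (X : is_lim (fun r => RInt (fun t => Im (f t)) 0 r) p_infty (Im l)).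
    { eapply is_lim_ext_loc; [|exact L2]. exists 0; intros r Hr. symmetry. apply is_RInt_unique. destruct (HF r (Rlt_le _ _ Hr)); assumption. }
    now rewrite (is_lim_unique _ _ _ X).
Qed.

Lemma pow_ge_sub_1 r n : (1 <= n)%nat -> 0 <= r -> r - 1 <= r ^ n.
Proof.
  intros Hn Hr. destruct (Rle_dec r 1); [pose proof (pow_le r n Hr); lra|].
  pose proof (Rle_pow r 1 n ltac:(lra) Hn). rewrite pow_1 in *. lra.
Qed.

Definition rapid (f : R -> C) : Prop :=
  exists K k, 0 < k /\ 0 <= K /\ forall t, 0 <= t -> Cmod (f t) <= K * edom 0 k t.

Lemma edom_0_le k k' t : 0 <= t -> k <= k' -> edom 0 k' t <= edom 0 k t.
Proof. intros Ht Hk. unfold edom. simpl. rewrite !Rmult_1_l. apply exp_le. nra. Qed.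

Lemma rapid_plus f g : rapid f -> rapid g -> rapid (fun t => f t + g t)%C.
Proof.
  intros [K1 [k1 [Hk1 [HK1 H1]]]] [K2 [k2 [Hk2 [HK2 H2]]]].
  exists (K1 + K2), (Rmin k1 k2). split; [now apply Rmin_pos|split; [lra|]].
  intros t Ht. eapply Rle_trans; [apply Cmod_triangle|]. rewrite Rmult_plus_distr_r.
  apply Rplus_le_compat.
  - eapply Rle_trans; [now apply H1|]. apply Rmult_le_compat_l; [assumption|]. apply edom_0_le; [assumption|apply Rmin_l].
  - eapply Rle_trans; [now apply H2|]. apply Rmult_le_compat_l; [assumption|]. apply edom_0_le; [assumption|apply Rmin_r].
Qed.

Lemma rapid_scal f (c : C) : rapid f -> rapid (fun t => c * f t)%C.
Proof.
  intros [K [k [Hk [HK H]]]]. exists (Cmod c * K), k. pose proof (Cmod_ge_0 c).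
  split; [assumption|split; [nra|]]. intros t Ht. rewrite Cmod_mult, Rmult_assoc.
  apply Rmult_le_compat_l; [assumption|now apply H].
Qed.

Lemma rapid_clim f : rapid f -> clim f 0.
Proof.
  intros [K [k [Hk [HK H]]]].
  apply clim_Cmod_0 with (g := fun t => K * (t * edom 0 k t)); [|now apply is_lim_edom].
  exists 1; intros r Hr. eapply Rle_trans; [apply H; lra|].
  apply Rmult_le_compat_l; [assumption|]. pose proof (edom_ge_0 0 k r ltac:(lra)). nra.
Qed.

Definition sexp (N p : nat) (la : C) (t : R) : C := (RtoC t ^ p * Cexp (- (la * RtoC t ^ N)))%C.

Lemma cder_sexp N p la t :
  cder (sexp N p la) t (INR p * sexp N (pred p) la t + - la * INR N * sexp N (p + pred N) la t)%C.
Proof.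
  unfold sexp. eapply cder_eq.
  - apply cder_mult; [apply cder_pow, cder_id|apply cder_Cexp, cder_opp, cder_scal, cder_pow, cder_id].
  - cbv beta. rewrite Cpow_add_r. ring.
Qed.

Lemma ccont_sexp N p la t : ccont (sexp N p la) t.
Proof. eapply cder_ccont, cder_sexp. Qed.

(** Since t^N >= t - 1, the exponential is at most exp (k) exp (-k t); half of this decay absorbs
    t^p. *)
Lemma sexp_rapid N p la : (1 <= N)%nat -> 0 < Re la -> rapid (sexp N p la).
Proof.
  intros HN Hl. set (k := Re la) in *.
  exists (exp k * (INR (fact p) / (k / 2) ^ p)), (k / 2).
  assert (0 < INR (fact p) / (k / 2) ^ p).
  { apply Rdiv_lt_0_compat; [apply INR_fact_lt_0|apply pow_lt; lra]. }
  pose proof (exp_pos k).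
  split; [lra|split; [nra|]].
  intros t Ht. unfold sexp. rewrite Cmod_mult, Cmod_pow, Cmod_R, Rabs_pos_eq, Cmod_Cexp by assumption.
  rewrite <- RtoC_pow, re_opp, re_scal_r. fold k.
  assert (E1 : exp (- (k * t ^ N)) <= exp k * exp (- k * t)).
  { rewrite <- exp_plus. apply exp_le. pose proof (pow_ge_sub_1 t N HN Ht). nra. }
  assert (E2 : t ^ p * exp (- (k / 2) * t) <= INR (fact p) / (k / 2) ^ p).
  { destruct (Req_EM_T t 0) as [->|Ht0].
    - rewrite Rmult_0_r, exp_0. destruct p; [simpl; lra|rewrite pow_i by lia; lra].
    - assert (Hx : 0 < k / 2 * t) by nra.
      pose proof (exp_neg_le_inv_pow p (k / 2 * t) Hx) as B.
      replace (- (k / 2) * t) with (- (k / 2 * t)) by ring.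
      apply (Rmult_le_compat_l (t ^ p)) in B; [|now apply pow_le].
      eapply Rle_trans; [exact B|]. right. rewrite Rpow_mult_distr. field.
      split; apply pow_nonzero; lra. }
  unfold edom. simpl (t ^ 0). rewrite Rmult_1_l.
  replace (exp (- k * t)) with (exp (- (k / 2) * t) * exp (- (k / 2) * t)) in E1 by (rewrite <- exp_plus; f_equal; field).
  pose proof (exp_pos (- (k / 2) * t)). pose proof (pow_le t p Ht).
  eapply Rle_trans; [apply Rmult_le_compat_l; [assumption|exact E1]|].
  replace (t ^ p * (exp k * (exp (- (k / 2) * t) * exp (- (k / 2) * t)))) with (exp k * (t ^ p * exp (- (k / 2) * t)) * exp (- (k / 2) * t)) by ring.
  apply Rmult_le_compat_r; [lra|]. apply Rmult_le_compat_l; lra.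
Qed.

Lemma sexp_0 N p la : (1 <= p)%nat -> sexp N p la 0 = 0%C.
Proof. intros Hp. unfold sexp. destruct p; [lia|]. rewrite Cpow_S. ring. Qed.

(** The substitution of t^N for [t] would give the Gamma integral j! / la^(j+1); here it is an
    induction on [j], integrating the derivative of [sexp N (N j + N) la]. *)
Lemma IInf_sexp N j la : (1 <= N)%nat -> 0 < Re la ->
  IInf (sexp N (N * j + pred N) la) (INR (fact j) / (INR N * la ^ (S j)))%C.
Proof.
  intros HN Hl.
  assert (Hl0 : la <> 0%C) by (intros ->; simpl in Hl; lra).
  assert (HN0 : RtoC (INR N) <> 0%C) by (apply RtoC_neq_0, not_0_INR; lia).
  assert (Hc : forall p r, ccont (sexp N p la) r) by (intros; apply ccont_sexp).
  induction j as [|j IH].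
  - rewrite Nat.mul_0_r. simpl (0 + pred N)%nat. simpl fact. rewrite Cpow_1_r.
    assert (Y : IInf (fun t => - la * INR N * sexp N (pred N) la t)%C (0 - sexp N 0 la 0)%C).
    { apply IInf_FTC.
      - intros s _. eapply cder_eq; [apply cder_sexp|]. simpl. ring.
      - intros s _. apply ccont_mult; [apply ccont_const|apply Hc].
      - now apply rapid_clim, sexp_rapid. }
    apply (IInf_scal _ _ (- / (la * INR N))%C) in Y.
    replace (RtoC (INR 1) / (INR N * la))%C with (- / (la * INR N) * (0 - sexp N 0 la 0))%C.
    + eapply IInf_ext; [|exact Y]. intros r _; cbv beta. field. split; assumption.
    + assert (Z : (RtoC 0 ^ N)%C = 0%C) by (destruct N; [lia|rewrite Cpow_S; ring]).
      unfold sexp. rewrite Z, Cmult_0_r. replace (- RtoC 0)%C with (RtoC 0) by ring. rewrite Cexp_0.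
      simpl. field. split; assumption.
  - replace (N * S j + pred N)%nat with (N * j + N + pred N)%nat by lia.
    set (p := (N * j + N)%nat).
    assert (Y : IInf (fun t => INR p * sexp N (pred p) la t + - la * INR N * sexp N (p + pred N) la t)%C (0 - sexp N p la 0)%C).
    { apply IInf_FTC.
      - intros s _. apply cder_sexp.
      - intros s _. apply ccont_plus; apply ccont_mult; try apply ccont_const; apply Hc.
      - now apply rapid_clim, sexp_rapid. }
    rewrite sexp_0 in Y by (unfold p; lia).
    replace (pred p) with (N * j + pred N)%nat in Y by (unfold p; lia).
    pose proof (IInf_plus _ _ _ _ (IInf_scal _ _ (- / (la * INR N))%C Y) (IInf_scal _ _ (INR p / (la * INR N))%C IH)) as Z.
    replace (RtoC (INR (fact (S j))) / (INR N * la ^ S (S j)))%C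
      with (- / (la * INR N) * (0 - 0) + INR p / (la * INR N) * (INR (fact j) / (INR N * la ^ S j)))%C.
    + eapply IInf_ext; [|exact Z]. intros r _; cbv beta. field. split; assumption.
    + rewrite fact_simpl, mult_INR, RtoC_mult, (Cpow_S la (S j)). unfold p.
      replace (N * j + N)%nat with (N * S j)%nat by lia. rewrite mult_INR, RtoC_mult.
      assert (la ^ S j <> 0)%C by now apply Cpow_nz. field. repeat split; assumption.
Qed.

Lemma IInf_gamma n (q mu : C) : 0 < Re (mu * q)%C ->
  IInf (fun r : R => q * ((r * q) ^ n * Cexp (- (mu * (r * q)))))%C (INR (fact n) / mu ^ (S n))%C.
Proof.
  intros Hs.
  assert (Hs0 : (mu * q)%C <> 0%C) by (intros E; rewrite E in Hs; simpl in Hs; lra).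
  assert (Hm : mu <> 0%C) by (intros ->; apply Hs0; ring).
  assert (Hq : q <> 0%C) by (intros ->; apply Hs0; ring).
  pose proof (IInf_sexp 1 n (mu * q) (Nat.le_refl 1) Hs) as X.
  apply (IInf_scal _ _ (q ^ S n)%C) in X.
  replace (INR (fact n) / mu ^ S n)%C with (q ^ S n * (INR (fact n) / (INR 1 * (mu * q) ^ S n)))%C.
  - eapply IInf_ext; [|exact X]. intros r _; cbv beta. unfold sexp.
    replace (1 * n + pred 1)%nat with n by (simpl; lia).
    rewrite Cpow_1_r, Cpow_mult_l, Cpow_S.
    replace (mu * q * r)%C with (mu * (r * q))%C by ring. ring.
  - rewrite Cpow_mult_l. simpl INR.
    assert (mu ^ S n <> 0)%C by now apply Cpow_nz. assert (q ^ S n <> 0)%C by now apply Cpow_nz.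
    field. split; assumption.
Qed.

Lemma cseries_geometric (w : C) : 0 < Re w ->
  cseries (fun k => Cexp (- (INR (S k) * w))) (/ (Cexp w - 1))%C.
Proof.
  intros Hw.
  assert (He : (1 - Cexp (- w))%C <> 0%C) by now apply Cexp_neg_neq_1.
  assert (E1 : (Cexp w - 1)%C <> 0%C).
  { intros E. assert (K : Cexp w = 1%C) by (replace (Cexp w) with (Cexp w - 1 + 1)%C by ring; rewrite E; ring).
    apply He. pose proof (Cexp_opp_l w) as X. rewrite K, Cmult_1_r in X. rewrite X; ring. }
  assert (Hm : 0 < Cmod (Cexp w - 1)) by now apply Cmod_gt_0.
  assert (Hn : forall n, (/ (Cexp w - 1) - csum (fun k => Cexp (- (INR (S k) * w))) n)%C = (Cexp (- (INR (S n) * w)) / (Cexp w - 1))%C).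
  { assert (Sh : forall n, (Cexp (- (INR (S n) * w)) * (Cexp w - 1))%C = (Cexp (- (INR n * w)) - Cexp (- (INR (S n) * w)))%C).
    { intros n. replace (Cexp (- (INR n * w))) with (Cexp (- (INR (S n) * w)) * Cexp w)%C; [ring|].
      rewrite <- Cexp_plus. f_equal. rewrite S_INR, RtoC_plus; ring. }
    induction n.
    - rewrite csum_O. pose proof (Sh 0%nat) as X. simpl INR in X. rewrite Cmult_0_l in X. replace (- RtoC 0)%C with (RtoC 0) in X by ring. rewrite Cexp_0 in X.
      simpl INR. transitivity ((1 - Cexp (- (1 * w)) * (Cexp w - 1)) / (Cexp w - 1))%C; [field; assumption|].
      rewrite X. f_equal; ring.
    - rewrite csum_S.
      replace (/ (Cexp w - 1) - (csum (fun k => Cexp (- (INR (S k) * w))) n + Cexp (- (INR (S (S n)) * w))))%C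
        with ((/ (Cexp w - 1) - csum (fun k => Cexp (- (INR (S k) * w))) n) - Cexp (- (INR (S (S n)) * w)))%C by ring.
      rewrite IHn. pose proof (Sh (S n)) as X.
      transitivity ((Cexp (- (INR (S n) * w)) - Cexp (- (INR (S (S n)) * w)) * (Cexp w - 1)) / (Cexp w - 1))%C; [field; assumption|].
      rewrite X. f_equal; ring. }
  apply cseries_Cmod with (e := fun n => / (INR (S n)) * (/ Re w * / Cmod (Cexp w - 1))).
  - intros n. rewrite Hn, Cmod_div, Cmod_Cexp by assumption. unfold Rdiv. rewrite <- Rmult_assoc.
    apply Rmult_le_compat_r; [left; now apply Rinv_0_lt_compat|].
    rewrite re_opp, re_scal_l.
    assert (0 < INR (S n)) by (apply lt_0_INR; lia).
    pose proof (exp_neg_le_inv_pow 1 (INR (S n) * Re w) ltac:(nra)) as B. rewrite pow_1 in B.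
    eapply Rle_trans; [exact B|]. change (INR (fact 1)) with 1. right; field. lra.
  - replace (Finite 0) with (Finite (0 * (/ Re w * / Cmod (Cexp w - 1)))) by (f_equal; ring).
    apply (is_lim_seq_scal_r _ _ (Finite 0)), (is_lim_seq_incr_1 (fun n => / INR n)).
    apply is_lim_seq_inv_INR.
Qed.

(** From the second term on, (n+1)^(-3/2) is at most twice the telescoping difference of n^(-1/2)
    and (n+1)^(-1/2). *)
Lemma ex_series_inv_3_2 : ex_series (fun n => / (INR (S n) * sqrt (INR (S n)))).
Proof.
  assert (T : is_series (fun n => / sqrt (INR (S n)) - / sqrt (INR (S (S n)))) 1).
  { change (is_lim_seq (sum_n (fun n => / sqrt (INR (S n)) - / sqrt (INR (S (S n))))) 1).
    apply (is_lim_seq_ext (fun n => 1 - / sqrt (INR (S (S n))))).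
    - induction n as [|n IH]; [rewrite sum_O; simpl INR; rewrite sqrt_1; field|].
      + pose proof (sqrt_lt_R0 (1 + 1) ltac:(lra)); lra.
      + rewrite sum_Sn, <- IH. change plus with Rplus. ring.
    - replace (Finite 1) with (Finite (1 - 0)) by (f_equal; ring).
      apply is_lim_seq_minus'; [apply is_lim_seq_const|].
      apply (is_lim_seq_incr_1 (fun n => / sqrt (INR (S n)))), (is_lim_seq_incr_1 (fun n => / sqrt (INR n))).
      replace (Finite 0) with (Rbar_inv p_infty) by reflexivity.
      apply is_lim_seq_inv; [|discriminate].
      apply (is_lim_comp_seq sqrt INR p_infty p_infty (is_lim_sqrt_p (fun x => x) p_infty (is_lim_id p_infty))); [exists 0%nat; intros; discriminate|apply is_lim_seq_INR]. }
  apply ex_series_incr_1.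
  apply (ex_series_le (K := R_AbsRing) (V := R_CompleteNormedModule) _ (fun n => 2 * (/ sqrt (INR (S n)) - / sqrt (INR (S (S n)))))).
  - intros n. change norm with Rabs. pose proof (pos_INR n). rewrite (S_INR (S n)).
    assert (Hx : 1 <= INR (S n)) by (apply (le_INR 1); lia). set (x := INR (S n)) in *.
    set (s := sqrt x). set (t := sqrt (x + 1)).
    assert (Hs : 0 < s) by (apply sqrt_lt_R0; lra). assert (Ht : 0 < t) by (apply sqrt_lt_R0; lra).
    assert (Es : s * s = x) by (apply sqrt_sqrt; lra). assert (Et : t * t = x + 1) by (apply sqrt_sqrt; lra).
    assert (Hst : s <= t) by (apply sqrt_le_1; lra).
    rewrite Rabs_pos_eq by (left; apply Rinv_0_lt_compat; nra).
    replace (2 * (/ s - / t)) with (/ (s * t * ((s + t) / 2))).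
    2:{ replace (/ (s * t * ((s + t) / 2))) with (2 * (t * t - s * s) / (s * t * (s + t))).
        - field. repeat split; lra.
        - rewrite Es, Et. field. repeat split; lra. }
    rewrite <- Et. apply Rinv_le_contravar; [repeat apply Rmult_lt_0_compat; lra|].
    apply Rmult_le_compat; nra.
  - exists (2 * 1). exact (is_series_scal 2 _ _ T).
Qed.

(** For [w] in a cone around the positive axis, w^2 avoids a sector around the negative axis, so its
    distance to -D^2 is at least a fixed fraction of D^2. This uniformity in [w] gives the
    Mittag-Leffler terms their inverse-square decay. *)
Lemma sq_plus_sq_lower (w : C) (D C0 : R) : 0 <= C0 -> 0 <= Re w -> Rabs (Im w) <= C0 * Re w ->
  D * D / (1 + C0 * C0) <= Cmod (w * w + RtoC D * RtoC D).
Proof.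
  intros HC Hw Hi.
  assert (Hd : 0 < 1 + C0 * C0) by nra.
  assert (HD : 0 <= D * D / (1 + C0 * C0)) by (apply Rmult_le_pos; [nra|left; now apply Rinv_0_lt_compat]).
  apply Rsqr_incr_0_var; [|apply Cmod_ge_0]. unfold Rsqr. rewrite Cmod_sqr.
  destruct w as [p q]; unfold Re, Im in *; simpl in *.
  set (A := p * p - q * q). set (E := D * D). 
  replace ((A + (E - 0 * 0)) * (A + (E - 0 * 0)) + (p * q + q * p + (D * 0 + 0 * D)) * (p * q + q * p + (D * 0 + 0 * D)))
    with ((A + E) * (A + E) + 4 * (p * q) * (p * q)) by (unfold A, E; ring).
  assert (HE : 0 <= E) by (unfold E; nra).
  assert (Hinv : 0 < / (1 + C0 * C0) <= 1).
  { split; [now apply Rinv_0_lt_compat|]. rewrite <- Rinv_1. apply Rinv_le_contravar; nra. }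
  unfold Rdiv. set (i := / (1 + C0 * C0)) in *.
  destruct (Rle_dec 0 A) as [HA|HA].
  - assert (E * i <= E) by nra. assert (E * i * (E * i) <= E * E) by (apply Rmult_le_compat; nra). nra.
  - (* here [|A| <= q^2 <= C0 p |q|], so the square of the imaginary part controls [A^2] *)
    assert (Hq2 : q * q <= C0 * (Rabs (p * q))).
    { rewrite Rabs_mult, (Rabs_pos_eq p) by assumption. pose proof (Rabs_pos q). replace (q * q) with (Rabs q * Rabs q) by (rewrite <- Rabs_mult; apply Rabs_pos_eq; nra). nra. }
    assert (HA2 : - A <= C0 * Rabs (p * q)) by (unfold A; nra).
    set (B := Rabs (p * q)) in *. assert (HB : 0 <= B) by apply Rabs_pos.
    replace (4 * (p * q) * (p * q)) with (4 * (B * B)).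
    2:{ unfold B. rewrite <- Rabs_mult, (Rabs_pos_eq (p * q * (p * q))) by nra. ring. }
    assert (G : E * E <= ((A + E) * (A + E) + 4 * (B * B)) * (1 + C0 * C0)).
    { assert (A * A <= C0 * C0 * (B * B)) by nra.
      destruct (Req_EM_T C0 0) as [HC0|HC0]; [subst C0; assert (A = 0) by nra; nra|].
      (* minimise over A: (A+E)^2 (1+C^2) + A^2 (1 + 1/C^2) >= E^2 *)
      assert (Hc2 : 0 < C0 * C0) by nra.
      assert (K : 0 <= ((1 + C0 * C0) * A + C0 * C0 * E) * ((1 + C0 * C0) * A + C0 * C0 * E)) by (apply Rle_0_sqr).
      assert (M : E * E * (C0 * C0) <= (A + E) * (A + E) * (1 + C0 * C0) * (C0 * C0) + A * A * (1 + C0 * C0)) by nra.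
      assert (A * A * (1 + C0 * C0) <= C0 * C0 * (B * B) * (1 + C0 * C0)) by (apply Rmult_le_compat_r; lra).
      apply (Rmult_le_reg_r (C0 * C0)); [assumption|]. nra. }
    assert (Hi1 : (1 + C0 * C0) * i = 1) by (unfold i; field; lra).
    assert (E * E * i <= (A + E) * (A + E) + 4 * (B * B)).
    { apply (Rmult_le_compat_r i) in G; [|lra]. rewrite (Rmult_assoc (_ + _)), Hi1, Rmult_1_r in G. exact G. }
    assert (E * i * (E * i) <= E * E * i * 1) by (replace (E * i * (E * i)) with (E * E * i * i) by ring; apply Rmult_le_compat_l; nra). lra.
Qed.

(** * Summation over the divisor pairs *)

(* Two evaluations of the double sum over [(k, d)] of the integrals of
   [x ^ expo * exp (- k y x ^ N -+ 2 pi i d x)], with [expo = 2 N m + N - 1]: rotated back to the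
   positive axis it is Poisson summation in [d]; summed over [k] first, it is a Mittag-Leffler
   expansion whose polar terms are the [Wray]. *)
Section Rays.

Variables (N m : nat) (y : C) (tau ka : R).

(** The imaginary part has the sign opposite to that of [mu sg d], so that exp (-mu x), merely
    oscillating on the real axis, is damped at the rate freq d * tau along the ray. *)
Definition ray (sg : R) : C := (1, - (sg * tau)).
Definition ray_seg (sg s : R) : C := (1 + RtoC s * (ray sg - 1))%C.
Definition mu (sg : R) (d : nat) : C := (Ci * sg * freq d)%C.
Definition expo : nat := (2 * N * m + pred N)%nat.

Hypothesis HN : (1 <= N)%nat.
Hypothesis Hm : (1 <= m)%nat.
Hypothesis Htau : 0 < tau.
Hypothesis Hka : 0 < ka.
(** Imposed on the segments from 1 to the two rays; homogeneity extends it to the sectors swept by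
    the rotation. There w = y x^N has positive real part for x nonzero, so exp w - 1 has no zero and
    the kernels decay. *)
Hypothesis Hsec : forall sg s, sg * sg = 1 -> 0 <= s <= 1 -> ka <= Re (y * ray_seg sg s ^ N)%C.

Lemma ray_seg_0 sg : ray_seg sg 0 = 1%C.
Proof. unfold ray_seg. ring. Qed.

Lemma ray_seg_1 sg : ray_seg sg 1 = ray sg.
Proof. unfold ray_seg. ring. Qed.

Lemma Re_mu_ray_seg sg s r d : sg * sg = 1 ->
  Re (mu sg d * (RtoC r * ray_seg sg s))%C = freq d * tau * s * r.
Proof.
  intros H. transitivity (sg * sg * (freq d * tau * s * r)); [|rewrite H; ring].
  unfold mu, ray_seg, ray, Re; simpl. ring.
Qed.

Lemma Re_mu_ray sg r d : sg * sg = 1 -> Re (mu sg d * (RtoC r * ray sg))%C = freq d * tau * r.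
Proof. intros H. rewrite <- ray_seg_1, Re_mu_ray_seg by assumption. ring. Qed.

Lemma Hka_y : ka <= Re y.
Proof.
  pose proof (Hsec 1 0 ltac:(ring) ltac:(lra)) as H. rewrite ray_seg_0, Cpow_1_l, Cmult_1_r in H. exact H.
Qed.

Lemma y_nz : y <> 0%C.
Proof. intros E. pose proof Hka_y as H. rewrite E in H. simpl in H. lra. Qed.

Lemma Cmod_ray_seg sg s : sg * sg = 1 -> 0 <= s <= 1 -> Cmod (ray_seg sg s) <= 1 + tau.
Proof.
  intros Hsg Hs. eapply Rle_trans; [apply Cmod_triangle|]. rewrite Cmod_1. apply Rplus_le_compat_l.
  rewrite Cmod_mult, Cmod_R, Rabs_pos_eq by lra.
  assert (E : Cmod (ray sg - 1) = tau).
  { apply Rsqr_inj; [apply Cmod_ge_0|lra|]. unfold Rsqr. rewrite Cmod_sqr. unfold ray, Re, Im; simpl.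
    replace ((1 + - (1)) * (1 + - (1)) + (- (sg * tau) + - 0) * (- (sg * tau) + - 0)) with (sg * sg * (tau * tau)) by ring.
    rewrite Hsg; ring. }
  rewrite E. nra.
Qed.

Lemma Cmod_ray sg : sg * sg = 1 -> Cmod (ray sg) <= 1 + tau.
Proof. intros H. rewrite <- ray_seg_1. apply Cmod_ray_seg; [exact H|lra]. Qed.

Lemma Cmod_pow_ray_seg n sg s r : sg * sg = 1 -> 0 <= s <= 1 -> 0 <= r ->
  Cmod ((RtoC r * ray_seg sg s) ^ n) <= (1 + tau) ^ n * r ^ n.
Proof.
  intros Hsg Hs Hr. rewrite Cmod_pow, Cmod_mult, Cmod_R, Rabs_pos_eq, Rpow_mult_distr, Rmult_comm by assumption.
  apply Rmult_le_compat_r; [now apply pow_le|]. apply pow_incr. split; [apply Cmod_ge_0|now apply Cmod_ray_seg].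
Qed.

Lemma Cmod_pow_ray n sg r : sg * sg = 1 -> 0 <= r -> Cmod ((RtoC r * ray sg) ^ n) <= (1 + tau) ^ n * r ^ n.
Proof. intros. rewrite <- ray_seg_1. apply Cmod_pow_ray_seg; try assumption; lra. Qed.

Lemma Re_wave sg s r : sg * sg = 1 -> 0 <= s <= 1 -> 0 <= r ->
  ka * r ^ N <= Re (y * (RtoC r * ray_seg sg s) ^ N)%C.
Proof.
  intros Hsg Hs Hr. rewrite Cpow_mult_l, <- RtoC_pow.
  replace (y * (RtoC (r ^ N) * ray_seg sg s ^ N))%C with (RtoC (r ^ N) * (y * ray_seg sg s ^ N))%C by ring.
  rewrite re_scal_l, Rmult_comm. apply Rmult_le_compat_l; [now apply pow_le|now apply Hsec].
Qed.

Lemma Re_wave_ray sg r : sg * sg = 1 -> 0 <= r -> ka * r ^ N <= Re (y * (RtoC r * ray sg) ^ N)%C.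
Proof. intros. rewrite <- ray_seg_1. apply Re_wave; try assumption; lra. Qed.

Lemma gker_le n k sg d s r : sg * sg = 1 -> 0 <= s <= 1 -> 0 <= r ->
  Cmod (gker N n (INR (S k) * y) (mu sg d) (RtoC r * ray_seg sg s)%C)
   <= (1 + tau) ^ n * r ^ n * exp (- (INR (S k) * (ka * r ^ N))) * exp (- (freq d * tau * s * r)).
Proof.
  intros Hsg Hs Hr. unfold gker. rewrite Cmod_mult, Cmod_Cexp, Rmult_assoc, <- exp_plus.
  apply Rmult_le_compat; [apply Cmod_ge_0|left; apply exp_pos|now apply Cmod_pow_ray_seg|].
  apply exp_le. rewrite re_opp, re_plus, Re_mu_ray_seg by assumption.
  rewrite <- Cmult_assoc, re_scal_l. pose proof (Re_wave sg s r Hsg Hs Hr) as B.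
  pose proof (pos_INR (S k)). nra.
Qed.

(** Near the real axis, s = 0, the wave is not damped, so only the decay in y x^N is used, through
    r^N >= r - 1. The constant may depend on [k], as the bound only serves convergence and rotation
    at fixed [k]. *)
Lemma gker_le_edom n k sg d s r : sg * sg = 1 -> 0 <= s <= 1 -> 0 <= r ->
  Cmod (gker N n (INR (S k) * y) (mu sg d) (RtoC r * ray_seg sg s)%C)
   <= (1 + tau) ^ n * exp (INR (S k) * ka) * edom n (INR (S k) * ka) r.
Proof.
  intros Hsg Hs Hr. eapply Rle_trans; [now apply gker_le|].
  unfold edom.
  replace ((1 + tau) ^ n * exp (INR (S k) * ka) * (r ^ n * exp (- (INR (S k) * ka) * r)))
    with ((1 + tau) ^ n * r ^ n * (exp (INR (S k) * ka) * exp (- (INR (S k) * ka) * r)) * 1) by ring.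
  pose proof (pow_le r n Hr). pose proof (pow_le (1 + tau) n ltac:(lra)).
  assert (0 < INR (S k)) by (apply lt_0_INR; lia).
  apply Rmult_le_compat; [apply Rmult_le_pos; [nra|left; apply exp_pos]|left; apply exp_pos| |].
  - apply Rmult_le_compat_l; [nra|]. rewrite <- exp_plus. apply exp_le.
    pose proof (pow_ge_sub_1 r N HN Hr). assert (0 < INR (S k) * ka) by nra. nra.
  - rewrite <- exp_0. apply exp_le. pose proof (freq_pos d).
    assert (0 <= freq d * tau * s * r) by (apply Rmult_le_pos; [apply Rmult_le_pos; [apply Rmult_le_pos|]|]; lra). lra.
Qed.

Lemma ccont_ray_arg sg r : ccont (fun r : R => RtoC r * ray sg)%C r.
Proof. apply ccont_mult; [apply ccont_id|apply ccont_const]. Qed.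

Definition kernel_ray (k d : nat) (sg r : R) : C := (ray sg * gker N expo (INR (S k) * y) (mu sg d) (RtoC r * ray sg))%C.

Definition Iray (k d : nat) (sg : R) : C := IV (kernel_ray k d sg).

Lemma ccont_gker_ray n la u sg r : ccont (fun r : R => gker N n la u (RtoC r * ray sg)%C) r.
Proof.
  unfold gker. pose proof (ccont_ray_arg sg r) as H.
  apply ccont_mult; [now apply ccont_pow|].
  apply ccont_Cexp, ccont_opp, ccont_plus; apply ccont_mult; try apply ccont_const; [now apply ccont_pow|exact H].
Qed.

Lemma Skka_pos k : 0 < INR (S k) * ka.
Proof. apply Rmult_lt_0_compat; [apply lt_0_INR; lia|assumption]. Qed.

Lemma IInf_Iray k d sg : sg * sg = 1 -> IInf (kernel_ray k d sg) (Iray k d sg).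
Proof.
  intros Hsg. apply IV_correct.
  apply (IInf_ex_edom _ expo (INR (S k) * ka) ((1 + tau) * ((1 + tau) ^ expo * exp (INR (S k) * ka)))).
  - apply Skka_pos.
  - pose proof (pow_le (1 + tau) expo ltac:(lra)). pose proof (exp_pos (INR (S k) * ka)).
    apply Rmult_le_pos; [lra|nra].
  - intros r _. apply ccont_mult; [apply ccont_const|apply ccont_gker_ray].
  - intros r Hr. unfold kernel_ray. rewrite Cmod_mult, Rmult_assoc.
    apply Rmult_le_compat; [apply Cmod_ge_0|apply Cmod_ge_0|now apply Cmod_ray|].
    rewrite <- ray_seg_1. apply gker_le_edom; try assumption; lra.
Qed.

Lemma IInf_Iray_real k d sg : sg * sg = 1 ->
  IInf (fun r => gker N expo (INR (S k) * y) (mu sg d) (RtoC r)) (Iray k d sg).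
Proof.
  intros Hsg. destruct (gker_chol N expo (INR (S k) * y) (mu sg d)) as [g' [g'' [G1 [G2 [G3 G4]]]]].
  assert (X : IInf (fun r : R => 1 * gker N expo (INR (S k) * y) (mu sg d) (RtoC r * 1))%C (Iray k d sg)).
  { refine (IInf_rotate _ g' g'' 1 (ray sg) _ expo (INR (S k) * ka) ((1 + tau) ^ expo * exp (INR (S k) * ka)) G1 G2 G3 G4 (Skka_pos k) _ _).
    - intros r s Hr Hs. exact (gker_le_edom expo k sg d s r Hsg Hs Hr).
    - now apply IInf_Iray. }
  eapply IInf_ext; [|exact X]. intros r _; cbv beta. now rewrite Cmult_1_l, Cmult_1_r.
Qed.

(** Each factor r^N taken out of r^expo buys a factor 1 / (k+1) from the exponential in y x^N; the
    remaining r^p, integrated against the damped wave, will give (d+1)^-(p+1). *)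
Lemma kernel_ray_le j p k d sg r : sg * sg = 1 -> expo = (p + N * j)%nat -> 0 < r ->
  Cmod (kernel_ray k d sg r)
    <= (1 + tau) ^ (S expo) * (INR (fact j) / ka ^ j) * / INR (S k) ^ j * edom p (freq d * tau) r.
Proof.
  intros Hsg Hp Hr. unfold kernel_ray. rewrite Cmod_mult.
  pose proof (gker_le expo k sg d 1 r Hsg ltac:(lra) ltac:(lra)) as B. rewrite ray_seg_1, Rmult_1_r in B.
  assert (Hk : 0 < INR (S k)) by (apply lt_0_INR; lia).
  assert (HrN : 0 < r ^ N) by now apply pow_lt.
  assert (Hx : 0 < INR (S k) * (ka * r ^ N)) by (repeat apply Rmult_lt_0_compat; assumption).
  pose proof (exp_neg_le_inv_pow j _ Hx) as B2.
  pose proof (Cmod_ray sg Hsg) as Bq.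
  pose proof (pow_lt (1 + tau) expo ltac:(lra)) as PQ. pose proof (pow_lt r expo Hr) as Pr.
  eapply Rle_trans; [apply Rmult_le_compat; [apply Cmod_ge_0|apply Cmod_ge_0|exact Bq|exact B]|].
  unfold edom. replace (- (freq d * tau) * r) with (- (freq d * tau * r)) by ring.
  rewrite <- !Rmult_assoc. apply Rmult_le_compat_r; [left; apply exp_pos|].
  rewrite <- tech_pow_Rmult, !Rmult_assoc.
  apply Rmult_le_compat_l; [lra|]. apply Rmult_le_compat_l; [lra|].
  eapply Rle_trans; [apply Rmult_le_compat_l; [lra|exact B2]|].
  right. rewrite Hp, pow_add, !Rpow_mult_distr, pow_mult. 
  assert (ka ^ j <> 0) by (apply pow_nonzero; lra). assert (INR (S k) ^ j <> 0) by (apply pow_nonzero; lra).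
  assert ((r ^ N) ^ j <> 0) by (apply pow_nonzero; lra).
  field. repeat split; assumption.
Qed.

Lemma inv_freq_tau_le p e d : (e <= S p)%nat -> / (freq d * tau) ^ S p <= / tau ^ S p * / INR (S d) ^ e.
Proof.
  intros He. rewrite Rpow_mult_distr, Rinv_mult, Rmult_comm.
  apply Rmult_le_compat_l; [left; apply Rinv_0_lt_compat, pow_lt; lra|].
  assert (1 <= INR (S d)) by (apply (le_INR 1); lia). pose proof (freq_ge d).
  apply Rinv_le_contravar; [apply pow_lt; lra|].
  eapply Rle_trans; [apply (Rle_pow (INR (S d)) e (S p)); assumption|]. apply pow_incr; lra.
Qed.

Lemma Iray_le j p e : expo = (p + N * j)%nat -> (e <= S p)%nat ->
  exists C0, 0 <= C0 /\ forall k d sg, sg * sg = 1 -> Cmod (Iray k d sg) <= C0 * / INR (S k) ^ j * / INR (S d) ^ e.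
Proof.
  intros Hp He.
  set (A := (1 + tau) ^ (S expo) * (INR (fact j) / ka ^ j)).
  assert (HA : 0 <= A).
  { unfold A. apply Rmult_le_pos; [apply pow_le; lra|].
    apply Rmult_le_pos; [apply pos_INR|left; apply Rinv_0_lt_compat, pow_lt; lra]. }
  exists (A * INR (fact p) * / tau ^ S p). pose proof (pos_INR (fact p)).
  assert (0 < / tau ^ S p) by (apply Rinv_0_lt_compat, pow_lt; lra).
  split; [apply Rmult_le_pos; [nra|lra]|].
  intros k d sg Hsg.
  assert (Hk : 0 < / INR (S k) ^ j) by (apply Rinv_0_lt_compat, pow_lt, lt_0_INR; lia).
  pose proof (freq_pos d).
  pose proof (IInf_Cmod_le_edom (kernel_ray k d sg) (Iray k d sg) p (freq d * tau) (A * / INR (S k) ^ j)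
    ltac:(nra) ltac:(nra) (fun r Hr => kernel_ray_le j p k d sg r Hsg Hp Hr) (IInf_Iray k d sg Hsg)) as B.
  eapply Rle_trans; [exact B|]. unfold Rdiv.
  pose proof (inv_freq_tau_le p e d He) as B2.
  replace (A * INR (fact p) * / tau ^ S p * / INR (S k) ^ j * / INR (S d) ^ e)
    with (A * / INR (S k) ^ j * INR (fact p) * (/ tau ^ S p * / INR (S d) ^ e)) by ring.
  rewrite <- Rmult_assoc. apply Rmult_le_compat_l; [|exact B2].
  apply Rmult_le_pos; [nra|assumption].
Qed.

Definition Isum (k d : nat) : C := (Iray k d 1 + Iray k d (-1))%C.

(** With [k], [d] counted from 1: taking out one factor r^N gives k^-1 d^-2, taking out two gives
    k^-2 d^-1. When N = m = 1 no single choice is summable in both indices, but the geometric mean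
    of the two bounds is (k d)^(-3/2). *)
Lemma Isum_dominated : exists C0, 0 <= C0 /\ forall k d,
  Cmod (Isum k d) <= C0 * / (INR (S k) * sqrt (INR (S k))) * / (INR (S d) * sqrt (INR (S d))).
Proof.
  assert (E1 : expo = ((2 * N * m - 1) + N * 1)%nat) by (unfold expo; nia).
  assert (E2 : expo = ((2 * N * m - N - 1) + N * 2)%nat) by (unfold expo; nia).
  destruct (Iray_le 1 _ 2 E1) as [C1 [HC1 B1]]; [nia|].
  destruct (Iray_le 2 _ 1 E2) as [C2 [HC2 B2]]; [nia|].
  exists (2 * (sqrt C1 * sqrt C2)). split; [pose proof (sqrt_pos C1); pose proof (sqrt_pos C2); nra|].
  assert (S1 : 1 * 1 = 1) by ring. assert (S2 : -1 * -1 = 1) by ring.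
  assert (G : forall k d sg, sg * sg = 1 ->
    Cmod (Iray k d sg) <= sqrt C1 * sqrt C2 * / (INR (S k) * sqrt (INR (S k))) * / (INR (S d) * sqrt (INR (S d)))).
  { intros k d sg Hsg.
    assert (Hk : 0 < INR (S k)) by (apply lt_0_INR; lia). assert (Hd : 0 < INR (S d)) by (apply lt_0_INR; lia).
    specialize (B1 k d sg Hsg). specialize (B2 k d sg Hsg). rewrite pow_1 in B1, B2.
    set (x := INR (S k)) in *. set (z := INR (S d)) in *.
    pose proof (sqrt_lt_R0 x Hk) as Sx. pose proof (sqrt_lt_R0 z Hd) as Sz.
    pose proof (sqrt_sqrt x ltac:(lra)) as Qx. pose proof (sqrt_sqrt z ltac:(lra)) as Qz.
    pose proof (sqrt_sqrt C1 HC1) as Q1. pose proof (sqrt_sqrt C2 HC2) as Q2.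
    pose proof (sqrt_pos C1). pose proof (sqrt_pos C2).
    assert (0 < / (x * sqrt x)) by (apply Rinv_0_lt_compat; nra).
    assert (0 < / (z * sqrt z)) by (apply Rinv_0_lt_compat; nra).
    apply Rsqr_incr_0_var.
    - unfold Rsqr. eapply Rle_trans; [apply Rmult_le_compat; [apply Cmod_ge_0|apply Cmod_ge_0|exact B1|exact B2]|].
      right.
      replace (sqrt C1 * sqrt C2 * / (x * sqrt x) * / (z * sqrt z) * (sqrt C1 * sqrt C2 * / (x * sqrt x) * / (z * sqrt z)))
        with ((sqrt C1 * sqrt C1) * (sqrt C2 * sqrt C2) * / (x * x * (sqrt x * sqrt x)) * / (z * z * (sqrt z * sqrt z))) by (field; lra).
      rewrite Q1, Q2, Qx, Qz. field. lra.
    - repeat apply Rmult_le_pos; lra. }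
  intros k d. unfold Isum. eapply Rle_trans; [apply Cmod_triangle|].
  pose proof (G k d 1 S1). pose proof (G k d (-1) S2). lra.
Qed.

(** The Lambert term of the pair d1 = n + 1, d2 = k + 1: the weight d1^a with a = [expo], times exp
    (-d1^N d2 y). *)
Definition lam (n k : nat) : C := sexp N expo (INR (S k) * y) (INR (S n)).

Lemma lam_le : exists C0, 0 <= C0 /\ forall n k, Cmod (lam n k) <= C0 * / INR (S n) ^ 2 * / INR (S k) ^ 2.
Proof.
  (* This exponent absorbs the weight and still leaves an inverse square in each index. *)
  set (p := (expo + 2)%nat). exists (INR (fact p) / ka ^ p).
  assert (Hkp : 0 < / ka ^ p) by (apply Rinv_0_lt_compat, pow_lt; lra).
  split; [apply Rmult_le_pos; [apply pos_INR|lra]|].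
  intros n k. unfold lam, sexp. rewrite Cmod_mult, Cmod_pow, Cmod_R, Cmod_Cexp, Rabs_pos_eq by apply pos_INR.
  assert (Hx : 1 <= INR (S n)) by (apply (le_INR 1); lia). assert (Hz : 1 <= INR (S k)) by (apply (le_INR 1); lia).
  set (x := INR (S n)) in *. set (z := INR (S k)) in *.
  rewrite re_opp, <- Cmult_assoc, re_scal_l, <- RtoC_pow, re_scal_r.
  assert (HxN : x <= x ^ N) by (pose proof (Rle_pow x 1 N Hx HN) as P; rewrite pow_1 in P; exact P).
  assert (HX : 0 < z * (ka * x)) by (repeat apply Rmult_lt_0_compat; lra).
  assert (E1 : exp (- (z * (Re y * x ^ N))) <= exp (- (z * (ka * x)))).
  { apply exp_le. apply Ropp_le_contravar, Rmult_le_compat_l; [lra|]. pose proof Hka_y. apply Rmult_le_compat; lra. }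
  pose proof (exp_neg_le_inv_pow p _ HX) as E2.
  pose proof (pow_lt x expo ltac:(lra)) as Pe.
  eapply Rle_trans; [apply Rmult_le_compat_l; [lra|eapply Rle_trans; [exact E1|exact E2]]|].
  unfold p. rewrite !Rpow_mult_distr, (pow_add x), (pow_add z). fold p.
  assert (Hze : 1 <= z ^ expo) by (apply pow_R1_Rle; lra).
  assert (ka ^ p <> 0) by (apply pow_nonzero; lra).
  assert (P2 : 0 < x ^ 2) by (apply pow_lt; lra). assert (P3 : 0 < z ^ 2) by (apply pow_lt; lra).
  replace (x ^ expo * (INR (fact p) / (z ^ expo * z ^ 2 * (ka ^ p * (x ^ expo * x ^ 2)))))
    with (INR (fact p) / ka ^ p * / x ^ 2 * / z ^ 2 * / z ^ expo).
  2:{ field. repeat split; try assumption; lra. }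
  rewrite <- (Rmult_1_r (_ * / z ^ 2)) at 2. apply Rmult_le_compat_l.
  - repeat apply Rmult_le_pos; try apply pos_INR; try lra; left; now apply Rinv_0_lt_compat.
  - rewrite <- Rinv_1. apply Rinv_le_contravar; lra.
Qed.

Lemma ex_series_inv_sq_scal C0 : ex_series (fun n => C0 * / INR (S n) ^ 2).
Proof. exact (ex_series_scal_l C0 _ ex_series_inv_sq). Qed.

Lemma inv_sq_pos n : 0 < / INR (S n) ^ 2.
Proof. apply Rinv_0_lt_compat, pow_lt, lt_0_INR; lia. Qed.

Lemma lam_square : exists A, cconv (fun K => csum (fun i => csum (lam i) K) K) A.
Proof.
  destruct lam_le as [C0 [HC0 B]].
  apply (square_conv lam (fun n => C0 * / INR (S n) ^ 2) (fun k => / INR (S k) ^ 2) B).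
  - intros i; pose proof (inv_sq_pos i); nra.
  - intros j; left; apply inv_sq_pos.
  - apply ex_series_inv_sq_scal.
  - apply ex_series_inv_sq.
Qed.

Lemma lam_columns A : cconv (fun K => csum (fun i => csum (lam i) K) K) A ->
  exists Lk, (forall k, cseries (fun n => lam n k) (Lk k)) /\ cseries Lk A.
Proof.
  intros HA. destruct lam_le as [C0 [HC0 B]].
  set (b := fun k n => lam n k).
  assert (Bb : forall k n, Cmod (b k n) <= / INR (S k) ^ 2 * (C0 * / INR (S n) ^ 2)).
  { intros k n. rewrite Rmult_comm. apply B. }
  assert (Hu : forall k, 0 <= / INR (S k) ^ 2) by (intros; left; apply inv_sq_pos).
  assert (Hv : forall n, 0 <= C0 * / INR (S n) ^ 2) by (intros n; pose proof (inv_sq_pos n); nra).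
  set (Lk := fun k => (Series (fun n => Re (lam n k)), Series (fun n => Im (lam n k)))).
  assert (HL : forall k, cseries (b k) (Lk k)).
  { intros k. destruct (cseries_row_ex b _ _ Bb (ex_series_inv_sq_scal C0) k) as [l [H1 H2]].
    replace (Lk k) with l; [split; assumption|].
    apply C_ext; simpl; symmetry; now apply is_series_unique. }
  exists Lk. split; [exact HL|].
  apply (cseries_rows b _ _ Bb Hu Hv ex_series_inv_sq (ex_series_inv_sq_scal C0) Lk A HL).
  eapply is_lim_seq_ext; [|exact HA]. intros n; cbv beta. unfold b. now rewrite csum_switch.
Qed.

Lemma Re_Sky k : 0 < Re (INR (S k) * y)%C.
Proof. rewrite re_scal_l. pose proof Hka_y. apply Rmult_lt_0_compat; [apply lt_0_INR; lia|lra]. Qed.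

Lemma IInf_cos_sexp k d :
  IInf (fun t => RtoC (cos (freq d * t)) * sexp N expo (INR (S k) * y) t)%C (Isum k d / 2)%C.
Proof.
  assert (S1 : 1 * 1 = 1) by ring. assert (S2 : -1 * -1 = 1) by ring.
  pose proof (IInf_scal _ _ (/ 2)%C (IInf_plus _ _ _ _ (IInf_Iray_real k d 1 S1) (IInf_Iray_real k d (-1) S2))) as X.
  replace (Isum k d / 2)%C with (/ 2 * (Iray k d 1 + Iray k d (-1)))%C by (unfold Isum; field).
  eapply IInf_ext; [|exact X]. intros t _; cbv beta. unfold gker, sexp.
  replace (- (INR (S k) * y * t ^ N + mu 1 d * t))%C with (- (INR (S k) * y * t ^ N) + - (mu 1 d * t))%C by ring.
  replace (- (INR (S k) * y * t ^ N + mu (-1) d * t))%C with (- (INR (S k) * y * t ^ N) + - (mu (-1) d * t))%C by ring.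
  rewrite !Cexp_plus.
  assert (E1 : (Cexp (- (mu 1 d * t)) + Cexp (- (mu (-1) d * t)))%C = (2 * RtoC (cos (freq d * t)))%C).
  { unfold Cexp, mu.
    replace (Re (- (Ci * 1 * freq d * t))) with 0 by (unfold Re; simpl; ring).
    replace (Re (- (Ci * (-1)%R * freq d * t))) with 0 by (unfold Re; simpl; ring).
    replace (Im (- (Ci * 1 * freq d * t))) with (- (freq d * t)) by (unfold Im; simpl; ring).
    replace (Im (- (Ci * (-1)%R * freq d * t))) with (freq d * t) by (unfold Im; simpl; ring).
    rewrite exp_0, cos_neg, sin_neg. apply C_ext; simpl; ring. }
  transitivity (/ 2 * (t ^ expo * Cexp (- (INR (S k) * y * t ^ N)) * (Cexp (- (mu 1 d * t)) + Cexp (- (mu (-1) d * t)))))%C; [ring|].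
  rewrite E1. field.
Qed.

(** The zero-frequency integral in Poisson summation at fixed [k]; the sum over [k] is the source of
    zeta (2m+1). *)
Definition Pk (k : nat) : C := (INR (fact (2 * m)) / (INR N * (INR (S k) * y) ^ S (2 * m)))%C.

(** Poisson summation in [n]: rotated back to the real axis the two waves add up to a cosine, and
    the function vanishes at 0 because [expo] is at least 1. *)
Lemma cseries_Isum_row k Lk : cseries (fun n => lam n k) Lk -> cseries (Isum k) (Lk - Pk k).
Proof.
  intros HL. set (la := (INR (S k) * y)%C).
  pose proof (Re_Sky k) as Hla. fold la in Hla.
  assert (Hexp : (1 <= expo)%nat) by (unfold expo; nia).
  set (f2 := fun t => (INR expo * (INR (pred expo) * sexp N (pred (pred expo)) la t + - la * INR N * sexp N (pred expo + pred N) la t)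
     + - la * INR N * (INR (expo + pred N) * sexp N (pred (expo + pred N)) la t + - la * INR N * sexp N (expo + pred N + pred N) la t))%C).
  assert (R2 : rapid f2).
  { unfold f2. apply rapid_plus; apply rapid_scal, rapid_plus; apply rapid_scal, sexp_rapid; assumption. }
  destruct R2 as [K [kk [Hkk [HK B2]]]].
  assert (HP : IInf (sexp N expo la) (Pk k)).
  { replace expo with (N * (2 * m) + pred N)%nat by (unfold expo; lia). apply (IInf_sexp N (2 * m) la HN Hla). }
  assert (X : cseries (fun d => 2 * (Isum k d / 2))%C (Lk - Pk k)%C).
  { apply (poisson (sexp N expo la) (fun t => INR expo * sexp N (pred expo) la t + - la * INR N * sexp N (expo + pred N) la t)%C f2
     (Pk k) (fun d => Isum k d / 2)%C (fun t => K * edom 0 kk t) (K * (INR (fact 0) / kk ^ 1)) Lk).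
    - intros t _. apply cder_sexp.
    - intros t _. apply cder_plus; apply cder_scal, cder_sexp.
    - intros t _. unfold f2. apply ccont_plus; apply ccont_mult; try apply ccont_const; apply ccont_plus; apply ccont_mult; try apply ccont_const; apply ccont_sexp.
    - now apply sexp_0.
    - exact HP.
    - intros d. apply IInf_cos_sexp.
    - intros t Ht. apply B2; lra.
    - apply (edom_RInt 0 kk K Hkk HK).
    - exact HL. }
  eapply cseries_ext; [|exact X]. intros d; cbv beta. field.
Qed.

Lemma cseries_Pk : cseries Pk (INR (fact (2 * m)) * zeta (2 * INR m + 1) / (INR N * y ^ (2 * m + 1)))%C.
Proof.
  assert (Z : is_series (fun n => / Rpower (INR (S n)) (2 * INR m + 1)) (zeta (2 * INR m + 1))).
  { apply Series_correct. apply (ex_series_le (K := R_AbsRing) (V := R_CompleteNormedModule) _ (fun n => / INR (S n) ^ 2)); [|apply ex_series_inv_sq].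
    intros n. change norm with Rabs.
    assert (1 <= INR (S n)) by (apply (le_INR 1); lia).
    rewrite Rabs_pos_eq by (left; apply Rinv_0_lt_compat, exp_pos).
    replace (2 * INR m + 1) with (INR (2 * m + 1)) by (rewrite plus_INR, mult_INR; simpl; ring).
    rewrite Rpower_pow by lra. apply Rinv_le_contravar; [apply pow_lt; lra|]. apply Rle_pow; [lra|lia]. }
  apply cseries_RtoC in Z.
  apply (cseries_scal _ _ (INR (fact (2 * m)) / (INR N * y ^ (2 * m + 1)))%C) in Z.
  assert (HN0 : RtoC (INR N) <> 0%C) by (apply RtoC_neq_0, not_0_INR; lia).
  assert (Hy0 : (y ^ (2 * m + 1) <> 0)%C) by (apply Cpow_nz, y_nz).
  replace (INR (fact (2 * m)) * zeta (2 * INR m + 1) / (INR N * y ^ (2 * m + 1)))%C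
    with (INR (fact (2 * m)) / (INR N * y ^ (2 * m + 1)) * zeta (2 * INR m + 1))%C by (field; split; assumption).
  eapply cseries_ext; [|exact Z]. intros k; cbv beta. unfold Pk.
  assert (0 < INR (S k)) by (apply lt_0_INR; lia).
  replace (2 * INR m + 1) with (INR (2 * m + 1)) by (rewrite plus_INR, mult_INR; simpl; ring).
  rewrite Rpower_pow by assumption. replace (S (2 * m)) with (2 * m + 1)%nat by lia.
  rewrite Cpow_mult_l, <- RtoC_pow, RtoC_inv by (apply pow_nonzero; lra).
  assert (RtoC (INR (S k) ^ (2 * m + 1)) <> 0%C) by (apply RtoC_neq_0, pow_nonzero; lra).
  field. repeat split; assumption.
Qed.

(** The rows, summed by Poisson, total the Lambert series minus the zeta term; the interchange with
    the columns rests on [Isum_dominated]. *)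
Lemma cseries_Isum_columns A col : cconv (fun K => csum (fun i => csum (lam i) K) K) A ->
  (forall d, cseries (fun k => Isum k d) (col d)) ->
  cseries col (A - INR (fact (2 * m)) * zeta (2 * INR m + 1) / (INR N * y ^ (2 * m + 1)))%C.
Proof.
  intros HA Hcol. destruct (lam_columns A HA) as [Lk [HL1 HL2]].
  destruct Isum_dominated as [C0 [HC0 B]].
  apply (cseries_fubini Isum (fun k => C0 * / (INR (S k) * sqrt (INR (S k)))) (fun d => / (INR (S d) * sqrt (INR (S d)))) (fun k => Lk k - Pk k)%C col _ B).
  - intros k. apply Rmult_le_pos; [assumption|]. left. apply Rinv_0_lt_compat.
    assert (0 < INR (S k)) by (apply lt_0_INR; lia). apply Rmult_lt_0_compat; [assumption|now apply sqrt_lt_R0].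
  - intros k. left. apply Rinv_0_lt_compat.
    assert (0 < INR (S k)) by (apply lt_0_INR; lia). apply Rmult_lt_0_compat; [assumption|now apply sqrt_lt_R0].
  - exact (ex_series_scal_l C0 _ ex_series_inv_3_2).
  - exact ex_series_inv_3_2.
  - intros k. apply cseries_Isum_row, HL1.
  - exact Hcol.
  - apply cseries_minus; [exact HL2|apply cseries_Pk].
Qed.

(** * Summation over [k] at fixed frequency: integrals of 1/(exp w - 1) *)

Definition Vker (d : nat) (sg r : R) : C :=
  (ray sg * ((RtoC r * ray sg) ^ expo / (Cexp (y * (RtoC r * ray sg) ^ N) - 1) * Cexp (- (mu sg d * (RtoC r * ray sg)))))%C.

Definition Vray (d : nat) (sg : R) : C := IV (Vker d sg).

Lemma Cexp_minus_1_lower (w : C) : Re w <= Cmod (Cexp w - 1).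
Proof.
  pose proof (Cmod_triangle (Cexp w - 1) 1) as T. replace (Cexp w - 1 + 1)%C with (Cexp w) in T by ring.
  rewrite Cmod_Cexp, Cmod_1 in T. pose proof (exp_ineq1_le (Re w)). lra.
Qed.

Lemma Cmod_wave sg d r : sg * sg = 1 -> Cmod (Cexp (- (mu sg d * (RtoC r * ray sg)))) = exp (- (freq d * tau) * r).
Proof.
  intros Hsg. rewrite Cmod_Cexp, re_opp, Re_mu_ray by assumption. f_equal; ring.
Qed.

Lemma Vker_le d sg r : sg * sg = 1 -> 0 < r ->
  Cmod (Vker d sg r) <= (1 + tau) ^ (S expo) * / ka * edom (2 * N * m - 1) (freq d * tau) r.
Proof.
  intros Hsg Hr. unfold Vker, Cdiv. rewrite !Cmod_mult, Cmod_wave by assumption.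
  pose proof (Re_wave_ray sg r Hsg ltac:(lra)) as Bw.
  assert (HrN : 0 < ka * r ^ N) by (apply Rmult_lt_0_compat; [assumption|now apply pow_lt]).
  pose proof (Cexp_minus_1_lower (y * (RtoC r * ray sg) ^ N)) as Bl.
  assert (Hnz : (Cexp (y * (RtoC r * ray sg) ^ N) - 1)%C <> 0%C) by (apply Cmod_gt_0; lra).
  rewrite Cmod_inv by exact Hnz.
  unfold edom. rewrite <- tech_pow_Rmult.
  assert (Ee : expo = (2 * N * m - 1 + N)%nat) by (unfold expo; nia).
  replace ((1 + tau) * (1 + tau) ^ expo * / ka * (r ^ (2 * N * m - 1) * exp (- (freq d * tau) * r)))
    with ((1 + tau) * ((1 + tau) ^ expo * r ^ expo * / (ka * r ^ N) * exp (- (freq d * tau) * r))).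
  2:{ replace (r ^ expo) with (r ^ (2 * N * m - 1) * r ^ N) by (rewrite <- pow_add; f_equal; lia).
      field. split; [lra|apply pow_nonzero; lra]. }
  apply Rmult_le_compat; [apply Cmod_ge_0| |now apply Cmod_ray|].
  - repeat apply Rmult_le_pos; try apply Cmod_ge_0; left; [apply Rinv_0_lt_compat; lra|apply exp_pos].
  - apply Rmult_le_compat_r; [left; apply exp_pos|].
    apply Rmult_le_compat; [apply Cmod_ge_0|left; apply Rinv_0_lt_compat; lra|apply Cmod_pow_ray; lra|].
    apply Rinv_le_contravar; lra.
Qed.

Lemma Vker_0 d sg : Vker d sg 0 = 0%C.
Proof.
  unfold Vker. replace (RtoC 0 * ray sg)%C with (RtoC 0) by ring.
  assert (Z : (RtoC 0 ^ expo)%C = 0%C).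
  { assert (1 <= expo)%nat by (unfold expo; nia). destruct expo; [lia|rewrite Cpow_S; ring]. }
  rewrite Z. unfold Cdiv. ring.
Qed.

Lemma edom_0 p r : (1 <= p)%nat -> 0 <= r <= 1 -> forall k, 0 <= k -> edom p k r <= r.
Proof.
  intros Hp Hr k Hk. unfold edom. destruct p as [|p]; [lia|]. rewrite <- tech_pow_Rmult.
  assert (r ^ p <= 1) by (rewrite <- (pow1 p); apply pow_incr; lra).
  assert (0 <= r ^ p) by (apply pow_le; lra).
  assert (exp (- k * r) <= 1) by (rewrite <- exp_0; apply exp_le; nra).
  pose proof (exp_pos (- k * r)).
  assert (r * r ^ p <= r) by nra. assert (0 <= r * r ^ p) by nra. nra.
Qed.

Lemma IInf_Vray d sg : sg * sg = 1 -> IInf (Vker d sg) (Vray d sg).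
Proof.
  intros Hsg. apply IV_correct.
  set (K := (1 + tau) ^ (S expo) * / ka).
  assert (HK : 0 <= K).
  { unfold K. apply Rmult_le_pos; [apply pow_le; lra|left; now apply Rinv_0_lt_compat]. }
  pose proof (freq_pos d) as Hf. assert (Hft : 0 < freq d * tau) by nra.
  assert (Hp : (1 <= 2 * N * m - 1)%nat) by nia.
  (* Continuity at 0 is two-sided, while the estimate holds for r > 0 only; the even extension
     through [Rabs] supplies the other side. At 0 itself the quotient takes the default value 0,
     which is also its limit. *)
  destruct (IInf_ex_edom (fun r => Vker d sg (Rabs r)) (2 * N * m - 1) (freq d * tau) K Hft HK) as [l Hl].
  - intros r Hr. destruct (Req_EM_T r 0) as [->|Hr0].
    + apply ccont_lipschitz with (K := K). intros t Ht. rewrite Rminus_0_r in *. rewrite Rabs_R0, Vker_0.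
      replace (Vker d sg (Rabs t) - 0)%C with (Vker d sg (Rabs t)) by ring.
      destruct (Req_EM_T t 0) as [->|Ht0].
      * rewrite Rabs_R0, Vker_0, Cmod_0. lra.
      * eapply Rle_trans; [apply Vker_le; [exact Hsg|now apply Rabs_pos_lt]|]. fold K.
        apply Rmult_le_compat_l; [exact HK|]. apply edom_0; [exact Hp| |lra]. split; [apply Rabs_pos|exact Ht].
    + apply (ccont_ext_loc (Vker d sg)).
      * assert (Hr1 : 0 < r) by lra. exists (mkposreal r Hr1). intros s Hs.
        unfold ball in Hs; simpl in Hs. unfold AbsRing_ball, abs, minus, plus, opp in Hs; simpl in Hs.
        apply Rabs_lt_between in Hs. rewrite Rabs_pos_eq by lra. reflexivity.
      * unfold Vker. pose proof (ccont_ray_arg sg r) as Hx.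
        apply ccont_mult; [apply ccont_const|]. apply ccont_mult.
        -- apply ccont_div; [now apply ccont_pow| |].
           ++ apply ccont_minus; [|apply ccont_const]. apply ccont_Cexp, ccont_mult; [apply ccont_const|now apply ccont_pow].
           ++ apply Cmod_gt_0. pose proof (Re_wave_ray sg r Hsg Hr). pose proof (Cexp_minus_1_lower (y * (RtoC r * ray sg) ^ N)).
              assert (0 < ka * r ^ N) by (apply Rmult_lt_0_compat; [assumption|apply pow_lt; lra]). lra.
        -- apply ccont_Cexp, ccont_opp, ccont_mult; [apply ccont_const|exact Hx].
  - intros r Hr. rewrite Rabs_pos_eq by assumption. destruct (Req_EM_T r 0) as [->|Hr0].
    + rewrite Vker_0, Cmod_0. apply Rmult_le_pos; [exact HK|apply edom_ge_0; lra].
    + apply Vker_le; [exact Hsg|lra].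
  - exists l. eapply IInf_ext; [|exact Hl]. intros r Hr; cbv beta. rewrite Rabs_pos_eq by lra. reflexivity.
Qed.

Lemma cseries_Iray d sg : sg * sg = 1 -> cseries (fun k => Iray k d sg) (Vray d sg).
Proof.
  intros Hsg.
  (* Two factors r^N are taken out here, to obtain a dominating series in [k] that converges. *)
  assert (E2 : expo = ((2 * N * m - N - 1) + N * 2)%nat) by (unfold expo; nia).
  pose proof (freq_pos d) as Hf. assert (Hft : 0 < freq d * tau) by nra.
  set (A := (1 + tau) ^ (S expo) * (INR (fact 2) / ka ^ 2)).
  assert (HA : 0 <= A).
  { unfold A. apply Rmult_le_pos; [apply pow_le; lra|].
    apply Rmult_le_pos; [apply pos_INR|left; apply Rinv_0_lt_compat, pow_lt; lra]. }
  apply (IInf_series (fun k => kernel_ray k d sg) (Vker d sg) (fun k => Iray k d sg) (Vray d sg)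
    (fun k => A * / INR (S k) ^ 2) (fun r => 1 * edom (2 * N * m - N - 1) (freq d * tau) r)
    (1 * (INR (fact (2 * N * m - N - 1)) / (freq d * tau) ^ S (2 * N * m - N - 1)))).
  - intros k. now apply IInf_Iray.
  - now apply IInf_Vray.
  - intros k r Hr. rewrite Rmult_1_l. exact (kernel_ray_le 2 _ k d sg r Hsg E2 Hr).
  - apply ex_series_inv_sq_scal.
  - apply edom_RInt; lra.
  - intros r Hr. rewrite Rmult_1_l. apply edom_ge_0; lra.
  - intros k. pose proof (inv_sq_pos k). nra.
  - intros r Hr. set (x := (RtoC r * ray sg)%C).
    assert (Hw : 0 < Re (y * x ^ N)%C).
    { pose proof (Re_wave_ray sg r Hsg ltac:(lra)). fold x in H.
      assert (0 < ka * r ^ N) by (apply Rmult_lt_0_compat; [assumption|apply pow_lt; lra]). lra. }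
    pose proof (cseries_scal _ _ (ray sg * (x ^ expo * Cexp (- (mu sg d * x))))%C (cseries_geometric _ Hw)) as X.
    unfold Vker. fold x.
    replace (ray sg * (x ^ expo / (Cexp (y * x ^ N) - 1) * Cexp (- (mu sg d * x))))%C
      with (ray sg * (x ^ expo * Cexp (- (mu sg d * x))) * / (Cexp (y * x ^ N) - 1))%C by (unfold Cdiv; ring).
    eapply cseries_ext; [|exact X]. intros k; cbv beta. unfold kernel_ray, gker. fold x.
    replace (- (INR (S k) * y * x ^ N + mu sg d * x))%C with (- (INR (S k) * (y * x ^ N)) + - (mu sg d * x))%C by ring.
    rewrite Cexp_plus. ring.
Qed.

(** The constant c = 2 pi d2 / y with d2 = j + 1: in the variable [x], the poles w = +- i freq j are
    the solutions of x^(2N) = -c^2. *)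
Definition cpole (j : nat) : C := (freq j / y)%C.

Definition Wker (i j : nat) (sg r : R) : C :=
  (ray sg * ((RtoC r * ray sg) ^ (expo + N) / ((RtoC r * ray sg) ^ (2 * N) + cpole j * cpole j)
     * Cexp (- (mu sg i * (RtoC r * ray sg)))))%C.

Definition Wray (i j : nat) (sg : R) : C := IV (Wker i j sg).

(** A bound for |w| / Re w on both rays, w = y x^N; it is the cone constant handed to
    [sq_plus_sq_lower]. *)
Definition aperture : R := Cmod y * (1 + tau) ^ N / ka.

Lemma aperture_pos : 0 <= aperture.
Proof.
  unfold aperture. apply Rmult_le_pos; [apply Rmult_le_pos; [apply Cmod_ge_0|apply pow_le; lra]|left; now apply Rinv_0_lt_compat].
Qed.

Lemma pole_scaled j (x : C) : (y * y * (x ^ (2 * N) + cpole j * cpole j))%C = ((y * x ^ N) * (y * x ^ N) + RtoC (freq j) * RtoC (freq j))%C.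
Proof.
  unfold cpole. pose proof y_nz. replace (2 * N)%nat with (N + N)%nat by lia. rewrite Cpow_add_r. field. assumption.
Qed.

Lemma denominator_lower j sg r : sg * sg = 1 -> 0 <= r ->
  freq j * freq j / (1 + aperture * aperture) <= Cmod (y * y * ((RtoC r * ray sg) ^ (2 * N) + cpole j * cpole j))%C.
Proof.
  intros Hsg Hr. rewrite pole_scaled.
  pose proof (Re_wave_ray sg r Hsg Hr) as B. pose proof (pow_le r N Hr) as PrN.
  apply sq_plus_sq_lower; [apply aperture_pos|nra|].
  eapply Rle_trans; [apply Im_le_Cmod|]. rewrite Cmod_mult.
  pose proof (Cmod_pow_ray N sg r Hsg Hr) as B2.
  eapply Rle_trans; [apply Rmult_le_compat_l; [apply Cmod_ge_0|exact B2]|].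
  eapply Rle_trans; [|apply Rmult_le_compat_l; [apply aperture_pos|exact B]].
  right. unfold aperture. field. lra.
Qed.

Lemma denominator_nz j sg r : sg * sg = 1 -> 0 <= r ->
  ((RtoC r * ray sg) ^ (2 * N) + cpole j * cpole j)%C <> 0%C.
Proof.
  intros Hsg Hr E. pose proof (denominator_lower j sg r Hsg Hr) as B. rewrite E, Cmult_0_r, Cmod_0 in B.
  pose proof (freq_pos j). pose proof aperture_pos.
  assert (0 < freq j * freq j / (1 + aperture * aperture)) by (apply Rdiv_lt_0_compat; nra). lra.
Qed.

Definition Wconst : R := (1 + tau) ^ (S (expo + N)) * (Cmod y * Cmod y) * (1 + aperture * aperture).

Lemma Wconst_pos : 0 <= Wconst.
Proof.
  unfold Wconst. pose proof (Cmod_ge_0 y). pose proof aperture_pos. pose proof (pow_le (1 + tau) (S (expo + N)) ltac:(lra)).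
  apply Rmult_le_pos; [apply Rmult_le_pos; [assumption|nra]|nra].
Qed.

Lemma Wker_le i j sg r : sg * sg = 1 -> 0 <= r ->
  Cmod (Wker i j sg r) <= Wconst * / INR (S j) ^ 2 * edom (expo + N) (freq i * tau) r.
Proof.
  intros Hsg Hr. unfold Wker, Cdiv. set (x := (RtoC r * ray sg)%C).
  pose proof (denominator_nz j sg r Hsg Hr) as Hnz. pose proof (denominator_lower j sg r Hsg Hr) as Hlo. fold x in Hnz, Hlo.
  rewrite !Cmod_mult, Cmod_inv by exact Hnz. unfold x at 3. rewrite Cmod_wave by assumption.
  rewrite !Cmod_mult in Hlo.
  set (Y := Cmod y * Cmod y) in *. set (D := Cmod (x ^ (2 * N) + cpole j * cpole j)) in *.
  assert (HD : 0 < D) by now apply Cmod_gt_0.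
  assert (HY : 0 < Y) by (unfold Y; pose proof (proj1 (Cmod_gt_0 y) y_nz); nra).
  pose proof aperture_pos as Ha. set (ap := 1 + aperture * aperture) in *. assert (Hap : 0 < ap) by (unfold ap; nra).
  pose proof (freq_ge j) as Hj. assert (H1 : 1 <= INR (S j)) by (apply (le_INR 1); lia).
  assert (HiD : / D <= Y * ap * / INR (S j) ^ 2).
  { apply (Rmult_le_reg_r D); [assumption|]. rewrite Rinv_l by lra.
    apply (Rmult_le_reg_r (INR (S j) ^ 2)); [apply pow_lt; lra|]. rewrite Rmult_1_l.
    replace (Y * ap * / INR (S j) ^ 2 * D * INR (S j) ^ 2) with (Y * D * ap) by (field; lra).
    eapply Rle_trans; [|apply Rmult_le_compat_r; [lra|exact Hlo]].
    replace (freq j * freq j / ap * ap) with (freq j * freq j) by (field; lra). nra. }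
  unfold edom, Wconst. fold ap. fold Y. rewrite <- tech_pow_Rmult.
  replace ((1 + tau) * (1 + tau) ^ (expo + N) * Y * ap * / INR (S j) ^ 2 * (r ^ (expo + N) * exp (- (freq i * tau) * r)))
    with ((1 + tau) * ((1 + tau) ^ (expo + N) * r ^ (expo + N) * (Y * ap * / INR (S j) ^ 2) * exp (- (freq i * tau) * r))) by ring.
  apply Rmult_le_compat; [apply Cmod_ge_0| |now apply Cmod_ray|].
  - repeat apply Rmult_le_pos; try apply Cmod_ge_0; left; [now apply Rinv_0_lt_compat|apply exp_pos].
  - apply Rmult_le_compat_r; [left; apply exp_pos|].
    apply Rmult_le_compat; [apply Cmod_ge_0|left; now apply Rinv_0_lt_compat|now apply Cmod_pow_ray|exact HiD].
Qed.

Lemma IInf_Wray i j sg : sg * sg = 1 -> IInf (Wker i j sg) (Wray i j sg).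
Proof.
  intros Hsg. apply IV_correct. pose proof (freq_pos i) as Hf.
  apply (IInf_ex_edom _ (expo + N) (freq i * tau) (Wconst * / INR (S j) ^ 2)).
  - nra.
  - pose proof Wconst_pos. pose proof (inv_sq_pos j). nra.
  - intros r Hr. unfold Wker. pose proof (ccont_ray_arg sg r) as Hx.
    apply ccont_mult; [apply ccont_const|]. apply ccont_mult.
    + apply ccont_div; [now apply ccont_pow|apply ccont_plus; [now apply ccont_pow|apply ccont_const]|now apply denominator_nz].
    + apply ccont_Cexp, ccont_opp, ccont_mult; [apply ccont_const|exact Hx].
  - intros r Hr. now apply Wker_le.
Qed.

Lemma Wray_le : exists C0, 0 <= C0 /\ forall i j sg, sg * sg = 1 ->
  Cmod (Wray i j sg) <= C0 * / INR (S i) ^ 2 * / INR (S j) ^ 2.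
Proof.
  exists (Wconst * INR (fact (expo + N)) * / tau ^ S (expo + N)).
  pose proof Wconst_pos as HW. pose proof (pos_INR (fact (expo + N))) as Hfa.
  assert (Ht : 0 < / tau ^ S (expo + N)) by (apply Rinv_0_lt_compat, pow_lt; lra).
  split; [apply Rmult_le_pos; [nra|lra]|].
  intros i j sg Hsg. pose proof (freq_pos i). pose proof (inv_sq_pos j) as Hj.
  pose proof (IInf_Cmod_le_edom (Wker i j sg) (Wray i j sg) (expo + N) (freq i * tau) (Wconst * / INR (S j) ^ 2)
    ltac:(nra) ltac:(nra) (fun r Hr => Wker_le i j sg r Hsg (Rlt_le _ _ Hr)) (IInf_Wray i j sg Hsg)) as B.
  eapply Rle_trans; [exact B|]. unfold Rdiv.
  pose proof (inv_freq_tau_le (expo + N) 2 i ltac:(unfold expo; nia)) as B2.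
  replace (Wconst * INR (fact (expo + N)) * / tau ^ S (expo + N) * / INR (S i) ^ 2 * / INR (S j) ^ 2)
    with (Wconst * / INR (S j) ^ 2 * INR (fact (expo + N)) * (/ tau ^ S (expo + N) * / INR (S i) ^ 2)) by ring.
  rewrite <- Rmult_assoc. apply Rmult_le_compat_l; [|exact B2].
  apply Rmult_le_pos; [nra|assumption].
Qed.

Lemma mu_nz sg d : sg * sg = 1 -> mu sg d <> 0%C.
Proof.
  intros Hsg E. pose proof (Re_mu_ray sg 1 d Hsg) as H. rewrite E, Cmult_0_l in H.
  pose proof (freq_pos d). simpl in H. nra.
Qed.

(** The Mittag-Leffler expansion at w = y x^N times (y/2) x^expo, a factor that turns 2w / (w^2 +
    freq^2) into the quotient in [Wker]. The polar terms become pure powers against the wave,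
    evaluated by [IInf_gamma]. *)
Lemma cseries_Wray i sg : sg * sg = 1 ->
  cseries (fun j => Wray i j sg)
    (y / 2 * (Vray i sg - / y * (INR (fact (2 * N * m - 1)) / mu sg i ^ S (2 * N * m - 1)) + / 2 * (INR (fact expo) / mu sg i ^ S expo)))%C.
Proof.
  intros Hsg. pose proof (freq_pos i) as Hf. pose proof y_nz as Hy.
  assert (Hre : 0 < Re (mu sg i * ray sg)%C).
  { pose proof (Re_mu_ray sg 1 i Hsg) as E. rewrite Cmult_1_l in E. rewrite E. nra. }
  set (G := fun n r => (ray sg * ((RtoC r * ray sg) ^ n * Cexp (- (mu sg i * (RtoC r * ray sg)))))%C).
  assert (HG : forall n, IInf (G n) (INR (fact n) / mu sg i ^ S n)%C) by (intros n; now apply IInf_gamma).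
  apply (IInf_series (fun j => Wker i j sg) (fun r => y / 2 * (Vker i sg r - / y * G (2 * N * m - 1)%nat r + / 2 * G expo r))%C
    (fun j => Wray i j sg) _ (fun j => Wconst * / INR (S j) ^ 2) (fun r => 1 * edom (expo + N) (freq i * tau) r)
    (1 * (INR (fact (expo + N)) / (freq i * tau) ^ S (expo + N)))).
  - intros j. now apply IInf_Wray.
  - apply IInf_scal, IInf_plus; [apply IInf_minus; [now apply IInf_Vray|apply IInf_scal, HG]|apply IInf_scal, HG].
  - intros j r Hr. rewrite Rmult_1_l. apply Wker_le; [exact Hsg|lra].
  - apply ex_series_inv_sq_scal.
  - apply edom_RInt; nra.
  - intros r Hr. rewrite Rmult_1_l. apply edom_ge_0; lra.
  - intros j. pose proof (inv_sq_pos j). pose proof Wconst_pos. nra.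
  - intros r Hr. set (x := (RtoC r * ray sg)%C). set (w := (y * x ^ N)%C).
    assert (Hw : 0 < Re w).
    { pose proof (Re_wave_ray sg r Hsg ltac:(lra)). fold x in H. fold w in H.
      assert (0 < ka * r ^ N) by (apply Rmult_lt_0_compat; [assumption|apply pow_lt; lra]). lra. }
    assert (Hw0 : w <> 0%C) by (intros E; rewrite E in Hw; simpl in Hw; lra).
    assert (HxN : (x ^ N)%C <> 0%C) by (intros E; apply Hw0; unfold w; rewrite E; ring).
    pose proof (cseries_scal _ _ (y / 2 * (ray sg * (x ^ expo * Cexp (- (mu sg i * x)))))%C (mittag_leffler w Hw)) as X.
    assert (Ex : (x ^ expo)%C = (x ^ (2 * N * m - 1) * x ^ N)%C).
    { rewrite <- Cpow_add_r. f_equal. unfold expo; nia. }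
    replace (y / 2 * (Vker i sg r - / y * G (2 * N * m - 1)%nat r + / 2 * G expo r))%C
      with (y / 2 * (ray sg * (x ^ expo * Cexp (- (mu sg i * x)))) * (/ (Cexp w - 1) - / w + 1 / 2))%C.
    + eapply cseries_ext; [|exact X]. intros j; cbv beta. unfold Wker. fold x.
      pose proof (denominator_nz j sg r Hsg ltac:(lra)) as Hnz. fold x in Hnz.
      unfold w at 2 3. rewrite <- pole_scaled.
      rewrite Cpow_add_r. unfold w. field. split; assumption.
    + assert (He : (Cexp w - 1)%C <> 0%C).
      { apply Cmod_gt_0. pose proof (Cexp_minus_1_lower w). lra. }
      unfold Vker, G. fold x. fold w. rewrite Ex. unfold w at 2. field. repeat split; assumption.
Qed.

Hypothesis Hodd : Nat.Odd N.

Lemma pow_m1_odd : (-1) ^ (N * m) = (-1) ^ m.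
Proof.
  destruct Hodd as [h Hh]. replace (N * m)%nat with (2 * (h * m) + m)%nat by nia.
  rewrite pow_add, pow_1_even. ring.
Qed.

Lemma mu_pow_even sg i : sg * sg = 1 -> (mu sg i ^ (2 * N * m))%C = RtoC ((-1) ^ m * freq i ^ (2 * N * m)).
Proof.
  intros Hsg. replace (2 * N * m)%nat with (2 * (N * m))%nat by lia.
  rewrite Cpow_mult_r. replace (mu sg i ^ 2)%C with (RtoC (-1 * freq i ^ 2)).
  - rewrite <- RtoC_pow, Rpow_mult_distr, pow_m1_odd, <- pow_mult. reflexivity.
  - unfold mu. apply C_ext; simpl; [|ring].
    transitivity (- (sg * sg) * (freq i * freq i)); [rewrite Hsg; ring|ring].
Qed.

(** The exponent 2Nm + N is odd; this sign is what cancels the contributions of the constant 1/2 on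
    the two rays. *)
Lemma mu_pow_odd i : (mu (-1) i ^ S expo)%C = (- (mu 1 i ^ S expo))%C.
Proof.
  assert (E : mu (-1) i = (RtoC (-1) * mu 1 i)%C) by (unfold mu; apply C_ext; simpl; ring).
  rewrite E, Cpow_mult_l, <- RtoC_pow.
  destruct Hodd as [h Hh]. replace (S expo) with (S (2 * (N * m + h))) at 1 by (unfold expo; lia).
  rewrite pow_1_odd. replace (RtoC (-1)) with (- RtoC 1)%C by (rewrite <- RtoC_opp; reflexivity). ring.
Qed.

Definition Wsum (i j : nat) : C := (Wray i j 1 + Wray i j (-1))%C.

Lemma cseries_Wsum_row i :
  cseries (Wsum i) (y / 2 * (Vray i 1 + Vray i (-1) + / y * INR (fact (2 * N * m - 1)) * RtoC (- 2 * (-1) ^ m / freq i ^ (2 * N * m))))%C.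
Proof.
  assert (S1 : 1 * 1 = 1) by ring. assert (S2 : -1 * -1 = 1) by ring.
  pose proof (cseries_plus _ _ _ _ (cseries_Wray i 1 S1) (cseries_Wray i (-1) S2)) as X.
  unfold Wsum.
  match goal with |- cseries _ ?z => match type of X with cseries _ ?w => replace z with w; [exact X|] end end.
  assert (ES : S (2 * N * m - 1) = (2 * N * m)%nat) by nia. rewrite ES.
  rewrite !mu_pow_even, mu_pow_odd by assumption.
  assert (P1 : freq i ^ (2 * N * m) <> 0) by (apply pow_nonzero; pose proof (freq_pos i); lra).
  assert (Q1 : (-1) ^ m * (-1) ^ m = 1) by (rewrite <- Rpow_mult_distr; replace (-1 * -1) with 1 by ring; apply pow1).
  assert (Q0 : (-1) ^ m <> 0) by (apply pow_nonzero; lra).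
  assert (E : (/ RtoC ((-1) ^ m * freq i ^ (2 * N * m)))%C = RtoC ((-1) ^ m / freq i ^ (2 * N * m))).
  { rewrite <- RtoC_inv by (apply Rmult_integral_contrapositive; split; assumption).
    f_equal. rewrite Rinv_mult. unfold Rdiv. f_equal.
    apply (Rmult_eq_reg_r ((-1) ^ m)); [|assumption]. rewrite Q1. field; assumption. }
  assert (EF : forall F : C, (F / RtoC ((-1) ^ m * freq i ^ (2 * N * m)))%C = (F * RtoC ((-1) ^ m / freq i ^ (2 * N * m)))%C).
  { intros F. unfold Cdiv. now rewrite E. }
  rewrite !EF.
  assert (M : (mu 1 i ^ S expo)%C <> 0%C) by (apply Cpow_nz, mu_nz; ring).
  assert (EM : forall F z : C, z <> 0%C -> (F / - z)%C = (- (F / z))%C) by (intros; field; assumption).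
  rewrite EM by exact M.
  replace (RtoC (-2 * (-1) ^ m / freq i ^ (2 * N * m))) with (- RtoC 2 * RtoC ((-1) ^ m / freq i ^ (2 * N * m)))%C; [ring|].
  rewrite <- RtoC_opp, <- RtoC_mult. f_equal. unfold Rdiv; ring.
Qed.

Lemma cseries_Isum_column d : cseries (fun k => Isum k d) (Vray d 1 + Vray d (-1))%C.
Proof. unfold Isum. apply cseries_plus; apply cseries_Iray; ring. Qed.

Lemma bernoulli_term :
  is_series (fun i => INR (fact (2 * N * m - 1)) * (- 2 * (-1) ^ m / freq i ^ (2 * N * m)))
    (bernoulli (2 * N * m) / (2 * INR N * INR m)).
Proof.
  assert (HNm : (1 <= N * m)%nat) by nia.
  pose proof (is_series_scal (INR (fact (2 * N * m - 1))) _ _ (is_series_bernoulli (N * m) HNm)) as X.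
  replace (2 * (N * m))%nat with (2 * N * m)%nat in X by lia. rewrite pow_m1_odd in X.
  replace (bernoulli (2 * N * m) / (2 * INR N * INR m)) with (INR (fact (2 * N * m - 1)) * (bernoulli (2 * N * m) / INR (fact (2 * N * m)))).
  - exact X.
  -    replace (2 * INR N * INR m) with (INR (2 * N * m)) by (rewrite !mult_INR; simpl; ring).
    replace (fact (2 * N * m)) with (2 * N * m * fact (2 * N * m - 1))%nat.
    + rewrite mult_INR. field. split; [apply not_0_INR; nia|apply INR_fact_neq_0].
    + assert (Hp : exists p, (2 * N * m)%nat = S p) by (exists (2 * N * m - 1)%nat; nia).
      destruct Hp as [p Hp]. rewrite Hp. simpl (S p - 1)%nat. rewrite Nat.sub_0_r. reflexivity.
Qed.

(** Both arithmetic functions run over the same pairs d1 = i + 1, d2 = j + 1 with d1^N d2 = n; sigma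
    puts its weight on d1, S on d2. *)
Definition dirichlet_index (i j : nat) : nat := (S i ^ N * S j)%nat.

Lemma dirichlet_index_ge i j : (S i <= dirichlet_index i j /\ S j <= dirichlet_index i j)%nat.
Proof.
  unfold dirichlet_index.
  assert (H : (S i <= S i ^ N)%nat) by (rewrite <- (Nat.pow_1_r (S i)) at 1; apply Nat.pow_le_mono_r; lia).
  split; nia.
Qed.

Lemma dirichlet_index_fin K : exists M0, forall i j, (i <= K)%nat -> (j <= K)%nat -> (dirichlet_index i j <= M0)%nat.
Proof.
  exists (S K ^ N * S K)%nat. intros i j Hi Hj. unfold dirichlet_index.
  apply Nat.mul_le_mono; [apply Nat.pow_le_mono_l|]; lia.
Qed.

Definition dirichlet_sum (b : nat -> nat -> C) (n : nat) : C :=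
  csum (fun i => csum (fun j => if (dirichlet_index i j =? S n)%nat then b i j else 0%C) n) n.

(** The rows of [Wsum] contain the columns of [Isum], which total [A] minus the zeta term, and the
    terms of Euler's series for the Bernoulli number. Both families have product bounds with inverse
    squares, so both may be regrouped along [dirichlet_index]. *)
Lemma ray_total : exists A,
  cseries (dirichlet_sum lam) A /\
  cseries (dirichlet_sum Wsum)
    (y / 2 * (A - INR (fact (2 * m)) * zeta (2 * INR m + 1) / (INR N * y ^ (2 * m + 1))
        + bernoulli (2 * N * m) / (2 * INR N * INR m * y)))%C.
Proof.
  destruct lam_square as [A HA]. exists A. split.
  - destruct lam_le as [C0 [HC0 B]].
    apply (cseries_groups lam (fun n => C0 * / INR (S n) ^ 2) (fun k => / INR (S k) ^ 2) B) with (6 := dirichlet_index_fin).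
    + intros i; pose proof (inv_sq_pos i); nra.
    + intros j; left; apply inv_sq_pos.
    + apply ex_series_inv_sq_scal.
    + apply ex_series_inv_sq.
    + apply dirichlet_index_ge.
    + exact HA.
  - destruct Wray_le as [C0 [HC0 B]].
    assert (BW : forall i j, Cmod (Wsum i j) <= 2 * C0 * / INR (S i) ^ 2 * / INR (S j) ^ 2).
    { intros i j. unfold Wsum. eapply Rle_trans; [apply Cmod_triangle|].
      pose proof (B i j 1 ltac:(ring)). pose proof (B i j (-1) ltac:(ring)). lra. }
    assert (Hu : forall i, 0 <= 2 * C0 * / INR (S i) ^ 2) by (intros i; pose proof (inv_sq_pos i); nra).
    assert (Hv : forall j, 0 <= / INR (S j) ^ 2) by (intros j; left; apply inv_sq_pos).
    destruct (cseries_rows_square Wsum _ _ BW Hu Hv (ex_series_inv_sq_scal _) ex_series_inv_sq _ cseries_Wsum_row) as [T [HT1 HT2]].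
    assert (HT : T = (y / 2 * (A - INR (fact (2 * m)) * zeta (2 * INR m + 1) / (INR N * y ^ (2 * m + 1))
        + bernoulli (2 * N * m) / (2 * INR N * INR m * y)))%C).
    { eapply cseries_unique; [exact HT1|].
      pose proof (cseries_Isum_columns A (fun d => Vray d 1 + Vray d (-1))%C HA cseries_Isum_column) as X1.
      pose proof (cseries_scal _ _ (/ y)%C (cseries_RtoC _ _ bernoulli_term)) as X2.
      pose proof (cseries_scal _ _ (y / 2)%C (cseries_plus _ _ _ _ X1 X2)) as X.
      match goal with |- cseries _ ?z => match type of X with cseries _ ?w => replace z with w end end.
      - eapply cseries_ext; [|exact X]. intros i; cbv beta. rewrite RtoC_mult. ring.
      - assert (HN0 : INR N <> 0) by (apply not_0_INR; lia). assert (Hm0 : INR m <> 0) by (apply not_0_INR; lia).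
        rewrite RtoC_div, !RtoC_mult by (repeat apply Rmult_integral_contrapositive_currified; lra).
        pose proof y_nz.
        assert (RtoC (INR N) <> 0%C) by now apply RtoC_neq_0. assert (RtoC (INR m) <> 0%C) by now apply RtoC_neq_0.
        assert (y ^ (2 * m + 1) <> 0)%C by now apply Cpow_nz.
        field. repeat split; assumption. }
    rewrite <- HT.
    apply (cseries_groups Wsum (fun i => 2 * C0 * / INR (S i) ^ 2) (fun k => / INR (S k) ^ 2) BW) with (6 := dirichlet_index_fin); try assumption.
    + apply ex_series_inv_sq_scal.
    + apply ex_series_inv_sq.
    + apply dirichlet_index_ge.
Qed.

End Rays.

(** * Partial fractions over roots of unity, and cones *)

Lemma csum_pow_geometric (A B : C) n :
  ((A - B) * csum (fun j => A ^ (n - j) * B ^ j) n)%C = (A ^ S n - B ^ S n)%C.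
Proof.
  induction n.
  - rewrite csum_O. simpl. ring.
  - rewrite csum_S, Nat.sub_diag.
    rewrite (csum_ext _ (fun j => A * (A ^ (n - j) * B ^ j))%C).
    + rewrite csum_scal. 
      replace ((A - B) * (A * csum (fun k => A ^ (n - k) * B ^ k) n + A ^ 0 * B ^ S n))%C
        with (A * ((A - B) * csum (fun k => A ^ (n - k) * B ^ k) n) + (A - B) * B ^ S n)%C by (simpl; ring).
      rewrite IHn, (Cpow_S A (S n)), (Cpow_S B (S n)). ring.
    + intros k Hk. replace (S n - k)%nat with (S (n - k)) by lia. rewrite Cpow_S. ring.
Qed.

Lemma csum_const (c : C) n : csum (fun _ => c) n = (INR (S n) * c)%C.
Proof.
  induction n; [rewrite csum_O; simpl; ring|]. rewrite csum_S, IHn, (S_INR (S n)), RtoC_plus. ring.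
Qed.

Lemma csum_shift (a : nat -> C) n : csum a (S n) = (a 0%nat + csum (fun k => a (S k)) n)%C.
Proof.
  induction n; [rewrite csum_S, !csum_O; reflexivity|]. rewrite csum_S, IHn, csum_S. ring.
Qed.

Lemma root_powers_sum (om : C) n j : (om ^ S n)%C = 1%C -> (om ^ j)%C <> 1%C ->
  csum (fun i => om ^ (i * j))%C n = 0%C.
Proof.
  intros H1 H2. pose proof (csum_pow_geometric 1 (om ^ j) n) as G.
  assert (N0 : (1 - om ^ j)%C <> 0%C).
  { intros E. apply H2. replace (om ^ j)%C with (1 - (1 - om ^ j))%C by ring. rewrite E; ring. }
  rewrite <- Cpow_mult_r, (Nat.mul_comm j), Cpow_mult_r, H1, !Cpow_1_l in G.
  replace (1 - 1)%C with (RtoC 0) in G by ring.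
  rewrite (csum_ext _ (fun i => 1 ^ (n - i) * (om ^ j) ^ i)%C).
  - transitivity (/ (1 - om ^ j) * ((1 - om ^ j) * csum (fun i => 1 ^ (n - i) * (om ^ j) ^ i)%C n))%C; [field; exact N0|].
    rewrite G; ring.
  - intros i _. rewrite Cpow_1_l, <- Cpow_mult_r, Nat.mul_comm. ring.
Qed.

(** Over the common denominator each summand is a geometric sum in B om^i; summing over [i]
    annihilates every power of [om] except the zeroth. *)
Lemma partial_fractions_roots (A B om : C) n :
  (om ^ S n)%C = 1%C -> (forall j, (0 < j <= n)%nat -> (om ^ j)%C <> 1%C) -> (A ^ S n - B ^ S n)%C <> 0%C ->
  csum (fun i => / (A - B * om ^ i))%C n = (INR (S n) * A ^ n / (A ^ S n - B ^ S n))%C.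
Proof.
  intros H1 H2 H3.
  assert (E : forall i, (/ (A - B * om ^ i))%C = (/ (A ^ S n - B ^ S n) * csum (fun j => A ^ (n - j) * (B * om ^ i) ^ j) n)%C).
  { intros i. pose proof (csum_pow_geometric A (B * om ^ i) n) as G.
    rewrite (Cpow_mult_l B (om ^ i) (S n)), <- (Cpow_mult_r om), (Nat.mul_comm i), Cpow_mult_r, H1, Cpow_1_l, Cmult_1_r in G.
    assert (N0 : (A - B * om ^ i)%C <> 0%C) by (intros Z; apply H3; rewrite <- G, Z; ring).
    rewrite <- G. field. split; [|exact N0]. intros Z; apply H3; rewrite <- G, Z; ring. }
  rewrite (csum_ext _ _ n (fun i _ => E i)), csum_scal, csum_switch.
  destruct n as [|n].
  - rewrite !csum_O. rewrite !Cpow_1_r in *. simpl. field. exact H3.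
  - rewrite csum_shift.
    rewrite (csum_ext (fun k => csum (fun i => A ^ (S n - S k) * (B * om ^ i) ^ S k)%C (S n)) (fun _ => 0%C)).
    + rewrite csum_const.
      rewrite (csum_ext (fun i => A ^ (S n - 0) * (B * om ^ i) ^ 0)%C (fun _ => A ^ S n)%C) by (intros; simpl; ring).
      rewrite csum_const. unfold Cdiv. ring.
    + intros k Hk.
      rewrite (csum_ext _ (fun i => A ^ (S n - S k) * B ^ S k * om ^ (i * S k))%C).
      * rewrite csum_scal, root_powers_sum by (try apply H2; try assumption; lia). ring.
      * intros i _. rewrite Cpow_mult_l, <- Cpow_mult_r. ring.
Qed.

Lemma fold_right_seq (f : nat -> C) (s0 : C) n :
  fold_right (fun i s => f i + s)%C s0 (seq 0 (S n)) = (csum f n + s0)%C.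
Proof.
  revert s0; induction n; intros s0; [rewrite csum_O; reflexivity|].
  rewrite seq_S, fold_right_app, IHn, csum_S. simpl. ring.
Qed.

Lemma sum_Z_csum (h : nat) (f : Z -> C) :
  sum_Z (- Z.of_nat h) (Z.of_nat h) f = csum (fun i => f (Z.of_nat i - Z.of_nat h)%Z) (2 * h).
Proof.
  unfold sum_Z. replace (Z.to_nat (Z.of_nat h - - Z.of_nat h + 1)) with (S (2 * h)) by lia.
  rewrite fold_right_seq, Cplus_0_r. apply csum_ext; intros i _. f_equal. lia.
Qed.

Lemma sum_n_m_csum (f : nat -> C) n :
  sum_n_m (G := C_AbelianMonoid) f 1 (S n) = csum (fun k => f (S k)) n.
Proof. symmetry. exact (sum_n_m_S (G := C_AbelianMonoid) f 0 n). Qed.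

(** The expansion of the kernel in powers of u^(2N) / X^2 begins with the negatives of the added
    terms; what is left is the kernel times (u^(2N) / X^2)^(m+1). *)
Lemma tail_telescope (u X : C) N m : (1 <= N)%nat -> X <> 0%C -> (u ^ (2 * N) - X * X)%C <> 0%C ->
  (u ^ (2 * N - 1) / (u ^ (2 * N) - X * X) + csum (fun j => u ^ (2 * N * S j - 1) * / X ^ (2 * S j)) m)%C
   = (u ^ (2 * N * S m + 2 * N - 1) / (X ^ (2 * S m) * (u ^ (2 * N) - X * X)))%C.
Proof.
  intros HN HX HD. set (D := (u ^ (2 * N) - X * X)%C) in *.
  assert (Hstep : forall m, (u ^ (2 * N * m + 2 * N - 1) / (X ^ (2 * m) * D) + u ^ (2 * N * S m - 1) * / X ^ (2 * S m))%C
     = (u ^ (2 * N * S m + 2 * N - 1) / (X ^ (2 * S m) * D))%C).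
  { intros k. replace (2 * N * S k - 1)%nat with (2 * N * k + 2 * N - 1)%nat by lia.
    replace (2 * N * S k + 2 * N - 1)%nat with ((2 * N * k + 2 * N - 1) + 2 * N)%nat by nia.
    replace (2 * S k)%nat with (2 * k + 2)%nat by lia. rewrite !Cpow_add_r.
    replace (u ^ (2 * N))%C with (D + X * X)%C by (unfold D; ring).
    assert (X ^ (2 * k) <> 0)%C by now apply Cpow_nz.
    set (v := (u ^ (2 * N * k + 2 * N - 1))%C). replace (X ^ 2)%C with (X * X)%C by (simpl; ring).
    field. repeat split; assumption. }
  induction m.
  - rewrite csum_O. rewrite <- Hstep.
    replace (2 * N * 0 + 2 * N - 1)%nat with (2 * N - 1)%nat by lia. simpl (2 * 0)%nat.
    replace (X ^ 0)%C with (RtoC 1) by reflexivity. rewrite Cmult_1_l. reflexivity.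
  - rewrite csum_S, <- Hstep, <- IHm. ring.
Qed.

(** The cone inequality is cos (|Im ze| + th) > 0 expanded by the addition formula. *)
Lemma Cexp_cone (ze : C) th : 0 < th < PI / 2 -> Rabs (Im ze) < PI / 2 - th ->
  0 < Re (Cexp ze) /\ tan th * Rabs (Im (Cexp ze)) < Re (Cexp ze).
Proof.
  intros Hth Hze. unfold Cexp; simpl. set (phi := Im ze) in *. pose proof (exp_pos (Re ze)) as He.
  pose proof PI_RGT_0. pose proof (Rabs_pos phi).
  assert (Hc : 0 < cos (Rabs phi + th)) by (apply cos_gt_0; lra).
  assert (Hct : 0 < cos th) by (apply cos_gt_0; lra).
  assert (Hst : 0 < sin th) by (apply sin_gt_0; lra).
  assert (Ecos : cos (Rabs phi) = cos phi) by (unfold Rabs; destruct Rcase_abs; [apply cos_neg|reflexivity]).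
  assert (Hcp : 0 < cos phi) by (rewrite <- Ecos; apply cos_gt_0; lra).
  assert (Hsp : 0 <= sin (Rabs phi)) by (apply sin_ge_0; lra).
  assert (Esin : Rabs (sin phi) = sin (Rabs phi)).
  { unfold Rabs at 2. unfold Rabs in Hsp. destruct Rcase_abs.
    - rewrite sin_neg in *. apply Rabs_left1; lra.
    - apply Rabs_pos_eq; lra. }
  split; [now apply Rmult_lt_0_compat|].
  rewrite Rabs_mult, (Rabs_pos_eq (exp _)), Esin by lra.
  replace (tan th * (exp (Re ze) * sin (Rabs phi))) with (exp (Re ze) * (tan th * sin (Rabs phi))) by ring.
  apply Rmult_lt_compat_l; [exact He|].
  apply (Rmult_lt_reg_r (cos th)); [assumption|].
  replace (tan th * sin (Rabs phi) * cos th) with (sin th * sin (Rabs phi)) by (unfold tan; field; lra).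
  rewrite cos_plus, Ecos in Hc. lra.
Qed.

Definition F_ker (th sg : R) (z : C) (s : R) : C :=
  let e : C := (tan th, sg) in (e * Cexp (- (s * e)) * (s * e) / ((s * e) * (s * e) - z * z))%C.

Lemma IInf_F_ker (z : C) (th : R) : 0 < th < PI / 2 -> 0 < Re z -> tan th * Rabs (Im z) < Re z ->
  (forall sg, sg * sg = 1 -> IInf (F_ker th sg z) (IV (F_ker th sg z))) /\
  sinhShi_coshChi z = ((IV (F_ker th 1 z) + IV (F_ker th (-1) z)) / 2)%C.
Proof.
  intros H1 H2 H3. destruct (IInf_sinhShi_coshChi z th H1 H2 H3) as [l [HI HF]].
  assert (HV : forall sg, sg * sg = 1 -> IInf (F_ker th sg z) (IV (F_ker th sg z))).
  { intros sg Hsg. apply IV_correct. exists (l sg). exact (HI sg Hsg). }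
  split; [exact HV|]. rewrite HF.
  rewrite (IInf_unique _ _ _ (HI 1 ltac:(ring)) (HV 1 ltac:(ring))).
  rewrite (IInf_unique _ _ _ (HI (-1) ltac:(ring)) (HV (-1) ltac:(ring))). reflexivity.
Qed.

Lemma Cpower_nat (x : R) (k : nat) : 0 < x -> Cpower x (INR k) = (RtoC x ^ k)%C.
Proof.
  intros Hx. unfold Cpower. rewrite <- Cexp_pow, Cexp_Clog; [reflexivity|apply RtoC_neq_0; lra].
Qed.

Lemma csum_delta (g : nat -> C) j0 n : (j0 <= n)%nat -> csum (fun j => if (j =? j0)%nat then g j else 0%C) n = g j0.
Proof.
  intros H. induction n.
  - rewrite csum_O. replace j0 with 0%nat by lia. reflexivity.
  - rewrite csum_S. destruct (Nat.eqb_spec (S n) j0) as [<-|Hne].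
    + rewrite csum_zero; [ring|]. intros k Hk. destruct (Nat.eqb_spec k (S n)); [lia|reflexivity].
    + rewrite IHn by lia. ring.
Qed.

(** * The bracket of the right-hand side *)

Section Angles.

Variables (N m : nat) (y : C).
Hypothesis Hodd : Nat.Odd N.
Hypothesis Hm : (1 <= m)%nat.
Hypothesis Hy : 0 < Re y.

Let HN : (1 <= N)%nat.
Proof. destruct Hodd as [h ->]. lia. Qed.

Let INR_N_pos : 0 < INR N.
Proof. apply lt_0_INR. exact HN. Qed.

Let INR_N_nz : RtoC (INR N) <> 0%C.
Proof. apply RtoC_neq_0. apply Rgt_not_eq, INR_N_pos. Qed.

Let y0 : y <> 0%C.
Proof. intros E. rewrite E in Hy. simpl in Hy. lra. Qed.

Definition eta : R := Im (L0 y).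
(* The aperture is chosen so that [y x ^ N] stays in the right half plane for [|arg x| <= theta]. *)
Definition theta : R := (PI / 2 - Rabs eta) / (2 * INR N).
(** A lower bound for Re (y x^N) when Re x = 1 and |arg x| <= theta: the modulus is at least |y|,
    and the argument at most |eta| + N theta. *)
Definition kappa : R := exp (Re (L0 y)) * cos (Rabs eta + INR N * theta).

Lemma eta_bound : Rabs eta < PI / 2.
Proof. apply L0_Im. Qed.

Lemma N_theta : INR N * theta = (PI / 2 - Rabs eta) / 2.
Proof. unfold theta. field. apply Rgt_not_eq, INR_N_pos. Qed.

Lemma theta_bound : 0 < theta < PI / 2.
Proof.
  pose proof eta_bound as B. pose proof (Rabs_pos eta) as P. pose proof INR_N_pos as HNp. pose proof PI_RGT_0.
  assert (H1 : 1 <= INR N) by (apply (le_INR 1), HN).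
  unfold theta. split; [apply Rdiv_lt_0_compat; lra|].
  apply (Rmult_lt_reg_r (2 * INR N)); [lra|]. unfold Rdiv at 1; rewrite Rmult_assoc, Rinv_l, Rmult_1_r by lra. nra.
Qed.

Lemma kappa_pos : 0 < kappa.
Proof.
  unfold kappa. apply Rmult_lt_0_compat; [apply exp_pos|]. rewrite N_theta.
  pose proof eta_bound. pose proof (Rabs_pos eta). apply cos_gt_0; lra.
Qed.

Lemma sector_bound sg s : sg * sg = 1 -> 0 <= s <= 1 -> kappa <= Re (y * ray_seg (tan theta) sg s ^ N)%C.
Proof.
  intros Hsg Hs. set (v := ray_seg (tan theta) sg s).
  pose proof theta_bound as Ht.
  assert (Ht0 : 0 < tan theta) by (apply tan_gt_0; lra).
  assert (Rv : Re v = 1) by (unfold v, ray_seg, ray, Re; simpl; ring).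
  assert (Iv : Im v = - (sg * (s * tan theta))) by (unfold v, ray_seg, ray, Im; simpl; ring).
  assert (Hv : Cexp (L0 v) = v) by (apply Cexp_L0; lra).
  assert (Hy' : Cexp (L0 y) = y) by now apply Cexp_L0.
  rewrite <- Hy' at 1. rewrite <- Hv, Cexp_pow, <- Cexp_plus.
  assert (Iat : Rabs (Im (L0 v)) <= theta).
  { change (Im (L0 v)) with (atan (Im v / Re v)). rewrite Rv, Iv. unfold Rdiv. rewrite Rinv_1, Rmult_1_r.
    assert (Ha : 0 <= atan (s * tan theta) <= theta).
    { split.
      - rewrite <- atan_0. destruct (Req_EM_T (s * tan theta) 0) as [->|]; [lra|]. left; apply atan_increasing. nra.
      - rewrite <- (atan_tan theta) at 2 by lra.
        destruct (Req_EM_T (s * tan theta) (tan theta)) as [->|]; [lra|]. left; apply atan_increasing. nra. }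
    assert (Hs' : sg = 1 \/ sg = -1).
    { assert ((sg - 1) * (sg + 1) = 0) by nra. apply Rmult_integral in H; lra. }
    rewrite atan_opp, Rabs_Ropp.
    destruct Hs' as [-> | ->].
    - rewrite Rmult_1_l. rewrite Rabs_pos_eq; lra.
    - replace (-1 * (s * tan theta)) with (- (s * tan theta)) by ring. rewrite atan_opp, Rabs_Ropp, Rabs_pos_eq; lra. }
  change (kappa <= exp (Re (L0 y + INR N * L0 v)%C) * cos (Im (L0 y + INR N * L0 v)%C)).
  rewrite re_plus, im_plus, re_scal_l, im_scal_l. fold eta.
  unfold kappa. pose proof INR_N_pos as HNp. pose proof PI_RGT_0.
  set (t := Im (L0 v)) in *.
  assert (Hsum : Rabs (eta + INR N * t) <= Rabs eta + INR N * theta).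
  { eapply Rle_trans; [apply Rabs_triang|]. rewrite Rabs_mult, (Rabs_pos_eq (INR N)) by lra.
    apply Rplus_le_compat_l, Rmult_le_compat_l; lra. }
  pose proof N_theta as HNt. pose proof eta_bound. pose proof (Rabs_pos eta).
  assert (Hcos : cos (Rabs eta + INR N * theta) <= cos (eta + INR N * t)).
  { replace (cos (eta + INR N * t)) with (cos (Rabs (eta + INR N * t))).
    - apply cos_decr_1; try lra; try apply Rabs_pos.
    - unfold Rabs at 1; destruct Rcase_abs; [apply cos_neg|reflexivity]. }
  assert (Hre : 0 <= Re (L0 v)).
  { change (Re (L0 v)) with (/ 2 * ln (Re v * Re v + Im v * Im v)). rewrite Rv, Iv. rewrite <- (Rmult_0_r (/ 2)). apply Rmult_le_compat_l; [lra|].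
    rewrite <- ln_1. set (q := - (sg * (s * tan theta))). destruct (Req_EM_T (q * q) 0) as [E|E].
    - rewrite E. right. f_equal. ring.
    - left. apply ln_increasing; nra. }
  assert (0 < cos (Rabs eta + INR N * theta)) by (rewrite HNt; apply cos_gt_0; lra).
  apply Rmult_le_compat; [left; apply exp_pos|lra| |exact Hcos].
  apply exp_le. nra.
Qed.

Definition Xarg (n : nat) : C := (RtoC (2 * PI) ^ (N + 1) * INR n / y)%C.

(** The argument is a positive multiple of 1 / y, so its principal logarithm is a real number minus
    that of [y], and the principal N-th root has argument -eta / N. *)
Lemma Clog_Xarg n : (1 <= n)%nat ->
  exists p : R, Clog (Xarg n) = (RtoC p - L0 y)%C /\ Cexp (RtoC p - L0 y) = Xarg n.
Proof.
  intros Hn. set (P := (2 * PI) ^ (N + 1) * INR n).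
  assert (HP : 0 < P).
  { unfold P. apply Rmult_lt_0_compat; [apply pow_lt; pose proof PI_RGT_0; lra|apply lt_0_INR; lia]. }
  assert (EX : Xarg n = (P / y)%C).
  { unfold Xarg, P. rewrite (RtoC_mult ((2 * PI) ^ (N + 1))), RtoC_pow. reflexivity. }
  assert (EE : Cexp (RtoC (ln P) - L0 y) = Xarg n).
  { unfold Cminus. rewrite Cexp_plus, Cexp_opp, Cexp_L0, Cexp_RtoC, exp_ln by assumption. rewrite EX. reflexivity. }
  exists (ln P). split; [|exact EE].
  assert (RX : 0 < Re (Xarg n)).
  { rewrite EX. unfold Cdiv. rewrite re_scal_l. apply Rmult_lt_0_compat; [exact HP|].
    unfold Cinv, Re; simpl. pose proof (Csq_pos y y0) as Q. unfold Re, Im in Q, Hy. apply Rdiv_lt_0_compat; lra. }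
  rewrite Clog_L0 by exact RX. symmetry. apply L0_unique; [exact EE|exact RX|].
  unfold Cminus. rewrite im_plus, im_opp, im_RtoC, Rplus_0_l, Rabs_Ropp.
  pose proof (L0_Im y). pose proof PI_RGT_0. lra.
Qed.

Definition zroot (n : nat) (k : Z) : C := (Cpower (Xarg n) (/ INR N) * Cexp (RtoC PI * Ci * IZR k / INR N))%C.

Lemma zroot_exp n : (1 <= n)%nat -> exists p : R, Cexp (RtoC p - L0 y) = Xarg n /\
  forall k, zroot n k = Cexp (/ INR N * (RtoC p - L0 y) + RtoC PI * Ci * IZR k / INR N).
Proof.
  intros Hn. destruct (Clog_Xarg n Hn) as [p [H1 H2]]. exists p. split; [exact H2|].
  intros k. unfold zroot, Cpower. rewrite H1, <- Cexp_plus. reflexivity.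
Qed.

(** The argument is (pi k - eta) / N with |k| <= (N-1)/2. Staying below pi/2 - theta in absolute
    value then amounts to |eta| + N theta < pi/2. *)
Lemma zroot_cone n (h i : nat) : N = (2 * h + 1)%nat -> (1 <= n)%nat -> (i <= 2 * h)%nat ->
  let z := zroot n (Z.of_nat i - Z.of_nat h) in 0 < Re z /\ tan theta * Rabs (Im z) < Re z.
Proof.
  intros Hh Hn Hi z. destruct (zroot_exp n Hn) as [p [_ Hz]]. unfold z. rewrite Hz.
  apply Cexp_cone; [apply theta_bound|].
  rewrite im_plus, <- RtoC_inv, im_scal_l by (apply Rgt_not_eq, INR_N_pos).
  unfold Cminus. rewrite im_plus, im_opp, im_RtoC. fold eta.
  replace (RtoC PI * Ci * IZR (Z.of_nat i - Z.of_nat h) / INR N)%C with (RtoC (PI * IZR (Z.of_nat i - Z.of_nat h) / INR N) * Ci)%C.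
  2:{ rewrite RtoC_div, RtoC_mult by (apply Rgt_not_eq, INR_N_pos). field. exact INR_N_nz. }
  rewrite im_scal_l. simpl (Im Ci). rewrite Rmult_1_r.
  set (kk := IZR (Z.of_nat i - Z.of_nat h)).
  assert (Hk : Rabs kk <= INR h).
  { unfold kk. rewrite minus_IZR, <- !INR_IZR_INZ. apply Rabs_le.
    assert (INR i <= INR (2 * h)) by now apply le_INR. rewrite mult_INR in H. simpl in H. pose proof (pos_INR i). lra. }
  replace (/ INR N * (0 + - eta) + PI * kk / INR N) with ((- eta + PI * kk) / INR N) by (field; apply Rgt_not_eq, INR_N_pos).
  unfold Rdiv at 1. rewrite Rabs_mult, Rabs_inv, (Rabs_pos_eq (INR N)) by (left; apply INR_N_pos).
  pose proof INR_N_pos as HNp.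
  apply (Rmult_lt_reg_r (INR N)); [assumption|]. rewrite Rmult_assoc, Rinv_l, Rmult_1_r by lra.
  rewrite Rmult_minus_distr_r, (Rmult_comm theta), N_theta.
  assert (EN : INR N = 2 * INR h + 1) by (rewrite Hh, plus_INR, mult_INR; simpl; ring).
  pose proof PI_RGT_0.
  assert (Rabs (- eta + PI * kk) <= Rabs eta + PI * INR h).
  { eapply Rle_trans; [apply Rabs_triang|]. rewrite Rabs_Ropp, Rabs_mult, (Rabs_pos_eq PI) by lra.
    apply Rplus_le_compat_l, Rmult_le_compat_l; lra. }
  pose proof eta_bound. rewrite EN. nra.
Qed.

(** Over N consecutive integers k the squares of the roots form one full orbit B om^i with B^N = X^2
    and [om] a primitive N-th root of unity, so partial fractions apply to u^2. *)
Lemma roots_average (u : C) n (h : nat) : N = (2 * h + 1)%nat -> (1 <= n)%nat ->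
  (u ^ (2 * N) - Xarg n * Xarg n)%C <> 0%C ->
  csum (fun i => u / (u * u - zroot n (Z.of_nat i - Z.of_nat h) * zroot n (Z.of_nat i - Z.of_nat h)))%C (2 * h)
    = (INR N * (u ^ (2 * N - 1) / (u ^ (2 * N) - Xarg n * Xarg n)))%C.
Proof.
  intros Hh Hn HD. destruct (zroot_exp n Hn) as [p [HX Hz]].
  set (om := Cexp (2 * PI * Ci / INR N)).
  set (B := Cexp (2 * (/ INR N * (RtoC p - L0 y)) - 2 * PI * Ci * INR h / INR N)).
  assert (EZ : forall i, (zroot n (Z.of_nat i - Z.of_nat h) * zroot n (Z.of_nat i - Z.of_nat h))%C = (B * om ^ i)%C).
  { intros i. rewrite Hz. unfold om, B. rewrite Cexp_pow, <- !Cexp_plus. f_equal.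
    rewrite minus_IZR, <- !INR_IZR_INZ, RtoC_minus. field. exact INR_N_nz. }
  assert (C2PI : forall k : nat, Cexp (2 * PI * Ci * INR k) = 1%C).
  { intros k. unfold Cexp.
    replace (Re (2 * PI * Ci * INR k)) with 0 by (unfold Re; simpl; ring).
    replace (Im (2 * PI * Ci * INR k)) with (0 + 2 * INR k * PI) by (unfold Im; simpl; ring).
    rewrite cos_period, sin_period, exp_0, cos_0, sin_0. apply C_ext; simpl; ring. }
  assert (ES : S (2 * h) = N) by lia.
  assert (Hom : (om ^ N)%C = 1%C).
  { unfold om. rewrite Cexp_pow. rewrite <- (C2PI 1%nat). f_equal. simpl (INR 1). field. exact INR_N_nz. }
  assert (HB : (B ^ N)%C = (Xarg n * Xarg n)%C).
  { unfold B. rewrite Cexp_pow.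
    replace (INR N * (2 * (/ INR N * (p - L0 y)) - 2 * PI * Ci * INR h / INR N))%C
      with ((p - L0 y) + (p - L0 y) + - (2 * PI * Ci * INR h))%C by (field; exact INR_N_nz).
    rewrite !Cexp_plus, Cexp_opp, C2PI, HX. field. }
  assert (Hj : forall j, (0 < j <= 2 * h)%nat -> (om ^ j)%C <> 1%C).
  { intros j Hj E. unfold om in E. rewrite Cexp_pow in E.
    apply (f_equal Re) in E. change (exp (Re (INR j * (2 * PI * Ci / INR N))%C) * cos (Im (INR j * (2 * PI * Ci / INR N))%C) = 1) in E.
    assert (E1 : (INR j * (2 * PI * Ci / INR N))%C = (RtoC (2 * (PI * INR j / INR N)) * Ci)%C).
    { rewrite !RtoC_mult, RtoC_div, RtoC_mult by (apply Rgt_not_eq, INR_N_pos). field. exact INR_N_nz. }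
    rewrite E1, re_scal_l, im_scal_l in E. simpl (Re Ci) in E. simpl (Im Ci) in E. simpl (Re 1) in E.
    rewrite Rmult_0_r, exp_0, Rmult_1_l, Rmult_1_r, cos_2a_sin in E.
    assert (Hs : 0 < sin (PI * INR j / INR N)).
    { pose proof PI_RGT_0. pose proof INR_N_pos as HNp.
      assert (0 < INR j) by (apply lt_0_INR; lia). assert (INR j < INR N) by (apply lt_INR; lia).
      apply sin_gt_0; [apply Rdiv_lt_0_compat; nra|].
      apply (Rmult_lt_reg_r (INR N)); [assumption|]. unfold Rdiv; rewrite Rmult_assoc, Rinv_l, Rmult_1_r by lra. nra. }
    nra. }
  rewrite <- ES in Hom.
  assert (Eu : ((u * u) ^ N)%C = (u ^ (2 * N))%C) by (rewrite Cpow_mult_r; f_equal; simpl; ring).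
  pose proof (partial_fractions_roots (u * u) B om (2 * h) Hom Hj) as PF.
  rewrite ES, HB, Eu in PF. specialize (PF HD).
  rewrite (csum_ext _ (fun i => u * / (u * u - B * om ^ i))%C) by (intros i _; rewrite EZ; reflexivity).
  rewrite csum_scal, PF.
  replace (u ^ (2 * N - 1))%C with (u * (u * u) ^ (2 * h))%C.
  - unfold Cdiv. ring.
  - replace (2 * N - 1)%nat with (S (2 * (2 * h))) by lia. rewrite Cpow_S, (Cpow_mult_r u 2). f_equal. f_equal. simpl; ring.
Qed.

(** The bracket of the theorem with both sums indexed from 0; for odd [N], [Nat.div2 N] is
    (N-1)/2. *)
Definition bracket (n : nat) : C :=
  (/ INR N * csum (fun i => sinhShi_coshChi (zroot n (Z.of_nat i - Z.of_nat (Nat.div2 N)))) (2 * Nat.div2 N)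
    + csum (fun j => INR (fact (2 * N * S j - 1)) * / Xarg n ^ (2 * S j))%C (pred m))%C.

Lemma Xarg_dirichlet i j : Xarg (dirichlet_index N i j) = (RtoC (freq i) ^ N * cpole y j)%C.
Proof.
  unfold Xarg, dirichlet_index, cpole, freq. rewrite mult_INR, pow_INR, !RtoC_mult, RtoC_pow, !Cpow_mult_l, !Cpow_add_r, !Cpow_1_r. field. exact y0.
Qed.

(** For n = d1^N d2 one has X = (2 pi d1)^N c. The substitution u = +- 2 pi i d1 x therefore takes
    the rays of sinh Shi - cosh Chi to those of [Wray] and u^(2N) - X^2 to -(2 pi d1)^(2N) (x^(2N) +
    c^2). *)
Lemma bracket_Wsum i j :
  bracket (dirichlet_index N i j) = (/ 2 * RtoC ((-1) ^ m) / (cpole y j * cpole y j) ^ m * Wsum N m y (tan theta) i j)%C.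
Proof.
  set (n := dirichlet_index N i j).
  assert (Hn : (1 <= n)%nat) by (pose proof (dirichlet_index_ge N m HN Hm i j); unfold n; lia).
  assert (Hh : N = (2 * Nat.div2 N + 1)%nat).
  { destruct Hodd as [h ->]. rewrite Nat.add_1_r, Nat.div2_succ_double. lia. }
  set (h := Nat.div2 N) in *.
  set (tau := tan theta). pose proof theta_bound as Ht. assert (Htau : 0 < tau) by (apply tan_gt_0; lra).
  set (X := Xarg n). set (c := cpole y j). pose proof (freq_pos i) as Hf.
  assert (EX : X = (RtoC (freq i) ^ N * c)%C) by apply Xarg_dirichlet.
  assert (Hfc : RtoC (freq i) <> 0%C) by (apply RtoC_neq_0; lra).
  assert (Hc : c <> 0%C).
  { unfold c, cpole. intros E. pose proof (freq_pos j). assert (RtoC (freq j) = 0%C) by (replace (RtoC (freq j)) with (freq j / y * y)%C by (field; exact y0); rewrite E; ring).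
    apply RtoC_inj in H0. lra. }
  assert (HX0 : X <> 0%C) by (rewrite EX; apply Cmult_neq_0; [now apply Cpow_nz|exact Hc]).
  pose proof (fun i0 Hi => zroot_cone n h i0 Hh Hn Hi) as Hcone.
  assert (HU : forall sg, sg * sg = 1 ->
    (/ INR N * csum (fun i => IV (F_ker theta sg (zroot n (Z.of_nat i - Z.of_nat h)))) (2 * h)
      + csum (fun j => INR (fact (2 * N * S j - 1)) * / X ^ (2 * S j))%C (pred m))%C
     = (RtoC ((-1) ^ m) / (c * c) ^ m * Wray N m y tau i j sg)%C).
  { intros sg Hsg. set (e := (tau, sg) : C).
    assert (Ee : e = (Ci * sg * ray tau sg)%C).
    { unfold e, ray. apply C_ext; unfold Re, Im; simpl; [|ring]. transitivity (sg * sg * tau); [rewrite Hsg; ring|ring]. }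
    assert (HI1 : IInf (fun s => / INR N * csum (fun i0 => F_ker theta sg (zroot n (Z.of_nat i0 - Z.of_nat h)) s) (2 * h))%C
       (/ INR N * csum (fun i0 => IV (F_ker theta sg (zroot n (Z.of_nat i0 - Z.of_nat h)))) (2 * h))%C).
    { apply IInf_scal.
      (* [IInf_csum] asks for convergence at every index, the cone condition holds up to 2h only;
         capping the index settles the rest. *)
      set (zc := fun i0 => zroot n (Z.of_nat (Nat.min i0 (2 * h)) - Z.of_nat h)).
      replace (csum (fun i0 => IV (F_ker theta sg (zroot n (Z.of_nat i0 - Z.of_nat h)))) (2 * h))
        with (csum (fun i0 => IV (F_ker theta sg (zc i0))) (2 * h)).
      2:{ apply csum_ext; intros k Hk. unfold zc. rewrite Nat.min_l by exact Hk. reflexivity. }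
      eapply IInf_ext; [|apply (IInf_csum (fun i0 => F_ker theta sg (zc i0)))].
      - intros r _. apply csum_ext; intros k Hk. unfold zc. rewrite Nat.min_l by exact Hk. reflexivity.
      - intros i0. destruct (Hcone (Nat.min i0 (2 * h)) (Nat.le_min_r _ _)) as [C1 C2].
        apply (IInf_F_ker (zc i0) theta Ht C1 C2), Hsg. }
    (* The factorials (2Nj - 1)! are written as Gamma integrals along the same ray, so that the
       bracket becomes one integral. *)
    assert (HI2 : IInf (fun s : R => csum (fun j0 => / X ^ (2 * S j0) * (e * ((s * e) ^ (2 * N * S j0 - 1) * Cexp (- (1 * (s * e))))))%C (pred m))
       (csum (fun j0 => / X ^ (2 * S j0) * (INR (fact (2 * N * S j0 - 1)) / 1 ^ S (2 * N * S j0 - 1)))%C (pred m))).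
    { apply (IInf_csum (fun j0 s => / X ^ (2 * S j0) * (e * ((s * e) ^ (2 * N * S j0 - 1) * Cexp (- (1 * (s * e))))))%C).
      intros j0. apply IInf_scal, IInf_gamma. rewrite Cmult_1_l. exact Htau. }
    pose proof (IInf_scale _ _ (freq i) Hf (IInf_plus _ _ _ _ HI1 HI2)) as HI.
    assert (HW := IInf_scal _ _ (RtoC ((-1) ^ m) / (c * c) ^ m)%C
      (IInf_Wray N m y tau kappa HN Hm Htau kappa_pos sector_bound i j sg Hsg)).
    rewrite (csum_ext (fun j0 => / X ^ (2 * S j0) * (INR (fact (2 * N * S j0 - 1)) / 1 ^ S (2 * N * S j0 - 1)))%C
       (fun j0 => INR (fact (2 * N * S j0 - 1)) * / X ^ (2 * S j0))%C) in HI.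
    2:{ intros k _. rewrite Cpow_1_l. unfold Cdiv. rewrite <- RtoC_inv, Rinv_1 by lra. ring. }
    refine (IInf_unique _ _ _ HI _). eapply IInf_ext; [|exact HW].
    intros r Hr; cbv beta. set (x := (RtoC r * ray tau sg)%C).
    set (u := (RtoC (freq i * r) * e)%C).
    assert (Eu : u = (Ci * sg * freq i * x)%C) by (unfold u, x; rewrite Ee, RtoC_mult; ring).
    assert (ECi : (Ci * sg * (Ci * sg))%C = (- RtoC 1)%C).
    { apply C_ext; simpl; [|ring]. transitivity (- (sg * sg)); [ring|rewrite Hsg; ring]. }
    pose proof (denominator_nz N m y tau kappa HN Hm Htau kappa_pos sector_bound j sg r Hsg ltac:(lra)) as Hnz.
    fold x in Hnz. fold c in Hnz.
    assert (Hm1 : (RtoC (-1)) = (- RtoC 1)%C) by (rewrite <- RtoC_opp; reflexivity).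
    assert (EmN : (RtoC (-1) ^ N)%C = RtoC (-1)).
    { rewrite <- RtoC_pow. f_equal. destruct Hodd as [h' ->]. rewrite pow_add, pow_1_even, pow_1. ring. }
    assert (Eu2N : (u ^ (2 * N))%C = (- (RtoC (freq i) ^ N * RtoC (freq i) ^ N) * x ^ (2 * N))%C).
    { rewrite Eu, Cpow_mult_l, Cpow_mult_l, (Cpow_mult_r (Ci * sg)).
      replace ((Ci * sg) ^ 2)%C with (RtoC (-1)) by (rewrite Hm1, <- ECi; simpl; ring).
      rewrite EmN, Hm1. replace (2 * N)%nat with (N + N)%nat by lia. rewrite (Cpow_add_r (RtoC (freq i))). ring. }
    assert (HfN : (RtoC (freq i) ^ N)%C <> 0%C) by now apply Cpow_nz.
    assert (ED : (u ^ (2 * N) - X * X)%C = (- (RtoC (freq i) ^ N * RtoC (freq i) ^ N) * (x ^ (2 * N) + c * c))%C).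
    { rewrite Eu2N, EX. ring. }
    assert (HD : (u ^ (2 * N) - X * X)%C <> 0%C).
    { rewrite ED. apply Cmult_neq_0; [|exact Hnz]. intros Z.
      apply (Cmult_neq_0 _ _ HfN HfN). replace (freq i ^ N * freq i ^ N)%C with (- - (freq i ^ N * freq i ^ N))%C by ring. rewrite Z; ring. }
    assert (EF : csum (fun i0 => F_ker theta sg (zroot n (Z.of_nat i0 - Z.of_nat h)) (freq i * r)) (2 * h)
      = (e * Cexp (- u) * (INR N * (u ^ (2 * N - 1) / (u ^ (2 * N) - X * X))))%C).
    { pose proof (roots_average u n h Hh Hn HD) as RA. fold X in RA. rewrite <- RA, <- csum_scal. apply csum_ext; intros k _.
      unfold F_ker. fold tau. fold e. fold u. unfold Cdiv. ring. }
    rewrite EF.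
    rewrite (csum_ext _ (fun j0 => e * Cexp (- u) * (u ^ (2 * N * S j0 - 1) * / X ^ (2 * S j0)))%C).
    2:{ intros k _. fold u. rewrite Cmult_1_l. ring. }
    rewrite csum_scal.
    transitivity (RtoC (freq i) * (e * Cexp (- u) * (u ^ (2 * N - 1) / (u ^ (2 * N) - X * X) + csum (fun j0 => u ^ (2 * N * S j0 - 1) * / X ^ (2 * S j0))%C (pred m))))%C.
    2:{ field. split; [exact HD|exact INR_N_nz]. }
    rewrite (tail_telescope u X N (pred m) HN HX0 HD).
    replace (S (pred m)) with m by lia.
    unfold Wker. fold x. fold c.
    replace (mu sg i * x)%C with u by (rewrite Eu; unfold mu; ring).
    rewrite ED.
    (* The factor [e] completes the odd power of [Ci * sg] to the even exponent 2N(m+1), leaving the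
       real sign (-1)^(N(m+1)), which is -(-1)^m for odd [N]. *)
    assert (Eue : (freq i * e * u ^ (2 * N * m + 2 * N - 1))%C
        = (ray tau sg * RtoC ((-1) ^ (N * (m + 1))) * (freq i ^ N * freq i ^ N) ^ (m + 1) * x ^ (expo N m + N))%C).
    { set (q := (2 * N * m + 2 * N - 1)%nat).
      assert (Eq : (expo N m + N)%nat = q) by (unfold expo, q; lia). rewrite Eq.
      assert (ESq : S q = (2 * (N * (m + 1)))%nat) by (unfold q; nia).
      transitivity (ray tau sg * (Ci * sg * freq i) ^ S q * x ^ q)%C.
      - rewrite Eu, Ee, !Cpow_mult_l, Cpow_S. rewrite ?Cpow_mult_l, ?Cpow_S. ring.
      - rewrite ESq, (Cpow_mult_l (Ci * sg)), (Cpow_mult_r (Ci * sg)).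
        replace ((Ci * sg) ^ 2)%C with (RtoC (-1)) by (rewrite Hm1, <- ECi; simpl; ring).
        rewrite <- (RtoC_pow (-1)). rewrite <- (Cpow_add_r _ N N), <- (Cpow_mult_r (freq i)).
        replace ((N + N) * (m + 1))%nat with (2 * (N * (m + 1)))%nat by lia. ring. }
    assert (Esg : RtoC ((-1) ^ (N * (m + 1))) = (- RtoC ((-1) ^ m))%C).
    { rewrite <- RtoC_opp. f_equal. destruct Hodd as [h' Hh'].
      replace (N * (m + 1))%nat with (2 * (h' * (m + 1)) + (m + 1))%nat by (rewrite Hh'; lia).
      rewrite pow_add, pow_1_even, pow_add, pow_1. ring. }
    assert (EX2 : (X ^ (2 * m))%C = ((freq i ^ N * freq i ^ N) ^ m * (c * c) ^ m)%C).
    { rewrite Cpow_mult_r, <- Cpow_mult_l. f_equal. rewrite EX. simpl. ring. }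
    set (ff := (freq i ^ N * freq i ^ N)%C) in *.
    assert (Hff : ff <> 0%C) by now apply Cmult_neq_0.
    assert (Hffm : (ff ^ m)%C <> 0%C) by now apply Cpow_nz.
    assert (Hccm : ((c * c) ^ m)%C <> 0%C) by (apply Cpow_nz, Cmult_neq_0; assumption).
    rewrite EX2.
    transitivity (freq i * e * u ^ (2 * N * m + 2 * N - 1) * Cexp (- u) / (ff ^ m * (c * c) ^ m * (- ff * (x ^ (2 * N) + c * c))))%C.
    - rewrite Eue, Esg, (Cpow_add_r ff m 1), (Cpow_1_r ff). field. repeat split; assumption.
    - field. repeat split; assumption. }
  assert (S1 : 1 * 1 = 1) by ring. assert (S2 : -1 * -1 = 1) by ring.
  unfold Wsum. fold tau. fold c.
  transitivity ((RtoC ((-1) ^ m) / (c * c) ^ m * Wray N m y tau i j 1 + RtoC ((-1) ^ m) / (c * c) ^ m * Wray N m y tau i j (-1)) / 2)%C.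
  - rewrite <- (HU 1 S1), <- (HU (-1) S2). unfold bracket. fold h. fold X.
    rewrite (csum_ext (fun i0 => sinhShi_coshChi (zroot n (Z.of_nat i0 - Z.of_nat h)))
      (fun i0 => / 2 * (IV (F_ker theta 1 (zroot n (Z.of_nat i0 - Z.of_nat h))) + IV (F_ker theta (-1) (zroot n (Z.of_nat i0 - Z.of_nat h)))))%C).
    + rewrite csum_scal, csum_plus. field. exact INR_N_nz.
    + intros k Hk. destruct (Hcone k Hk) as [C1 C2].
      rewrite (proj2 (IInf_F_ker _ theta Ht C1 C2)). field.
  - assert (Hccm : ((c * c) ^ m)%C <> 0%C) by (apply Cpow_nz, Cmult_neq_0; assumption). field. exact Hccm.
Qed.

End Angles.

(** * From sums over pairs back to the two arithmetic functions *)

Lemma csum_scal_r (c : C) (a : nat -> C) n : csum (fun k => a k * c)%C n = (csum a n * c)%C.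
Proof.
  rewrite (csum_ext _ (fun k => c * a k)%C) by (intros; ring). rewrite csum_scal. ring.
Qed.

(** The exponent [a] is the natural number [expo], so principal powers are ordinary ones; a divisor
    d1^N of n fixes the cofactor d2, and the inner sum has a single term. *)
Lemma sigma_pow_dirichlet (N m n : nat) (y : C) : (1 <= N)%nat -> (1 <= m)%nat ->
  (sigma_pow N (RtoC (2 * INR N * INR m - 1 + INR N)) (S n) * Cexp (- (INR (S n) * y)))%C
   = dirichlet_sum N (lam N m y) n.
Proof.
  intros HN Hm. unfold sigma_pow, dirichlet_sum. rewrite sum_n_m_csum, <- csum_scal_r.
  apply csum_ext; intros i Hi.
  assert (Ea : 2 * INR N * INR m - 1 + INR N = INR (expo N m)).
  { unfold expo. rewrite plus_INR, !mult_INR. destruct N as [|N']; [lia|]. rewrite S_INR. simpl. ring. }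
  rewrite Ea, Cpower_nat by (apply lt_0_INR; lia).
  set (P := (S i ^ N)%nat). assert (HP : (P <> 0)%nat) by (apply Nat.pow_nonzero; lia).
  destruct (Nat.eqb_spec (S n mod P) 0) as [E|E].
  - apply Nat.Div0.mod_divides in E. destruct E as [q Eq]. destruct q as [|j0]; [lia|].
    rewrite (csum_ext _ (fun j => if (j =? j0)%nat then lam N m y i j else 0%C)).
    + rewrite csum_delta by nia. unfold lam, sexp.
      f_equal. f_equal. f_equal. rewrite Eq, mult_INR. unfold P. rewrite pow_INR, RtoC_mult, RtoC_pow. ring.
    + intros j _. unfold dirichlet_index. fold P.
      destruct (Nat.eqb_spec (P * S j) (S n)), (Nat.eqb_spec j j0); try reflexivity; nia.
  - rewrite csum_zero; [ring|]. intros j _. unfold dirichlet_index. fold P.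
    destruct (Nat.eqb_spec (P * S j) (S n)) as [H|]; [|reflexivity].
    exfalso; apply E. rewrite <- H, Nat.mul_comm. apply Nat.Div0.mod_mul.
Qed.

(** Here (1 + a) / N - 1 = 2m, so the weight d2^(2m) cancels the power of d2 in the factor c^(-2m)
    of [bracket_Wsum] and leaves the constant (y / (2 pi))^(2m). *)
Lemma S_pow_dirichlet (N m n : nat) (y : C) : Nat.Odd N -> (1 <= m)%nat -> 0 < Re y ->
  (S_pow N (RtoC (2 * INR N * INR m - 1 + INR N)) (S n) * bracket N m y (S n))%C
   = (/ 2 * RtoC ((-1) ^ m) * (y / (2 * PI)) ^ (2 * m) * dirichlet_sum N (Wsum N m y (tan (theta N y))) n)%C.
Proof.
  intros Hodd Hm Hy. assert (HN : (1 <= N)%nat) by (destruct Hodd as [h ->]; lia).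
  assert (y0 : y <> 0%C) by (intros E; rewrite E in Hy; simpl in Hy; lra).
  assert (HN0 : INR N <> 0) by (apply not_0_INR; lia).
  unfold S_pow, dirichlet_sum. rewrite sum_n_m_csum, <- csum_scal_r, <- csum_scal.
  apply csum_ext; intros i Hi. rewrite sum_n_m_csum, <- csum_scal_r, <- csum_scal.
  apply csum_ext; intros j Hj.
  change (S i ^ N * S j)%nat with (dirichlet_index N i j).
  destruct (Nat.eqb_spec (dirichlet_index N i j) (S n)) as [E|_]; [|ring].
  replace ((1 + RtoC (2 * INR N * INR m - 1 + INR N)) / INR N - 1)%C with (RtoC (INR (2 * m))).
  2:{ assert (RtoC (INR N) <> 0%C) by now apply RtoC_neq_0.
      rewrite mult_INR. simpl (INR 2). rewrite !RtoC_plus, RtoC_minus, !RtoC_mult, RtoC_plus. field. assumption. }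
  rewrite Cpower_nat by (apply lt_0_INR; lia).
  rewrite <- E, bracket_Wsum by assumption.
  assert (HPI : RtoC PI <> 0%C) by (apply RtoC_neq_0; pose proof PI_RGT_0; lra).
  assert (HS : RtoC (INR (S j)) <> 0%C) by (apply RtoC_neq_0, not_0_INR; lia).
  assert (EC : cpole y j = (INR (S j) / (y / (2 * PI)))%C).
  { unfold cpole, freq. rewrite !RtoC_mult. field. split; assumption. }
  set (v := (y / (2 * PI))%C) in *.
  assert (Hv : v <> 0%C).
  { unfold v. intros Z. apply y0. replace y with (y / (2 * PI) * (2 * PI))%C by (field; assumption). rewrite Z; ring. }
  replace ((cpole y j * cpole y j) ^ m)%C with (INR (S j) ^ (2 * m) * / v ^ (2 * m))%C.
  - assert (RtoC (INR (S j)) ^ (2 * m) <> 0)%C by now apply Cpow_nz.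
    assert (v ^ (2 * m) <> 0)%C by now apply Cpow_nz. field. split; assumption.
  - rewrite EC. unfold Cdiv. rewrite <- Cpow_inv by assumption. rewrite <- Cpow_mult_l, Cpow_mult_r. f_equal. simpl; ring.
Qed.

Lemma cseries_eq a b l k : cseries a l -> (forall n, b n = a n) -> l = k -> cseries b k.
Proof. intros H E <-. eapply cseries_ext; [|exact H]. intros; symmetry; apply E. Qed.

Theorem theorem2p7 (N m : nat) (y : C)
    (hN : Nat.Odd N) (hm : (1 <= m)%nat) (hy : 0 < Re y) :
  let a : C := RtoC (2 * INR N * INR m - 1 + INR N) in
  let X (n : nat) : C := (RtoC (2 * PI) ^ (N + 1) * INR n / y)%C in
  let h : Z := ((Z.of_nat N - 1) / 2)%Z in
  let lhs_term (n : nat) : C := (sigma_pow N a n * Cexp (- (INR n * y)))%C in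
  let rhs_term (n : nat) : C :=
    (S_pow N a n *
      (/ INR N *
         sum_Z (- h) h (fun k : Z =>
           sinhShi_coshChi
             (Cpower (X n) (/ INR N) * Cexp (RtoC PI * Ci * IZR k / INR N)))
       + sum_n_m (fun j : nat => INR (fact (2 * N * j - 1)) * / (X n) ^ (2 * j))
           1 m))%C in
  exists L M : C,
    is_series (fun n => lhs_term (S n)) L /\
    is_series (fun n => rhs_term (S n)) M /\
    (L + bernoulli (2 * N * m) / (2 * INR N * INR m * y)
       - INR (fact (2 * m)) * zeta (2 * INR m + 1)
           / (INR N * y ^ (2 * m + 1))
     = 2 * (- (1)) ^ m / PI * (2 * PI / y) ^ (2 * m + 1) * M)%C.
Proof.
  intros a X h lhs_term rhs_term.
  assert (HN : (1 <= N)%nat) by (destruct hN as [h' ->]; lia).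
  assert (y0 : y <> 0%C) by (intros E; rewrite E in hy; simpl in hy; lra).
  assert (HN0 : RtoC (INR N) <> 0%C) by (apply RtoC_neq_0, not_0_INR; lia).
  assert (Hm0 : RtoC (INR m) <> 0%C) by (apply RtoC_neq_0, not_0_INR; lia).
  assert (HPI : RtoC PI <> 0%C) by (apply RtoC_neq_0; pose proof PI_RGT_0; lra).
  pose proof (theta_bound N m y hN hm) as Hth.
  destruct (ray_total N m y (tan (theta N y)) (kappa N y) HN hm ltac:(apply tan_gt_0; lra)
    (kappa_pos N m y hN hm) (sector_bound N m y hN hm hy) hN) as [A [HA HW]].
  (* The constant of [S_pow_dirichlet]; it determines the second sum from the value of the [Wsum]
     series. *)
  set (K := (/ 2 * RtoC ((-1) ^ m) * (y / (2 * PI)) ^ (2 * m))%C).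
  exists A, (K * (y / 2 * (A - INR (fact (2 * m)) * zeta (2 * INR m + 1) / (INR N * y ^ (2 * m + 1))
        + bernoulli (2 * N * m) / (2 * INR N * INR m * y))))%C.
  split; [|split].
  - apply cseries_is_series. eapply cseries_eq; [exact HA| |reflexivity].
    intros n. apply sigma_pow_dirichlet; assumption.
  - apply cseries_is_series. eapply cseries_eq; [apply cseries_scal, HW| |reflexivity].
    intros n. cbv beta. unfold K. rewrite <- S_pow_dirichlet by assumption.
    unfold rhs_term. f_equal. unfold bracket. f_equal.
    + f_equal. replace h with (Z.of_nat (Nat.div2 N)).
      * rewrite sum_Z_csum. reflexivity.
      * unfold h. destruct hN as [h' ->]. rewrite Nat.add_1_r, Nat.div2_succ_double.
        apply Z.div_unique with 0%Z; lia.
    + replace m with (S (pred m)) at 1 by lia. rewrite sum_n_m_csum. reflexivity.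
  - unfold K. replace (RtoC ((-1) ^ m)) with ((- (1)) ^ m)%C.
    2:{ rewrite RtoC_pow. f_equal. rewrite <- RtoC_opp. reflexivity. }
    set (sg := ((- (1)) ^ m)%C).
    assert (Esg : (sg * sg)%C = 1%C).
    { unfold sg. rewrite <- Cpow_mult_l. replace (- (1) * - (1))%C with (RtoC 1) by ring. apply Cpow_1_l. }
    set (v := (y / (2 * PI))%C).
    assert (Hv : v <> 0%C).
    { unfold v. intros Z. apply y0. replace y with (y / (2 * PI) * (2 * PI))%C by (field; assumption). rewrite Z; ring. }
    replace (2 * PI / y)%C with (/ v)%C by (unfold v; field; split; assumption).
    replace (2 * m + 1)%nat with (S (2 * m)) at 2 by lia. rewrite Cpow_S.
    rewrite Cpow_inv by assumption.
    set (Q := (A - INR (fact (2 * m)) * zeta (2 * INR m + 1) / (INR N * y ^ (2 * m + 1)) + bernoulli (2 * N * m) / (2 * INR N * INR m * y))%C).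
    assert (Hvm : (v ^ (2 * m) <> 0)%C) by now apply Cpow_nz.
    (* The left side is [Q] up to the order of its terms. On the right the two signs cancel, the
       powers of [v] reduce to 1 / v, and (2 / pi) (1 / 2) (y / 2) / v = 1. *)
    transitivity Q; [unfold Q; ring|].
    transitivity (sg * sg * (/ PI * (y / 2) / v) * Q)%C.
    + rewrite Esg. unfold v. field. split; assumption.
    + set (vm := (v ^ (2 * m))%C) in *. field. repeat split; assumption.
Qed.
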